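(* Let $n\ge2$ and $c\in(-2,2)$. The group $\widehat G_0\cong\mathrm{Aut}(U_0)$ acts freely and properly on $R^c_{U_0}(F_n,S)$, so $X^c_{U_0}(F_n,S)=R^c_{U_0}(F_n,S)/\widehat G_0$ has a natural smooth structure, and there is a diffeomorphism $\mathcal X^{c,red}(F_n,S)\to X^c_{U_0}(F_n,S)$. Under this identification, the restriction $\pi_c\colon\mathcal X^{c,red}(F_n,S)\to X^{c,red}(F_n,S)$ corresponds to the map $X^c_{U_0}(F_n,S)\to X^{c,red}(F_n,S)$ taking $[\rho]$ to its character.
   Context: $F_n$ is free on $S=\{s_1,\dots,s_n\}$. $U_0\le\mathrm{SL}_2(\mathbb C)$ is the group of matrices $\begin{pmatrix}a&b\\0&\bar a\end{pmatrix}$ with $a,b\in\mathbb C$, $|a|=1$; $\widehat G_0=\mathrm{Aut}(U_0)$ is its group of Lie group automorphisms (isomorphic to the group $\mathrm{Sim}(\mathbb E^2)$ of similarities of the Euclidean plane), acting on representations by composition. A representation into $U_0$ is fully reducible if it is conjugate (in $U_0$) to one with diagonal image. $R^c_{U_0}(F_n,S)$ is the set of $\rho\colon F_n\to U_0$ with $\operatorname{tr}\rho(s_i)=c$ for all $i$ that are not fully reducible. $X^c(F_n,S)$ is the set of real-valued characters of representations $\rho\colon F_n\to\mathrm{SL}_2(\mathbb C)$ with all $\operatorname{tr}\rho(s_i)=c$, and $X^{c,red}(F_n,S)$ is its finite subset of characters of reducible representations. The resolution. For $t\in\mathbb R$ let $B_t=t(x^2+y^2)+z^2$ on $\mathbb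 R^3$ and $\overline Q_t=\{B_t=1\}$. Let $\overline{\mathcal R}_n$ be the smooth manifold of $(t,v_1,\dots,v_n)\in\mathbb R\times(\mathbb R^3)^n$ with all $v_i\in\overline Q_t$ and $v_i\notin\{v_j,-v_j\}$ for some $i,j$. $\mathbb R_{>0}$ acts by $s\cdot(t,v_1,\dots,v_n)=(t/s^2,s\cdot v_1,\dots,s\cdot v_n)$, $s\cdot(x,y,z)=(sx,sy,z)$. For $t\ne0$, $G_t\le\mathrm{SL}_3(\mathbb R)$ is the subgroup preserving $B_t$, and $G_0$ is the group of matrices $\begin{pmatrix}A&b\\0&\det A\end{pmatrix}$, $A\in\mathrm O(2)$, $b\in\mathbb R^2$; $G_t$ acts diagonally on the slice with that $t$. The quotient $\mathcal X^c(F_n,S)$ of $\overline{\mathcal R}_n$ by $\mathbb R_{>0}$ and all the $G_t$ is a smooth $(2n-3)$-manifold with the unique smooth structure making the quotient map a submersion. The smooth map $\pi_c\colon\mathcal X^c(F_n,S)\to X^c(F_n,S)$ sends the class of $(t,v_1,\dots,v_n)$ to the character of $s_i\mapsto(\cos\alpha)I+(\sin\alpha)\varphi_t(v_i)$, where $\alpha=\cos^{-1}(c/2)$ and $\varphi_t(x,y,z)=i\begin{pmatrix}z&-x-iy\\-t(x-iy)&-z\end{pmatrix}$. $\mathcal X^{c,red}(F_n,S)=\pi_c^{-1}(X^{c,red}(F_n,S))$, which is the image of the locus $t=0$ and is a closed codimension-one submanifold. *)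

(* Defs.v *)
From HB Require Import structures.
From mathcomp Require Import all_boot all_order all_algebra.
From mathcomp Require Import complex.
From mathcomp Require Import all_classical all_reals all_analysis.
From Stdlib Require Import Relations.
Set Implicit Arguments.
Unset Strict Implicit.
Unset Printing Implicit Defensive.
Import Order.TTheory GRing.Theory Num.Theory.
Import numFieldNormedType.Exports.
Local Open Scope classical_set_scope.
Local Open Scope complex_scope.
Local Open Scope ring_scope.

(** * Smooth maps *)

(* All iterated directional derivatives up to order [k] exist and are
   continuous on [U]; on finite-dimensional spaces this is C^k. *)
Fixpoint Ck_on (R : realType) (V W : normedModType R) (k : nat)
    (U : set V) (f : V -> W) : Prop :=
  (forall x, U x -> {for x, continuous f}) /\
  (if k is k'.+1 then
     forall v : V, (forall x, U x -> derivable f x v) /\ Ck_on k' U ('D_v f)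
   else True).

Definition smooth_on (R : realType) (V W : normedModType R)
    (U : set V) (f : V -> W) : Prop :=
  open U /\ forall k, Ck_on k U f.

(* [f] is a smooth function of the coordinates [e] on [A]: near each point,
   [f = F \o e] on [A] with [F] smooth on an open set. For [e = id] this is the
   usual notion of a smooth map on an arbitrary subset of a vector space. *)
Definition smooth_wrt (R : realType) (T : Type) (V W : normedModType R)
    (A : set T) (e : T -> V) (f : T -> W) : Prop :=
  forall x, A x -> exists (O : set V) (F : V -> W),
    [/\ O (e x), smooth_on O F & forall y, A y -> O (e y) -> f y = F (e y)].

(** * Smooth manifolds *)

(* Manifolds are subsets [M] of a carrier type, with a maximal atlas. Only the
   values of [cmap c] on [cdom c] matter; a maximal atlas contains every
   extension of a chart to the carrier type. *)
Record chart (R : realType) (T : Type) (d : nat) := Chart {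
  cdom : set T;
  cmap :> T -> 'rV[R]_d }.

Section Manifolds.
Variable R : realType.

Definition is_chart T d (M : set T) (c : chart R T d) : Prop :=
  [/\ cdom c `<=` M, {in cdom c &, injective c} & open (c @` cdom c)].

Definition compatible T d d' (c : chart R T d) (c' : chart R T d') : Prop :=
  let A := cdom c `&` cdom c' in
  [/\ open (c @` A), open (c' @` A), smooth_wrt A c c' & smooth_wrt A c' c].

Definition mfd_open T d (M : set T) (At : set (chart R T d)) (O : set T) : Prop :=
  O `<=` M /\ forall c, At c -> open (c @` (O `&` cdom c)).

Definition mfd_hausdorff T d (M : set T) (At : set (chart R T d)) : Prop :=
  forall x y, M x -> M y -> x <> y -> exists O O',
    [/\ mfd_open M At O, mfd_open M At O', O x, O' y & O `&` O' = set0].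

Definition mfd_second_countable T d (M : set T) (At : set (chart R T d)) : Prop :=
  exists b : nat -> set T, (forall k, mfd_open M At (b k)) /\
    forall O x, mfd_open M At O -> O x -> exists2 k, b k x & b k `<=` O.

Definition smooth_structure T d (M : set T) (At : set (chart R T d)) : Prop :=
  [/\ At `<=` is_chart M,
      M `<=` \bigcup_(c in At) cdom c,
      (forall c c', At c -> At c' -> compatible c c'),
      (forall c, is_chart M c -> (forall c', At c' -> compatible c c') -> At c)
    & mfd_hausdorff M At /\ mfd_second_countable M At].

(* The maximal atlas of [N] as a [k]-dimensional embedded submanifold of the
   manifold with atlas [At]: charts of [N] defined on relatively open subsets
   and related to the ambient charts by maps smooth in both directions.
   [At] need not be maximal, and its charts need not have open images: with the
   single chart [(setT, e)], [e] injective, this is the atlas of [e @` N] as an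
   embedded submanifold of a vector space, pulled back to [N]. *)
Definition submfd_atlas T m k (At : set (chart R T m)) (N : set T) :
    set (chart R T k) :=
  [set c | is_chart N c /\ forall x, cdom c x -> exists a, At a /\
    [/\ cdom a x,
        (exists O : set 'rV[R]_m, [/\ open O, O (a x) &
           forall y, N y -> cdom a y -> O (a y) -> cdom c y]),
        smooth_wrt (cdom c `&` cdom a) c a
      & smooth_wrt (cdom c `&` cdom a) a c]].

Definition embedded_atlas T m k (e : T -> 'rV[R]_m) (N : set T) :
    set (chart R T k) :=
  submfd_atlas (k := k) [set Chart setT e] N.

Definition local_expr T T' d d' (f : T -> T') (c : chart R T d)
    (c' : chart R T' d') (F : 'rV[R]_d -> 'rV[R]_d') : Prop :=
  [/\ f @` cdom c `<=` cdom c', smooth_on (c @` cdom c) F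
    & forall y, cdom c y -> c' (f y) = F (c y)].

Definition smooth_map T T' d d' (M : set T) (At : set (chart R T d))
    (At' : set (chart R T' d')) (f : T -> T') : Prop :=
  forall x, M x -> exists c c' F,
    [/\ At c, At' c', cdom c x & local_expr f c c' F].

Definition submersion T T' d d' (M : set T) (At : set (chart R T d))
    (At' : set (chart R T' d')) (f : T -> T') : Prop :=
  forall x, M x -> exists c c' F,
    [/\ At c, At' c', cdom c x, local_expr f c c' F
      & range ('d F (c x)) = setT].

Definition diffeomorphism T T' d d' (M : set T) (At : set (chart R T d))
    (M' : set T') (At' : set (chart R T' d')) (f : T -> T') : Prop :=
  [/\ set_bij M M' f, smooth_map M At At' f
    & exists g, {in M, cancel f g} /\ smooth_map M' At' At g].

(** Quotients: the points of [quotient M E] are the [E]-classes in [M]. *)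

Definition eclass T (M : set T) (E : T -> T -> Prop) (x : T) : set T :=
  [set y | M y /\ E x y].

Definition quotient T (M : set T) (E : T -> T -> Prop) : set (set T) :=
  eclass M E @` M.

Definition quotient_structure T m d (M : set T) (At : set (chart R T m))
    (E : T -> T -> Prop) (Q : set (chart R (set T) d)) : Prop :=
  smooth_structure (quotient M E) Q /\ submersion M At Q (eclass M E).

End Manifolds.

(** * Matrices and the group U_0 *)

Definition mx2 (K : Type) (a b c d : K) : 'M[K]_2 :=
  \matrix_(i, j) if i == 0 then (if j == 0 then a else b)
                 else (if j == 0 then c else d).

Definition re_im (R : realType) m k (A : 'M[R[i]]_(m, k)) :
    'rV[R]_(m * k + m * k) :=
  row_mx (mxvec (map_mx (@complex.Re R) A)) (mxvec (map_mx (@complex.Im R) A)).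

Definition U0_pred (R : realType) : pred 'M[R[i]]_2 := fun A =>
  [&& A 1 0 == 0, A 1 1 == (A 0 0)^*%C & `|A 0 0| == 1].

Record U0 (R : realType) := MkU0 { U0mx :> 'M[R[i]]_2 ; _ : U0_pred U0mx }.

HB.instance Definition _ (R : realType) := [isSub for @U0mx R].
HB.instance Definition _ (R : realType) := [Choice of U0 R by <:].

Lemma mx2P (K : Type) (A B : 'M[K]_2) :
  A 0 0 = B 0 0 -> A 0 1 = B 0 1 -> A 1 0 = B 1 0 -> A 1 1 = B 1 1 -> A = B.
Proof.
move=> e00 e01 e10 e11; apply/matrixP => i j.
have o2 (k : 'I_2) : k = 0 \/ k = 1.
  by case: k => [[|[|//]] ?]; [left | right]; apply/val_inj.
by have [-> | ->] := o2 i; have [-> | ->] := o2 j.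
Qed.

Lemma mulmx2E (K : pzRingType) (A B : 'M[K]_2) i j :
  (A *m B) i j = A i 0 * B 0 j + A i 1 * B 1 j.
Proof.
rewrite mxE !big_ord_recl big_ord0 addr0.
by congr (A i _ * B _ j + A i _ * B _ j); apply/val_inj.
Qed.

Section U0Group.
Variable R : realType.
Implicit Types A B : U0 R.

Lemma U0_oneP : @U0_pred R 1%:M.
Proof. by rewrite /U0_pred !mxE conjc1 normr1 !eqxx. Qed.

Lemma U0_mulP A B : U0_pred (U0mx A *m U0mx B).
Proof.
case: A B => [A /and3P[/eqP A0 /eqP A1 /eqP Aa]] [B Bp] /=.
case/and3P: Bp => [/eqP B0 /eqP B1 /eqP Ba].
rewrite /U0_pred !mulmx2E A0 B0 A1 B1 !mul0r !mulr0 !addr0 add0r.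
by rewrite rmorphM normrM Aa Ba mulr1 !eqxx.
Qed.

Definition U0_invmx A : 'M[R[i]]_2 :=
  mx2 (U0mx A 1 1) (- U0mx A 0 1) 0 (U0mx A 0 0).

Lemma U0_invP A : U0_pred (U0_invmx A).
Proof.
case: A => [A Ap]; case/and3P: (Ap) => [/eqP A0 /eqP A1 /eqP Aa].
by rewrite /U0_pred !mxE /= A1 conjcK normcJ Aa !eqxx.
Qed.

Lemma U0_entries A :
  [/\ U0mx A 1 0 = 0, U0mx A 0 0 * U0mx A 1 1 = 1 & U0mx A 1 1 * U0mx A 0 0 = 1].
Proof.
case: A => [A /and3P[/eqP A0 /eqP A1 /eqP Aa]] /=; rewrite A1.
have Aj : A 0 0 * (A 0 0)^*%C = 1.
  by rewrite -[LHS]/(A 0 0 * (A 0 0)^*) -normCK Aa expr1n.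
by split=> //; rewrite mulrC.
Qed.

Definition U0_one : U0 R := MkU0 U0_oneP.
Definition U0_mul A B : U0 R := MkU0 (U0_mulP A B).
Definition U0_inv A : U0 R := MkU0 (U0_invP A).

Lemma U0_mulA : associative U0_mul.
Proof. by move=> A B D; apply/val_inj; rewrite /= mulmxA. Qed.

Lemma U0_mul1 : left_id U0_one U0_mul.
Proof. by move=> A; apply/val_inj; rewrite /= mul1mx. Qed.

Lemma U0_mulr1 : right_id U0_one U0_mul.
Proof. by move=> A; apply/val_inj; rewrite /= mulmx1. Qed.

Lemma U0_mulV : left_inverse U0_one U0_inv U0_mul.
Proof.
move=> A; have [A0 Ad Ad'] := U0_entries A.
by apply/val_inj/mx2P; rewrite [LHS]mulmx2E !mxE /= ?A0 ?Ad ?Ad'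
  ?mul0r ?mulr0 ?addr0 ?add0r // mulNr mulrC subrr.
Qed.

Lemma U0_mulVr : right_inverse U0_one U0_inv U0_mul.
Proof.
move=> A; have [A0 Ad Ad'] := U0_entries A.
by apply/val_inj/mx2P; rewrite [LHS]mulmx2E !mxE /= ?A0 ?Ad ?Ad'
  ?mul0r ?mulr0 ?addr0 ?add0r // mulrN mulrC addNr.
Qed.

HB.instance Definition _ :=
  isGroup.Build (U0 R) U0_mulA U0_mul1 U0_mulr1 U0_mulV U0_mulVr.

Definition U0_coord A : 'rV[R]_(2 * 2 + 2 * 2) := re_im (U0mx A).

HB.instance Definition _ :=
  Topological.copy (U0 R) (initial_topology U0_coord).

End U0Group.

(** * Representations and characters *)

Definition free_on (F : groupType) (I : Type) (s : I -> F) : Prop :=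
  forall (G : groupType) (f : I -> G), exists! h : F -> G,
    {morph h : x y / (x * y)%g} /\ forall i, h (s i) = f i.

Section Representations.
Variables (R : realType) (F : groupType) (n : nat).
Implicit Types (c : R) (s : 'I_n -> F).

Definition SL2_rep (rho : F -> 'M[R[i]]_2) : Prop :=
  [/\ forall x, \det (rho x) = 1, rho 1%g = 1%:M
    & forall x y, rho (x * y)%g = rho x *m rho y].

Definition character (rho : F -> 'M[R[i]]_2) : F -> R[i] :=
  fun x => \tr (rho x).

Definition reducible (rho : F -> 'M[R[i]]_2) : Prop :=
  exists2 u : 'cV[R[i]]_2, u != 0 & forall x, exists k, rho x *m u = k *: u.

Definition Xc c s : set (F -> R[i]) :=
  [set chi : F -> R[i] | exists rho, [/\ SL2_rep rho, forall i, \tr (rho (s i)) = c%:C,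
     chi = character rho & forall x, complex.Im (chi x) = 0]].

Definition Xc_red c s : set (F -> R[i]) :=
  [set chi | Xc c s chi /\
     exists rho, [/\ SL2_rep rho, reducible rho & chi = character rho]].

Definition U0_character (rho : F -> U0 R) : F -> R[i] :=
  character (fun x => U0mx (rho x)).

Definition fully_reducible (rho : F -> U0 R) : Prop :=
  exists k : U0 R, forall x, is_diag_mx (U0mx (rho x ^ k)%g).

Definition RcU0 c s : set (F -> U0 R) :=
  [set rho : F -> U0 R | [/\ {morph rho : x y / (x * y)%g},
     forall i, \tr (U0mx (rho (s i))) = c%:C & ~ fully_reducible rho]].

(* Representations are determined by their values on [s], which identifies
   [RcU0 c s] with a subset of the n-th power of the space of matrices. *)
Definition rep_coord s (rho : F -> U0 R) : 'rV[R]_(n * (2 * 2 + 2 * 2)) :=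
  mxvec (\matrix_(i, j) U0_coord (rho (s i)) 0 j).

Definition RcU0_atlas c s : set (chart R (F -> U0 R) (2 * n)) :=
  embedded_atlas (rep_coord s) (RcU0 c s).

Definition AutU0 : set (U0 R -> U0 R) :=
  [set g : U0 R -> U0 R | [/\ {morph g : A B / (A * B)%g},
     smooth_wrt setT (@U0_coord R) (@U0_coord R \o g)
   & exists h, [/\ cancel g h, cancel h g
       & smooth_wrt setT (@U0_coord R) (@U0_coord R \o h)]]].

Definition AutU0_equiv (rho rho' : F -> U0 R) : Prop :=
  exists2 g, AutU0 g & rho' = g \o rho.

Definition XcU0 c s : set (set (F -> U0 R)) := quotient (RcU0 c s) AutU0_equiv.

Definition AutU0_acts c s : Prop :=
  forall g rho, AutU0 g -> RcU0 c s rho -> RcU0 c s (g \o rho).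

Definition AutU0_free c s : Prop :=
  forall g rho, AutU0 g -> RcU0 c s rho -> g \o rho = rho -> g = id.

(* The map (g, rho) |-> (g rho, rho) is proper, where Aut(U_0) has the
   compact-open topology. Representations are replaced by their coordinates,
   whose topology induces that of [RcU0 c s]. *)
Definition AutU0_proper c s : Prop :=
  forall K : set ('rV[R]_(n * (2 * 2 + 2 * 2)) * 'rV[R]_(n * (2 * 2 + 2 * 2))),
    compact K ->
    K `<=` (rep_coord s @` RcU0 c s) `*` (rep_coord s @` RcU0 c s) ->
    compact [set p : {compact-open, U0 R -> U0 R} * 'rV[R]_(n * (2 * 2 + 2 * 2)) |
      exists g rho, [/\ AutU0 g, RcU0 c s rho, p = (g, rep_coord s rho)
        & K (rep_coord s (g \o rho), rep_coord s rho)]].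

End Representations.

(** * The resolution *)

Section Resolution.
Variable R : realType.

Definition Bform (t : R) (v : 'cV[R]_3) : R :=
  t * (v 0 0 ^+ 2 + v 1 0 ^+ 2) + v 2 0 ^+ 2.

Definition G0 : set 'M[R]_3 :=
  [set g : 'M[R]_(2 + 1) | exists (A : 'M[R]_2) (b : 'cV[R]_2),
     A *m A^T = 1%:M /\ g = block_mx A b 0 (\det A)%:M].

Definition Gt (t : R) : set 'M[R]_3 :=
  if t == 0 then G0
  else [set g | \det g = 1 /\ forall v, Bform t (g *m v) = Bform t v].

(* The point (t, v_1, ..., v_n) is encoded as (t, V) with v_i = col i V. *)
Definition Rbar n : set (R * 'M[R]_(3, n)) :=
  [set p | (forall i, Bform p.1 (col i p.2) = 1) /\
     exists i j, col i p.2 <> col j p.2 /\ col i p.2 <> - col j p.2].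

Definition Rbar_coord n (p : R * 'M[R]_(3, n)) : 'rV[R]_(1 + 3 * n) :=
  row_mx p.1%:M (mxvec p.2).

Definition Rbar_atlas n : set (chart R (R * 'M[R]_(3, n)) (2 * n + 1)) :=
  embedded_atlas (@Rbar_coord n) (@Rbar n).

Definition scale n (a : R) (p : R * 'M[R]_(3, n)) : R * 'M[R]_(3, n) :=
  (p.1 / a ^+ 2, diag_mx (\row_(j < 3) [:: a; a; 1]`_j) *m p.2).

Definition Rbar_step n (p q : R * 'M[R]_(3, n)) : Prop :=
  (exists2 a, 0 < a & q = scale a p) \/
  (exists2 g, Gt p.1 g & q = (p.1, g *m p.2)).

Definition Rbar_equiv n : R * 'M[R]_(3, n) -> R * 'M[R]_(3, n) -> Prop :=
  clos_refl_sym_trans _ (@Rbar_step n).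

Definition calX n : set (set (R * 'M[R]_(3, n))) :=
  quotient (@Rbar n) (@Rbar_equiv n).

Definition phi (t : R) (v : 'cV[R]_3) : 'M[R[i]]_2 :=
  let: (x, y, z) := (v 0 0, v 1 0, v 2 0) in
  'i%C *: mx2 z%:C (- (x +i* y)%C) (- (t%:C * (x -i* y)%C)) (- z%:C).

Definition gen_mx (c t : R) (v : 'cV[R]_3) : 'M[R[i]]_2 :=
  let alpha := acos (c / 2) in
  (cos alpha)%:C *: 1%:M + (sin alpha)%:C *: phi t v.

Section Projection.
Variables (F : groupType) (n : nat) (c : R) (s : 'I_n -> F).

(* [pi_c] does not depend on the representative of the class; the default value
   is used only for sets that are not points of [calX n]. *)
Definition pi_c (C : set (R * 'M[R]_(3, n))) : F -> R[i] :=
  xget (fun=> 0) [set chi : F -> R[i] | exists p rho,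
    [/\ C p, SL2_rep rho, forall i, rho (s i) = gen_mx c p.1 (col i p.2)
      & chi = character rho]].

Definition calX_red : set (set (R * 'M[R]_(3, n))) :=
  [set C | calX C /\ Xc_red c s (pi_c C)].

End Projection.

End Resolution.

(* Main.v *)
(** An automorphism of [U_0] acts on the pair (rotation part [a], translation
    part [b]) by [a |-> a^k], [b |-> l b^k + m Im a], where [^k] is the identity
    or complex conjugation. On a representation with [tr rho(s_i) = c] the
    rotation parts are [c/2 + i kap_i sin(alpha)] with [kap_i = 1] or [-1], and
    the group acts on the points [wt_i = kap_i b_i] of the plane by
    similarities; full reducibility means that the [wt_i] coincide. Hence the
    products [kap_i kap_j] and the ratios [(wt_i - wt_0) / (wt_j - wt_0)], up to
    the simultaneous conjugation recorded by [kap_0], are coordinates on the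
    quotient.

    A representation attached to a point with [t <> 0] has no reducible
    character: otherwise every [tr rho(s_i s_j)] would be [2] or [c^2 - 2], that
    is [B_t(v_i, v_j) = -1] or [1], which forces [v_i = v_j] or [v_i = - v_j].
    So the reducible locus is the slice [t = 0], where the equivalence relation
    generated by scalings and [G_0] is again the action of similarities. Both
    quotient structures consist of the charts which are locally smooth in the
    ambient coordinates and have smooth local sections (a submersion has such
    sections by the inverse function theorem), so the linear bijection between
    the coordinates on the two sides induces a diffeomorphism. *)

(* The atlas [A] on the resolution is known only through [hA], so its charts cannot be computed
   with. The notion [good_at] gets round this: it refers to ambient coordinates alone, it holds for
   every chart of any quotient structure, and transition maps between good charts are composites of
   ambient maps. The diffeomorphism therefore needs no formula for a chart of [A], only two smooth
   maps between the ambient vector spaces that are inverse to each other on the loci and respect the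
   equivalences. The same notion gives the uniqueness of the structure on [XcU0]. The dimension 2n -
   4 counts the 2n real parameters of n plane points, less the 4 of the similarity group.

   Elements of [AutU0] are abstract maps, so the explicit family [autU0] must be shown to exhaust
   them; freeness, properness and the invariants rest on that. Lying in the reducible locus is a
   condition on a character, which different representations may share; hence the case t <> 0 is
   settled by traces and not by looking for an invariant line. *)
Require Import Defs.
From HB Require Import structures.
From mathcomp Require Import all_boot all_order all_algebra.
From mathcomp Require Import complex.
From mathcomp Require Import all_classical all_reals all_analysis.
From mathcomp Require Import ring lra.
From Stdlib Require Import Relations.
Set Implicit Arguments.
Unset Strict Implicit.
Unset Printing Implicit Defensive.
Import Order.TTheory GRing.Theory Num.Theory.
Import numFieldNormedType.Exports.
Local Open Scope classical_set_scope.
Local Open Scope complex_scope.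
Local Open Scope ring_scope.

(** * Calculus *)

Section CkCalculus.
Context {R : realType}.

Lemma Ck_onW (V W : normedModType R) k (U : set V) (f : V -> W) :
  Ck_on k.+1 U f -> Ck_on k U f.
Proof.
elim: k f => [|k IH] f [fc fd]; first by split.
by split=> // v; have [fv /IH] := fd v.
Qed.

Lemma Ck_on_continuous (V W : normedModType R) k (U : set V) (f : V -> W) x :
  Ck_on k U f -> U x -> {for x, continuous f}.
Proof. by case: k => [|k] [fc _] /fc. Qed.

Lemma Ck_on_sub (V W : normedModType R) k (U U' : set V) (f : V -> W) :
  U' `<=` U -> Ck_on k U f -> Ck_on k U' f.
Proof.
move=> sU; elim: k f => [|k IH] f [fc fd]; split=> //;
  try by move=> x /sU /fc.
move=> v; have [fv fv'] := fd v; split; last exact: IH.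
by move=> x /sU /fv.
Qed.

Lemma near_open_eq (V : normedModType R) (W : Type) (U : set V)
    (f g : V -> W) x :
  open U -> U x -> (forall y, U y -> f y = g y) -> \forall y \near x, f y = g y.
Proof. by move=> oU Ux fg; apply: filterS (open_nbhs_nbhs (conj oU Ux)). Qed.

Lemma Ck_on_eq (V W : normedModType R) k (U : set V) (f g : V -> W) :
  open U -> (forall x, U x -> f x = g x) -> Ck_on k U f -> Ck_on k U g.
Proof.
move=> oU; elim: k f g => [|k IH] f g fg [fc fd];
    (have fg' y : U y -> \forall z \near y, f z = g z
      by move=> Uy; exact: near_open_eq oU Uy fg); split=> //; try move=> x Ux.
- change (g @ x --> g x); rewrite -fg//; apply: cvg_trans (fc _ Ux).
  exact/near_eq_cvg/fg'.
- change (g @ x --> g x); rewrite -fg//; apply: cvg_trans (fc _ Ux).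
  exact/near_eq_cvg/fg'.
- move=> v; have [fv fv'] := fd v; split.
    by move=> y Uy; apply: near_eq_derivable (fg' _ Uy) (fv _ Uy).
  apply: IH fv' => y Uy; exact/near_eq_derive/fg'.
Qed.

Lemma Ck_on_cst (V W : normedModType R) k (U : set V) (a : W) :
  Ck_on k U (fun=> a).
Proof.
elim: k a => [|k IH] a; split=> //; try by move=> x Ux; exact: cst_continuous.
move=> v; split; first by move=> x _; exact: derivable_cst.
rewrite (_ : 'D_v _ = fun=> 0) ?funeqE//.
by move=> x; rewrite derive_cst.
Qed.

Lemma Ck_onD (V W : normedModType R) k (U : set V) (f g : V -> W) : open U ->
  Ck_on k U f -> Ck_on k U g -> Ck_on k U (fun x => f x + g x).
Proof.
move=> oU; elim: k f g => [|k IH] f g [fc fd] [gc gd]; split=> //;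
  try by move=> x Ux; apply: cvgD; [exact: fc|exact: gc].
move=> v; have [fv fv'] := fd v; have [gv gv'] := gd v; split.
  by move=> x Ux; apply: derivableD; [exact: fv|exact: gv].
apply: Ck_on_eq (IH _ _ fv' gv') => // x Ux.
by rewrite -deriveD; [|exact: fv|exact: gv].
Qed.

Lemma Ck_onM (V : normedModType R) k (U : set V) (f g : V -> R) : open U ->
  Ck_on k U f -> Ck_on k U g -> Ck_on k U (fun x => f x * g x).
Proof.
move=> oU; elim: k f g => [|k IH] f g Cf Cg; split=> //;
  try by move=> x Ux; apply: cvgM; [exact: (Ck_on_continuous Cf)|
    exact: (Ck_on_continuous Cg)].
move=> v; have [fv fv'] := Cf.2 v; have [gv gv'] := Cg.2 v; split.
  by move=> x Ux; apply: derivableM; [exact: fv|exact: gv].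
have := Ck_onD oU (IH _ _ (Ck_onW Cf) gv') (IH _ _ (Ck_onW Cg) fv').
apply: Ck_on_eq => // x Ux.
by rewrite -[LHS]deriveM; [|exact: fv|exact: gv].
Qed.

Lemma Ck_onV (V : normedModType R) k (U : set V) (f : V -> R) : open U ->
  (forall x, U x -> f x != 0) -> Ck_on k U f -> Ck_on k U (fun x => (f x)^-1).
Proof.
move=> oU f0; elim: k => [|k IH] Cf; split=> //; try by move=> x Ux;
  apply: cvgV; [exact: f0|exact: (Ck_on_continuous Cf)].
move=> v; have [fv fv'] := Cf.2 v; split.
  by move=> x Ux; apply: derivableV; [exact: f0|exact: fv].
have CV := IH (Ck_onW Cf).
have := Ck_onM oU (Ck_onM oU (Ck_on_cst _ U (-1 : R)) (Ck_onM oU CV CV)) fv'.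
apply: Ck_on_eq => // x Ux.
rewrite deriveV; [|exact: f0|exact: fv].
by rewrite /GRing.scale/= mulN1r -exprVn expr2.
Qed.

(** The matrix norm is the maximum of the entries, so limits and directional derivatives are taken
    entrywise. *)
Lemma Ck_on_mx (V : normedModType R) k m n (U : set V) (f : V -> 'M[R]_(m, n)) :
  open U ->
  Ck_on k U f <-> forall i j, Ck_on k U (fun x => f x i j).
Proof.
move=> oU; have mxc h x : {for x, continuous (h : V -> 'M[R]_(m, n))} <->
    forall i j, {for x, continuous (fun x => h x i j)}.
  split=> [hc i j|hc].
    by apply: (@continuous_comp _ _ _ h (fun M => M i j) x) hc _;
      exact: coord_continuous.
  apply/cvgrPdist_lt => e e0; near=> y.
  rewrite [ltLHS]/Num.Def.normr/= mx_normrE (bigmax_lt _ e0)//= => i _.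
  rewrite !mxE; move: i; near: y; apply: filter_forall => /= i.
  by move/cvgrPdist_lt: (hc i.1 i.2); apply.
elim: k f => [|k IH] f; split.
- by move=> [fc _] i j; split=> // x Ux; apply: (mxc f x).1; exact: fc.
- by move=> fij; split=> // x Ux; apply: (mxc f x).2 => i j; exact: (fij i j).1.
- move=> [fc fd] i j; split=> [x Ux|v]; first by apply: (mxc f x).1; exact: fc.
  have [fv fv'] := fd v; split=> [x Ux|].
    by move/derivable_mxP: (fv _ Ux).
  have /IH/(_ i j) := fv'; apply: Ck_on_eq => // x Ux.
  by rewrite derive_mx ?mxE//; exact: fv.
- move=> fij; split=> [x Ux|v]; first by apply: (mxc f x).2 => i j; exact: (fij i j).1.
  have fv x : U x -> derivable f x v.
    by move=> Ux; apply/derivable_mxP => i j; exact: ((fij i j).2 v).1.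
  split=> //; apply/IH => i j.
  apply: Ck_on_eq ((fij i j).2 v).2 => // x Ux.
  by rewrite derive_mx ?mxE//; exact: fv.
Unshelve. all: by end_near. Qed.

Lemma Ck_on_id (V : normedModType R) k (U : set V) : Ck_on k U (@id V).
Proof.
case: k => [|k]; split=> //; try by move=> x Ux; exact: cvg_id.
move=> v; split; first by move=> x _; exact: derivable_id.
rewrite (_ : 'D_v id = fun=> v); first exact: Ck_on_cst.
by apply/funext => x; rewrite derive_id.
Qed.

Lemma Ck_on_sum (V W : normedModType R) k (U : set V) (I : Type) (r : seq I)
    (P : pred I) (f : I -> V -> W) : open U ->
  (forall i, P i -> Ck_on k U (f i)) ->
  Ck_on k U (fun x => \sum_(i <- r | P i) f i x).
Proof.
move=> oU Cf; elim: r => [|i r IH].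
  rewrite [X in Ck_on _ _ X](_ : _ = fun=> 0); first exact: Ck_on_cst.
  by apply/funext => x; rewrite big_nil.
have [Pi|Pi] := boolP (P i).
  apply: Ck_on_eq (Ck_onD oU (Cf _ Pi) IH) => // x _.
  by rewrite big_cons Pi.
by apply: Ck_on_eq IH => // x _; rewrite big_cons (negbTE Pi).
Qed.

Lemma Ck_on_prod (V : normedModType R) k (U : set V) (I : Type) (r : seq I)
    (P : pred I) (f : I -> V -> R) : open U ->
  (forall i, P i -> Ck_on k U (f i)) ->
  Ck_on k U (fun x => \prod_(i <- r | P i) f i x).
Proof.
move=> oU Cf; elim: r => [|i r IH].
  rewrite [X in Ck_on _ _ X](_ : _ = fun=> 1); first exact: Ck_on_cst.
  by apply/funext => x; rewrite big_nil.
have [Pi|Pi] := boolP (P i).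
  apply: Ck_on_eq (Ck_onM oU (Cf _ Pi) IH) => // x _.
  by rewrite big_cons Pi.
by apply: Ck_on_eq IH => // x _; rewrite big_cons (negbTE Pi).
Qed.

End CkCalculus.

Section C1.
Context {R : realType}.

Lemma rV_coord_le m (x : 'rV[R]_m) i : `|x 0 i| <= `|x|.
Proof.
rewrite [leRHS]/Num.Def.normr/= mx_normrE.
exact: (le_bigmax _ (fun ij : 'I_1 * 'I_m => `|x ij.1 ij.2|) (0, i)).
Qed.

Lemma rV_norm_le m (x : 'rV[R]_m) e :
  0 <= e -> (forall i, `|x 0 i| <= e) -> `|x| <= e.
Proof.
move=> e0 xe; rewrite [leLHS]/Num.Def.normr/= mx_normrE.
by apply: bigmax_le => // -[i j] _ /=; rewrite (ord1 i).
Qed.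

Lemma is_derive_line (V W : normedModType R) (f : V -> W) x v (t : R) :
  derivable f (x + t *: v) v ->
  is_derive t (1 : R) (fun t => f (x + t *: v)) ('D_v f (x + t *: v)).
Proof.
have E : (fun h : R => h^-1 *: (((fun t => f (x + t *: v)) \o shift t) (h *: 1)
      - f (x + t *: v))) =
    (fun h => h^-1 *: ((f \o shift (x + t *: v)) (h *: v) - f (x + t *: v))).
  apply/funext => h; congr (_ *: (f _ - _)) => /=.
  by rewrite [h *: 1]mulr1 scalerDl addrCA.
by move=> fv; split; rewrite /derivable /derive E.
Qed.

Lemma MVT_dir (V : normedModType R) (f : V -> R) x v :
  (forall t : R, 0 <= t <= 1 -> derivable f (x + t *: v) v) ->
  exists2 t : R, 0 <= t <= 1 & f (x + v) - f x = 'D_v f (x + t *: v).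
Proof.
move=> fv; pose g (t : R) := f (x + t *: v).
have gd (t : R) : t \in `[0, 1]%R -> is_derive t 1 g ('D_v f (x + t *: v)).
  by rewrite in_itv/= => t01; apply/is_derive_line/fv.
have gc : {within `[0, 1], continuous g}.
  by apply: derivable_within_continuous => t /gd [].
have gd' (t : R) : t \in `]0, 1[%R -> is_derive t 1 g ('D_v f (x + t *: v)).
  by move=> /subset_itv_oo_cc; exact: gd.
have [t t01] := MVT_segment (@ler01 R) gd' gc.
rewrite /g subr0 mulr1 scale1r scale0r addr0 => E; exists t => //.
Qed.

Lemma derive_scaledir (V : normedModType R) (f : V -> R) x v (a : R) :
  derivable f x v -> 'D_(a *: v) f x = a * 'D_v f x.
Proof.
have [->|a0] := eqVneq a 0; first by rewrite scale0r derive0 mul0r.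
move=> fv; apply/cvg_lim => //=.
have -> : (fun h => h^-1 *: (f (h *: (a *: v) + x) - f x)) =
    (fun h : R => a *: (h^-1 *: (f (h *: v + x) - f x))) \o (fun h : R => h * a).
  apply/funext => h /=; rewrite !scalerA invfM.
  by rewrite mulrCA divff// mulr1.
apply: (@cvg_comp _ _ _ _ _ _ (0^')); last first.
  by apply: cvgZl_tmp; exact: fv.
move=> A /= [e /= e0 eA]; exists (e / `|a|) => /=; first by rewrite divr_gt0// normr_gt0.
move=> h /=; rewrite sub0r normrN => he h0; apply: eA; last by rewrite mulf_neq0.
by rewrite /= sub0r normrN normrM -ltr_pdivlMr// normr_gt0.
Qed.

(** The path from [x] to [x + h] changes one coordinate at a time, and the mean value theorem
    applies to each of the [m] steps. It stays in the ball because truncating [h] does not increase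
    its max norm. *)
Lemma C1_increment m (g : 'rV[R]_m -> R) x (h : 'rV[R]_m) e r :
  (forall y, `|y - x| <= r -> forall v, derivable g y v) ->
  (forall y, `|y - x| <= r -> forall i,
     `|'D_(delta_mx 0 i) g y - 'D_(delta_mx 0 i) g x| <= e) ->
  `|h| <= r ->
  `|g (x + h) - g x - \sum_i h 0 i * 'D_(delta_mx 0 i) g x| <= m%:R * e * `|h|.
Proof.
move=> gd ge hr.
pose T k : 'rV[R]_m := \row_i (if (i < k)%N then h 0 i else 0).
have TS (i : 'I_m) : T i.+1 = T i + h 0 i *: delta_mx 0 i.
  apply/rowP => j; rewrite !mxE eqxx /= ltnS leq_eqVlt.
  have [ij|ij] := eqVneq (j : nat) i; last first.
    have -> : (j == i) = false by apply: contraNF ij => /eqP ->.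
    by rewrite mulr0 addr0.
  by rewrite (val_inj ij) eqxx ltnn mulr1 add0r.
have h0 : 0 <= `|h| by [].
have step k : (k <= m)%N ->
    `|g (x + T k) - g x - \sum_(i < m | (i < k)%N) h 0 i * 'D_(delta_mx 0 i) g x|
      <= k%:R * e * `|h|.
  elim: k => [_|k IH km].
    rewrite big_pred0// subr0 (_ : T 0%N = 0) ?addr0 ?subrr ?normr0 ?mul0r//.
    by apply/rowP => j; rewrite !mxE.
  pose i := Ordinal km.
  have Tr t : 0 <= t <= 1 ->
      `|x + T k + t *: (h 0 i *: delta_mx 0 i) - x| <= r.
    move=> /andP[t0 t1]; apply: le_trans hr; rewrite addrAC [x + _]addrC addrK.
    apply: rV_norm_le => // j; rewrite !mxE eqxx/=.
    have [ji|ji] := eqVneq j i.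
      by rewrite ji/= ltnn add0r mulr1 normrM ger0_norm//
        (le_trans _ (rV_coord_le h i))// ler_piMl.
    rewrite !mulr0 addr0; case: ifP => _; first exact: rV_coord_le.
    by rewrite normr0.
  have [t t01 tE] := @MVT_dir _ g (x + T k) (h 0 i *: delta_mx 0 i)
    (fun t t01 => gd _ (Tr _ t01) _).
  rewrite (bigD1 i) //= (TS i) addrA.
  rewrite (eq_bigl (fun j : 'I_m => (j < k)%N)); last first.
    move=> j; rewrite ltnS leq_eqVlt -val_eqE /=.
    by case: eqP => [->|]; rewrite ?ltnn ?andbT.
  set S := \sum_(_ | _) _.
  rewrite [X in `|X|](_ : _ = (g (x + T k) - g x - S) +
    h 0 i * ('D_(delta_mx 0 i) g (x + T k + t *: (h 0 i *: delta_mx 0 i))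
             - 'D_(delta_mx 0 i) g x)); last first.
    rewrite mulrBr -(derive_scaledir (h 0 i) (gd _ (Tr _ t01) _)) -tE.
    by ring.
  apply: le_trans (ler_normD _ _) _.
  rewrite -[k.+1]addn1 natrD 2!mulrDl lerD//; first exact/IH/ltnW.
  rewrite normrM mul1r mulrC.
  by apply: ler_pM => //; [exact/ge/Tr|exact: rV_coord_le].
have := step m (leqnn _).
rewrite (_ : T m = h); last by apply/rowP => j; rewrite mxE ltn_ord.
by rewrite (eq_bigl predT)// => j; rewrite ltn_ord.
Qed.

End C1.

Section ChainRule.
Context {R : realType}.

Lemma near0_norm_le (V : normedModType R) e :
  0 < e -> \forall h \near (0 : V), `|h| <= e.
Proof.
move=> e0; apply/nbhs_normP; exists e => //= h.
by rewrite /ball_/= sub0r normrN => /ltW.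
Qed.

Lemma differentiable_o (V : normedModType R) (f : V -> R) x :
  (forall e, 0 < e -> \forall h \near (0 : V), `|f (x + h) - f x| <= e * `|h|) ->
  differentiable f x.
Proof.
move=> fx; have df : f \o shift x = cst (f x) + (\0 : {linear V -> R}) +o_ 0 id.
  apply/eqaddoP => _/posnumP[e]; have := fx e%:num [gt0 of e%:num].
  apply: filterS => h; rewrite -![(_ + _ : _ -> _) _]/(_ + _).
  by rewrite -![(- _ : _ -> _) _]/(- _) -![(_ + _ : _ -> _) _]/(_ + _)/= addr0 [h + x]addrC.
have dE : 'd f x = (\0 : {linear V -> R}) :> (V -> R).
  by apply: diff_unique => //; exact: cst_continuous.
by apply/diff_locallyP; rewrite dE; split => //; exact: cst_continuous.
Qed.

Lemma C1_differentiable m (U : set 'rV[R]_m) (f : 'rV[R]_m -> R) x :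
  open U -> Ck_on 1 U f -> U x -> differentiable f x.
Proof.
move=> oU [fc fd] Ux.
pose L (y : 'rV[R]_m) := \sum_i y 0 i * 'D_(delta_mx 0 i) f x.
have dL y : differentiable L y.
  have -> : L = \sum_i (fun y : 'rV[R]_m => y 0 i * 'D_(delta_mx 0 i) f x).
    by apply/funext => z; rewrite fct_sumE.
  apply: differentiable_sum => i; apply: differentiableM => //.
  exact: differentiable_coord.
(* Subtracting the candidate differential [L] leaves a function with differential zero, whose
   increments are bounded by [C1_increment]. The bound [e / m.+1%:R] on the variation of the partial
   derivatives absorbs the factor [m]. *)
have -> : f = (fun y => f y - L y) + L by apply/funext => y; rewrite /= subrK.
apply: differentiableD; last exact: dL.
apply: differentiable_o => e e0.
have m0 : 0 < (m.+1%:R : R) by [].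
have : \forall y \near x, U y /\
    forall i, `|'D_(delta_mx 0 i) f y - 'D_(delta_mx 0 i) f x| <= e / m.+1%:R.
  near=> y; split; first by near: y; exact: open_nbhs_nbhs.
  near: y; apply: filter_forall => i.
  have /cvgrPdist_le/(_ (e / m.+1%:R) (divr_gt0 e0 m0)) :=
    (fd (delta_mx 0 i)).2.1 x Ux.
  by apply: filterS => y; rewrite distrC.
move=> /nbhs_ballP[r /= r0 rP]; near=> h.
have rP' y : `|y - x| <= r / 2 -> U y /\
    forall i, `|'D_(delta_mx 0 i) f y - 'D_(delta_mx 0 i) f x| <= e / m.+1%:R.
  move=> yr; apply: rP; rewrite -ball_normE /= distrC; apply: le_lt_trans yr _.
  by rewrite ltr_pdivrMr// mulr_natr mulr2n ltrDl.
have := @C1_increment _ _ f x h (e / m.+1%:R) (r / 2).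
have -> : \sum_i h 0 i * 'D_(delta_mx 0 i) f x = L (x + h) - L x.
  rewrite /L -sumrB; apply: eq_bigr => i _; rewrite !mxE; ring.
have hr : `|h| <= r / 2.
  by near: h; apply: (@near0_norm_le 'rV[R]_m (r / 2)); rewrite divr_gt0.
move=> /(_ _ _ hr) H; rewrite [X in `|X|](_ : _ = f (x + h) - f x - (L (x + h) - L x)); last by ring.
apply: le_trans (H _ _) _.
- by move=> y /rP'[Uy _] v; exact: (fd v).1.
- by move=> y /rP'[].
- rewrite ler_wpM2r// mulrCA ler_piMr ?(ltW e0)//.
  by rewrite ler_pdivrMr// mul1r ler_nat.
Unshelve. all: by end_near. Qed.

Lemma C1_differentiable_mx m p q (U : set 'rV[R]_m) (f : 'rV[R]_m -> 'M[R]_(p, q)) x :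
  open U -> Ck_on 1 U f -> U x -> differentiable f x.
Proof.
move=> oU Cf Ux.
have -> : f = \sum_i \sum_j (fun y => f y i j *: delta_mx i j).
  apply/funext => y; rewrite fct_sumE [LHS]matrix_sum_delta.
  by apply: eq_bigr => i _; rewrite fct_sumE.
apply: differentiable_sum => i; apply: differentiable_sum => j.
apply: differentiableZl; apply: (C1_differentiable oU _ Ux).
exact: (Ck_on_mx 1 f oU).1.
Qed.

Lemma derive_sum_delta m (W : normedModType R) (g : 'rV[R]_m -> W) y w :
  differentiable g y -> 'D_w g y = \sum_i w 0 i *: 'D_(delta_mx 0 i) g y.
Proof.
move=> dg; rewrite deriveE// {1}[w]row_sum_delta linear_sum.
by apply: eq_bigr => i _; rewrite linearZ deriveE.
Qed.

Lemma line0E (V W : normedModType R) (f : V -> W) x v :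
  (fun h : R => h^-1 *: (((fun t : R => f (x + t *: v)) \o shift 0) (h *: 1)
      - f (x + 0 *: v))) =
  (fun h => h^-1 *: ((f \o shift x) (h *: v) - f x)).
Proof.
apply/funext => h; rewrite /= scale0r addr0 [h *: 1]mulr1 addr0.
by rewrite [x + _]addrC.
Qed.

Lemma derivable_line0 (V W : normedModType R) (f : V -> W) x v :
  derivable (fun t : R => f (x + t *: v)) 0 1 <-> derivable f x v.
Proof. by rewrite /derivable line0E. Qed.

Lemma derive_line0 (V W : normedModType R) (f : V -> W) x v :
  'D_1 (fun t : R => f (x + t *: v)) 0 = 'D_v f x.
Proof. by rewrite /derive line0E. Qed.

(** [f] enters only through the path t -> f (x + t v), a function of one real variable, for which
    derivability and differentiability agree. *)
Lemma derive_compdir (V V' W : normedModType R) (f : V -> V') (g : V' -> W) x v :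
  derivable f x v -> differentiable g (f x) ->
  derivable (g \o f) x v /\ 'D_v (g \o f) x = 'D_('D_v f x) g (f x).
Proof.
move=> fv dg; pose p (t : R) := f (x + t *: v).
have p0 : p 0 = f x by rewrite /p scale0r addr0.
have dp : differentiable p 0 by apply/derivable1_diffP/derivable_line0.
have dgp : differentiable g (p 0) by rewrite p0.
have dc : differentiable (g \o p) 0 by exact: differentiable_comp.
split; first by apply/derivable_line0/derivable1_diffP.
have -> : 'D_v f x = 'd p 0 1 by rewrite -(deriveE _ dp) -derive_line0.
rewrite -(derive_line0 (g \o f)) -[LHS]/('D_1 (g \o p) 0) (deriveE _ dc).
by rewrite diff_comp// (deriveE _ dg) /= p0.
Qed.

(** The derivative of the composite is the sum of the products of [('D_v f) 0 i] with the i-th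
    partial derivative of [g] composed with [f]. The induction hypothesis applies to that partial
    derivative, so [g] has to vary in the induction. *)
Lemma Ck_on_comp m (V : normedModType R) k (U : set V) (O : set 'rV[R]_m)
    (f : V -> 'rV[R]_m) (g : 'rV[R]_m -> R) :
  open U -> open O -> (forall x, U x -> O (f x)) ->
  Ck_on k U f -> Ck_on k O g -> Ck_on k U (g \o f).
Proof.
move=> oU oO fO; elim: k g => [|k IH] g Cf Cg; (split;
  first by move=> x Ux; apply: continuous_comp;
    [exact: (Ck_on_continuous Cf)|exact: (Ck_on_continuous Cg (fO _ Ux))]) => //.
have dg y : O y -> differentiable g y.
  move=> Oy; apply: C1_differentiable oO _ Oy.
  by elim: (k) Cg => // j IHj /Ck_onW/IHj.
move=> v; have [fv fv'] := Cf.2 v; split.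
  move=> x Ux; exact: (derive_compdir (fv _ Ux) (dg _ (fO _ Ux))).1.
apply: (Ck_on_eq (f := fun x => \sum_i ('D_v f x) 0 i * ('D_(delta_mx 0 i) g \o f) x)) => //.
  move=> x Ux; rewrite (derive_compdir (fv _ Ux) (dg _ (fO _ Ux))).2.
  by rewrite [RHS]derive_sum_delta//; exact/dg/fO.
apply: Ck_on_sum => // i _; apply: Ck_onM => //.
  exact: (Ck_on_mx k _ oU).1.
apply: IH; [exact: Ck_onW|exact: (Cg.2 _).2].
Qed.

Lemma Ck_on_comp_mx m p q (V : normedModType R) k (U : set V) (O : set 'rV[R]_m)
    (f : V -> 'rV[R]_m) (g : 'rV[R]_m -> 'M[R]_(p, q)) :
  open U -> open O -> (forall x, U x -> O (f x)) ->
  Ck_on k U f -> Ck_on k O g -> Ck_on k U (g \o f).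
Proof.
move=> oU oO fO Cf Cg; apply/Ck_on_mx => // i j.
apply: (Ck_on_comp (g := fun y => g y i j) oU oO fO Cf).
exact: (Ck_on_mx k _ oO).1.
Qed.

End ChainRule.

Section MatrixCk.
Context {R : realType} {V : normedModType R}.

Lemma Ck_on_mul_mx m p q k (U : set V) (f : V -> 'M[R]_(m, p))
    (g : V -> 'M[R]_(p, q)) : open U ->
  Ck_on k U f -> Ck_on k U g -> Ck_on k U (fun x => f x *m g x).
Proof.
move=> oU /Ck_on_mx-/(_ oU) Cf /Ck_on_mx-/(_ oU) Cg; apply/Ck_on_mx => // i j.
apply: (Ck_on_eq (f := fun x => \sum_l f x i l * g x l j)) => //.
  by move=> x _; rewrite mxE.
by apply: Ck_on_sum => // l _; exact: Ck_onM.
Qed.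

Lemma Ck_on_det m k (U : set V) (f : V -> 'M[R]_m) : open U ->
  Ck_on k U f -> Ck_on k U (fun x => \det (f x)).
Proof.
move=> oU /Ck_on_mx-/(_ oU) Cf.
apply: Ck_on_sum => // s _; apply: Ck_onM => //; first exact: Ck_on_cst.
by apply: Ck_on_prod.
Qed.

(** By Cramer's rule the entries of the inverse are signed minors divided by the determinant. *)
Lemma Ck_on_invmx m k (U : set V) (f : V -> 'M[R]_m) : open U ->
  (forall x, U x -> f x \in unitmx) ->
  Ck_on k U f -> Ck_on k U (fun x => invmx (f x)).
Proof.
move=> oU fu Cf; have Cfij := (Ck_on_mx k f oU).1 Cf; apply/Ck_on_mx => // i j.
apply: (Ck_on_eq (f := fun x => (\det (f x))^-1 * ((-1) ^+ (j + i) *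
    \det (row' j (col' i (f x)))))) => //.
  by move=> x Ux; rewrite /invmx fu// !mxE.
apply: Ck_onM => //; last apply: Ck_onM => //; last 1 first.
- apply: Ck_on_det => //; apply/Ck_on_mx => // i' j'.
  by apply: Ck_on_eq (Cfij (lift j i') (lift i j')) => // x _; rewrite !mxE.
- apply: Ck_onV => //; last exact: Ck_on_det.
  by move=> x /fu; rewrite unitmxE unitfE.
- exact: Ck_on_cst.
Qed.

End MatrixCk.

Lemma differentiable_near (R : realType) (V W : normedModType R) (f : V -> W) x :
  differentiable f x -> forall e, 0 < e ->
  \forall h \near (0 : V), `|f (x + h) - f x - 'd f x h| <= e * `|h|.
Proof.
move=> /diff_locally df e e0; move/eqaddoP: df => /(_ e e0).
apply: filterS => h; rewrite -![(_ + _ : _ -> _) _]/(_ + _).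
rewrite -![(- _ : _ -> _) _]/(- _) -![(_ + _ : _ -> _) _]/(_ + _) /=.
by rewrite opprD addrA [h + x]addrC.
Qed.

Lemma lipschitz_continuous_at (R : realType) (V W : normedModType R)
    (O : set V) (f : V -> W) x (c : R) : open O -> O x ->
  (forall y, O y -> `|f x - f y| <= c * `|x - y|) -> {for x, continuous f}.
Proof.
move=> oO Ox fc; apply/cvgrPdist_lt => e e0; near=> y.
have Oy : O y by near: y; exact: open_nbhs_nbhs.
apply: le_lt_trans (fc _ Oy) _.
have c0 : 0 < `|c| + 1 by rewrite ltr_wpDl.
have : `|x - y| < e / (`|c| + 1).
  near: y; apply/nbhs_ballP; exists (e / (`|c| + 1)) => /=; first by rewrite divr_gt0.
  by move=> z; rewrite -ball_normE.
rewrite ltr_pdivlMr// mulrC; apply: le_lt_trans.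
by rewrite ler_wpM2r// (le_trans (ler_norm _))// lerDl.
Unshelve. all: by end_near. Qed.

(** * The inverse function theorem, normalised to derivative the identity at the point *)

Section InverseFunction.
Context {R : realType} {d : nat} (U : set 'rV[R]_d) (k : 'rV[R]_d -> 'rV[R]_d).
Variable x0 : 'rV[R]_d.
Hypotheses (sk : smooth_on U k) (Ux0 : U x0)
  (dk : forall i, 'D_(delta_mx 0 i) k x0 = delta_mx 0 i).

(** If the entries of the Jacobian are within [eps] of those of the identity, its distance to the
    identity as an operator is at most d eps <= 1/2, the contraction constant below. Taking d + 1
    keeps [eps] positive when d = 0. *)
Let eps : R := (2 * d.+1%:R)^-1.
Let eps0 : 0 < eps. Proof. by rewrite invr_gt0 mulr_gt0. Qed.
Let deps : d%:R * eps <= 2^-1.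
Proof.
by rewrite /eps invfM mulrCA ler_piMr// ler_pdivrMr// mul1r ler_nat.
Qed.

Let J x : 'M[R]_d := \matrix_(i, j) 'D_(delta_mx 0 i) (fun x => k x 0 j) x.

Let Ck n : Ck_on n U k. Proof. exact: sk.2. Qed.
Let Ckj n j : Ck_on n U (fun x => k x 0 j).
Proof. by apply: (Ck_on_mx n k sk.1).1. Qed.

Let Dk x v : U x -> 'D_v k x = v *m J x.
Proof.
move=> Ux; rewrite derive_mx; last exact: ((Ck 1).2 v).1.
apply/rowP => j; rewrite mxE derive_sum_delta; last first.
  exact: C1_differentiable sk.1 (Ckj 1 j) Ux.
by rewrite mxE; apply: eq_bigr => i _; rewrite mxE.
Qed.

Let CJ n : Ck_on n U J.
Proof.
apply/Ck_on_mx => [|i j]; first exact: sk.1.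
apply: Ck_on_eq ((Ckj n.+1 j).2 (delta_mx 0 i)).2; first exact: sk.1.
by move=> x _; rewrite mxE.
Qed.

Let J0 : J x0 = 1%:M.
Proof.
apply/matrixP => i j; have /rowP/(_ j) := dk i.
by rewrite Dk// -rowE !mxE eqxx eq_sym.
Qed.

Let radius : exists2 r, 0 < r & forall x, `|x - x0| <= r ->
  U x /\ forall i j, `|J x i j - (i == j)%:R| <= eps.
Proof.
have : \forall x \near x0, U x /\ forall i j, `|J x i j - (i == j)%:R| <= eps.
  near=> x; split; first by near: x; apply: open_nbhs_nbhs; split=> //; exact: sk.1.
  near: x; apply: filter_forall => i; apply: filter_forall => j.
  have := Ck_on_continuous ((Ck_on_mx 0 J sk.1).1 (CJ 0) i j) Ux0.
  move=> /cvgrPdist_le/(_ _ eps0); apply: filterS => x.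
  by rewrite J0 mxE distrC.
move=> /nbhs_ballP[r /= r0 rP]; exists (r / 2); first by rewrite divr_gt0.
move=> x xr; apply: rP; rewrite -ball_normE /= distrC; apply: le_lt_trans xr _.
by rewrite ltr_pdivrMr// mulr_natr mulr2n ltrDl.
Unshelve. all: by end_near. Qed.

Let r := sval (cid2 radius).
Let r0 : 0 < r. Proof. by rewrite /r; case: cid2. Qed.
Let Br x : `|x - x0| <= r -> U x. Proof. by rewrite /r; case: cid2 => s /= _ sP /sP[]. Qed.
Let BJ x i j : `|x - x0| <= r -> `|J x i j - (i == j)%:R| <= eps.
Proof. by rewrite /r; case: cid2 => s /= _ sP /sP[_]; apply. Qed.

Let Jdist x (v : 'rV[R]_d) : `|x - x0| <= r -> `|v *m J x - v| <= 2^-1 * `|v|.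
Proof.
move=> xr; apply: rV_norm_le => [|j]; first by rewrite mulr_ge0.
have -> : (v *m J x - v) 0 j = \sum_i v 0 i * (J x i j - (i == j)%:R).
  rewrite -{2}[v]mulmx1 -mulmxBr mxE.
  by apply: eq_bigr => i _; rewrite !mxE.
apply: le_trans (ler_norm_sum _ _ _) _.
apply: (@le_trans _ _ (\sum_(i < d) `|v| * eps)).
  apply: ler_sum => i _; rewrite normrM; apply: ler_pM => //.
    exact: rV_coord_le.
  exact: BJ.
rewrite sumr_const card_ord -[leLHS]mulr_natl mulrCA mulrC.
by rewrite ler_wpM2r.
Qed.

Let contr a b : `|a - x0| <= r -> `|b - x0| <= r ->
  `|(k a - a) - (k b - b)| <= 2^-1 * `|a - b|.
Proof.
move=> ar br; apply: rV_norm_le => [|j]; first by rewrite mulr_ge0.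
have seg (t : R) : 0 <= t <= 1 -> `|b + t *: (a - b) - x0| <= r.
  move=> /andP[t0 t1].
  have -> : b + t *: (a - b) - x0 = t *: (a - x0) + (1 - t) *: (b - x0).
    by apply/rowP => i; rewrite !mxE; ring.
  apply: le_trans (ler_normD _ _) _; rewrite !normrZ ger0_norm// ger0_norm ?subr_ge0//.
  have -> : r = t * r + (1 - t) * r by ring.
  by rewrite lerD// ler_wpM2l// subr_ge0.
have [t t01 tE] := @MVT_dir _ _ (fun x => k x 0 j) b (a - b)
  (fun t t01 => ((Ckj 1 j).2 _).1 _ (Br (seg t t01))).
set xi := b + t *: (a - b) in tE *; have xr : `|xi - x0| <= r := seg t t01.
have JE : ((a - b) *m J xi) 0 j = k a 0 j - k b 0 j.
  rewrite -Dk; last exact: Br.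
  rewrite derive_mx; last exact: (((Ck 1).2 _).1 _ (Br xr)).
  by rewrite mxE -tE [b + (a - b)]addrC subrK.
apply: le_trans (le_trans (rV_coord_le _ j) (Jdist (a - b) xr)).
have -> : ((a - b) *m J xi - (a - b)) 0 j = k a 0 j - k b 0 j - (a 0 j - b 0 j).
  by rewrite -JE !mxE.
by rewrite le_eqVlt; apply/orP; left; apply/eqP; congr (`|_|); rewrite !mxE; ring.
Qed.

Let lower a b : `|a - x0| <= r -> `|b - x0| <= r -> `|a - b| <= 2 * `|k a - k b|.
Proof.
move=> ar br; have := contr ar br.
have : `|a - b| <= `|k a - k b| + `|(k a - a) - (k b - b)|.
  rewrite {1}(_ : a - b = (k a - k b) - ((k a - a) - (k b - b))); first exact: ler_normB.
  by apply/rowP => i; rewrite !mxE; ring.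
lra.
Qed.

(** The minimiser in the next proof satisfies |k x - k x0| < 2 dl, hence |x - x0| < 4 dl, and the
    corrected point lies within 5 dl of [x0]; both stay in the ball of radius r = 8 dl. *)
Let dl := r / 8.
Let dl0 : 0 < dl. Proof. by rewrite divr_gt0. Qed.

(** A minimiser of |k x - y| exists on the compact ball. The Newton step x' = x + (y - k x) would at
    least halve the residual, because [k] minus the identity is 1/2-Lipschitz, so the minimal
    residual is 0. *)
Let onto y : `|y - k x0| < dl -> exists x, `|x - x0| < r /\ k x = y.
Proof.
move=> yd; pose B := closed_ball_ Num.Def.normr x0 r : set 'rV[R]_d.
have BE x : B x = (`|x - x0| <= r) by rewrite /B /closed_ball_ /= distrC.
have B0 : B x0 by rewrite BE subrr normr0 ltW.
have cB : compact B.
  apply: bounded_closed_compact; last exact: closed_closed_ball_.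
  exists (r + `|x0|); split; first exact: num_real.
  move=> M rM x; rewrite BE => xr; apply: le_trans (ltW rM).
  by rewrite -[x](subrK x0); apply: le_trans (ler_normD _ _) _; rewrite lerD2r.
have kc : {within B, continuous (fun x => `|k x - y|)}.
  apply: continuous_in_subspaceT => x; rewrite inE BE => /Br Ux.
  apply: (@continuous_comp _ _ _ (fun x => k x - y) Num.Def.normr); last exact: norm_continuous.
  have kx : k @ x --> k x := Ck_on_continuous (Ck 0) Ux.
  by apply: (cvgB kx); exact: cvg_cst.
have [|x] := EVT_min_rV _ cB kc; first by exists x0.
rewrite inE BE => xr xmin.
have kxy : `|k x - y| < dl.
  by apply: le_lt_trans (xmin x0 _) _; rewrite ?inE// distrC.
have xx0 : `|x - x0| < 4 * dl.
  have := lower xr (_ : `|x0 - x0| <= r); rewrite subrr normr0 ltW// => /(_ isT).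
  have : `|k x - k x0| <= `|k x - y| + `|y - k x0| by exact: ler_distD.
  lra.
have rd : r = 8 * dl by rewrite /dl mulrC divfK.
pose x' := x + (y - k x).
have x'r : `|x' - x0| <= r.
  have : `|x' - x0| <= `|x - x0| + `|k x - y|.
    rewrite (_ : x' - x0 = (x - x0) - (k x - y)); first exact: ler_normB.
    by apply/rowP => i; rewrite /x' !mxE; ring.
  by move: dl0; lra.
exists x; split; first by move: dl0; lra.
have kx' : k x' - y = (k x' - x') - (k x - x).
  by apply/rowP => i; rewrite /x' !mxE; ring.
have := xmin x'; rewrite inE BE => /(_ x'r); rewrite kx'.
move=> /le_trans/(_ (contr x'r xr)).
rewrite (_ : x' - x = - (k x - y)) ?normrN; last first.
  by apply/rowP => i; rewrite /x' !mxE; ring.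
move=> H; have : `|k x - y| <= 0 by lra.
by rewrite normr_le0 subr_eq0 => /eqP.
Qed.

Let G y := xget x0 [set x | `|x - x0| < r /\ k x = y].
Let O := ball (k x0) dl.
Let OE y : O y = (`|y - k x0| < dl) :> Prop.
Proof. by rewrite /O -ball_normE /= distrC. Qed.

Let GP y : O y -> `|G y - x0| < r /\ k (G y) = y.
Proof. by rewrite OE => /onto exy; have := xgetPex x0 exy. Qed.

Let GL y y' : O y -> O y' -> `|G y - G y'| <= 2 * `|y - y'|.
Proof.
move=> /GP[Gr Gk] /GP[Gr' Gk']; have := lower (ltW Gr) (ltW Gr').
by rewrite Gk Gk'.
Qed.

Let oO : open O. Proof. exact: ball_open. Qed.

Let Ju x : `|x - x0| <= r -> J x \in unitmx.
Proof.
move=> xr; rewrite unitmxE unitfE; apply/negP => /det0P[v v0 vJ].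
have := Jdist v xr; rewrite vJ sub0r normrN.
move: v0; rewrite -normr_gt0; lra.
Qed.

(** Differentiability of [k] at [G y], together with the Lipschitz bound [GL], shows that the
    difference quotient of [G] times the Jacobian tends to [v]; multiplying by the inverse Jacobian
    gives the derivative. *)
Let dG y v : O y ->
  derivable G y v /\ 'D_v G y = v *m invmx (J (G y)).
Proof.
move=> Oy; have [Gr Gk] := GP Oy; set x := G y in Gr Gk *.
have Ux : U x := Br (ltW Gr).
pose q (h : R) := h^-1 *: (G (h *: v + y) - x).
have near_O : \forall h \near (0 : R), O (h *: v + y).
  have : (fun h : R => h *: v + y) @ (0 : R) --> 0 *: v + y.
    by apply: cvgD; [apply: cvgZr_tmp; exact: cvg_id|exact: cvg_cst].
  by rewrite scale0r add0r; apply; exact: open_nbhs_nbhs.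
have dk' : differentiable k x by exact: C1_differentiable_mx sk.1 (Ck 1) Ux.
have qJ : (fun h => q h *m J x) @ 0^' --> v.
  apply/cvgrPdist_le => e e0.
  (* By [GL] the increment [D] has norm at most 2 |h| |v|, so an error e' |D| is at most e |h|. The
     summand 1 covers v = 0. *)
  pose e' := e / (2 * (`|v| + 1)).
  have v1 : 0 < `|v| + 1 by rewrite ltr_wpDl.
  have e'0 : 0 < e' by rewrite divr_gt0// mulr_gt0.
  have [s /= s0 sP] := (@nbhs_ballP _ _ _ _).1 (differentiable_near dk' e'0).
  near=> h.
  have h0 : h != 0 by near: h; exact: nbhs_dnbhs_neq.
  have Oh : O (h *: v + y) by near: h; exact: cvg_within near_O.
  have hs : `|h| < s / (2 * (`|v| + 1)).
    near: h; apply: cvg_within; apply/nbhs_ballP.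
    exists (s / (2 * (`|v| + 1))) => /=; first by rewrite divr_gt0// mulr_gt0.
    by move=> z; rewrite -ball_normE /= sub0r normrN.
  have [Ghr Ghk] := GP Oh.
  set D := G (h *: v + y) - x.
  have DL : `|D| <= 2 * (`|h| * `|v|).
    by apply: le_trans (GL Oh Oy) _; rewrite addrK normrZ.
  have hv : `|h| * `|v| <= `|h| * (`|v| + 1) by rewrite ler_wpM2l// lerDl.
  have Ds : ball 0 s D.
    rewrite -ball_normE /= sub0r normrN; apply: le_lt_trans DL _.
    move: hs; rewrite ltr_pdivlMr ?mulr_gt0//; lra.
  have := sP _ Ds; rewrite /= -deriveE// Dk// /D [x + _]addrC subrK Ghk Gk addrK.
  rewrite -/D => H.
  have -> : v - q h *m J x = h^-1 *: (h *: v - D *m J x).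
    by rewrite scalerBr scalerA mulVf// scale1r -scalemxAl.
  rewrite normrZ normfV ler_pdivrMl ?normr_gt0//.
  apply: le_trans H _; apply: (@le_trans _ _ (e' * (2 * (`|h| * (`|v| + 1))))).
    by rewrite ler_pM2l//; lra.
  rewrite le_eqVlt; apply/orP; left; apply/eqP; rewrite /e'; field; lra.
have qE : q = fun h => (q h *m J x) *m invmx (J x).
  by apply/funext => h; rewrite mulmxK// Ju// ltW.
have qc : q @ 0^' --> v *m invmx (J x).
  rewrite qE; apply: (@cvg_comp _ _ _ (fun h => q h *m J x)
    (fun w => w *m invmx (J x)) _ _ _ qJ).
  have : Ck_on 0 setT (fun w : 'rV[R]_d => w *m invmx (J x)).
    apply: Ck_on_mul_mx; [exact: openT|exact: Ck_on_id|exact: Ck_on_cst].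
  move=> C0; exact: (Ck_on_continuous C0 (I : setT v)).
split; first by apply/cvg_ex; exists (v *m invmx (J x)).
exact/cvg_lim.
Unshelve. all: by end_near. Qed.

Lemma inverse_function : exists (O : set 'rV[R]_d) G,
  [/\ O (k x0), smooth_on O G, G (k x0) = x0 & forall y, O y -> U (G y) /\ k (G y) = y].
Proof.
have Gc y : O y -> {for y, continuous G}.
  by move=> Oy; apply: (@lipschitz_continuous_at _ _ _ O G y 2) => // z; exact: GL.
exists O, G; have Ok : O (k x0) by exact: ballxx.
split=> //; last by move=> y /GP[/ltW/Br].
(* Bootstrapping: the derivative of [G] is a smooth expression in [G] itself, so each order of
   smoothness of [G] yields the next. *)
- split=> // n; elim: n => [|n IH]; split=> //; try exact: Gc.
  move=> v; split; first by move=> y Oy; exact: (dG v Oy).1.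
  apply: (Ck_on_eq (f := fun y => v *m invmx (J (G y)))) => //.
    by move=> y Oy; rewrite (dG v Oy).2.
  apply: Ck_on_mul_mx => //; first exact: Ck_on_cst.
  apply: Ck_on_invmx => //; first by move=> y /GP[/ltW/Ju].
  apply: (Ck_on_comp_mx oO sk.1 _ IH (CJ n)).
  by move=> y /GP[/ltW/Br].
- have [Gr Gk] := GP Ok; apply/subr0_eq/eqP; rewrite -normr_le0.
  have := lower (ltW Gr) (_ : `|x0 - x0| <= r).
  by rewrite Gk !subrr !normr0 mulr0; apply; exact: ltW.
Qed.

End InverseFunction.

Section SmoothOn.
Context {R : realType}.

Lemma smooth_on_sub (V W : normedModType R) (U U' : set V) (f : V -> W) :
  open U' -> U' `<=` U -> smooth_on U f -> smooth_on U' f.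
Proof. by move=> oU' sU [_ Cf]; split=> // k; exact: Ck_on_sub sU (Cf k). Qed.

Lemma smooth_on_eq (V W : normedModType R) (U : set V) (f g : V -> W) :
  (forall x, U x -> f x = g x) -> smooth_on U f -> smooth_on U g.
Proof. by move=> fg [oU Cf]; split=> // k; exact: Ck_on_eq fg (Cf k). Qed.

Lemma smooth_on_continuous (V W : normedModType R) (U : set V) (f : V -> W) x :
  smooth_on U f -> U x -> {for x, continuous f}.
Proof. by move=> [_ Cf]; exact: Ck_on_continuous (Cf 0%N). Qed.

Lemma open_preim (V : normedModType R) (W : normedModType R) (U : set V)
    (O : set W) (f : V -> W) :
  open U -> (forall x, U x -> {for x, continuous f}) -> open O ->
  open (U `&` f @^-1` O).
Proof.
move=> oU fc oO; rewrite openE => x [Ux Ofx]; apply: filterI.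
  exact: open_nbhs_nbhs.
exact: fc Ux _ (open_nbhs_nbhs (conj oO Ofx)).
Qed.

Lemma smooth_on_preim (V W : normedModType R) (U : set V) (O : set W) (f : V -> W) :
  smooth_on U f -> open O -> open (U `&` f @^-1` O).
Proof.
move=> sf oO; apply: open_preim => //; first exact: sf.1.
by move=> x; exact: smooth_on_continuous.
Qed.

Lemma smooth_on_comp m p q (V : normedModType R) (U : set V) (O : set 'rV[R]_m)
    (f : V -> 'rV[R]_m) (g : 'rV[R]_m -> 'M[R]_(p, q)) :
  smooth_on U f -> smooth_on O g -> smooth_on (U `&` f @^-1` O) (g \o f).
Proof.
move=> sf sg; have oUO := smooth_on_preim sf sg.1.
split=> // k; apply: (Ck_on_comp_mx (O := O)) => //; first exact: sg.1.
- by move=> x [].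
- by apply: Ck_on_sub (sf.2 k) => x [].
- exact: sg.2.
Qed.

Lemma smooth_on_mx (V : normedModType R) m n (U : set V) (f : V -> 'M[R]_(m, n)) :
  open U -> (forall i j, smooth_on U (fun x => f x i j)) -> smooth_on U f.
Proof.
move=> oU fij; split=> // k; apply/Ck_on_mx => // i j; exact: (fij i j).2.
Qed.

Lemma smooth_on_coord m n (U : set 'M[R]_(m, n)) i j :
  open U -> smooth_on U (fun x : 'M[R]_(m, n) => x i j).
Proof. by move=> oU; split=> // k; apply: (Ck_on_mx k id oU).1; exact: Ck_on_id. Qed.

Lemma smooth_on_cst (V W : normedModType R) (U : set V) (a : W) :
  open U -> smooth_on U (fun=> a).
Proof. by move=> oU; split=> // k; exact: Ck_on_cst. Qed.

Lemma smooth_onD (V W : normedModType R) (U : set V) (f g : V -> W) :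
  smooth_on U f -> smooth_on U g -> smooth_on U (fun x => f x + g x).
Proof. by move=> [oU Cf] [_ Cg]; split=> // k; exact: Ck_onD. Qed.

Lemma smooth_onM (V : normedModType R) (U : set V) (f g : V -> R) :
  smooth_on U f -> smooth_on U g -> smooth_on U (fun x => f x * g x).
Proof. by move=> [oU Cf] [_ Cg]; split=> // k; exact: Ck_onM. Qed.

Lemma smooth_onN (V : normedModType R) (U : set V) (f : V -> R) :
  smooth_on U f -> smooth_on U (fun x => - f x).
Proof.
move=> sf; have := smooth_onM (smooth_on_cst (-1 : R) sf.1) sf.
by apply: smooth_on_eq => x _; rewrite mulN1r.
Qed.

Lemma smooth_onV (V : normedModType R) (U : set V) (f : V -> R) :
  (forall x, U x -> f x != 0) -> smooth_on U f -> smooth_on U (fun x => (f x)^-1).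
Proof. by move=> f0 [oU Cf]; split=> // k; exact: Ck_onV. Qed.

Lemma smooth_on_mul_mx (V : normedModType R) m p q (U : set V) (f : V -> 'M[R]_(m, p))
    (g : V -> 'M[R]_(p, q)) :
  smooth_on U f -> smooth_on U g -> smooth_on U (fun x => f x *m g x).
Proof. by move=> [oU Cf] [_ Cg]; split=> // k; exact: Ck_on_mul_mx. Qed.

Lemma smooth_on_id (V : normedModType R) (U : set V) : open U -> smooth_on U id.
Proof. by move=> oU; split=> // k; exact: Ck_on_id. Qed.

Lemma smooth_on_differentiable m p q (U : set 'rV[R]_m) (f : 'rV[R]_m -> 'M[R]_(p, q)) x :
  smooth_on U f -> U x -> differentiable f x.
Proof. by move=> sf Ux; exact: C1_differentiable_mx sf.1 (sf.2 1%N) Ux. Qed.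

Lemma smooth_on_derivable (V W : normedModType R) (U : set V) (f : V -> W) x v :
  smooth_on U f -> U x -> derivable f x v.
Proof. by move=> sf Ux; exact: ((sf.2 1%N).2 v).1. Qed.

Lemma derive_affine m n (p : 'rV[R]_n) (B : 'M[R]_(m, n)) x v :
  'D_v (fun z => p + z *m B) x = v *m B.
Proof.
apply: lim_near_cst => //; near=> h.
have h0 : h != 0 by near: h; exact: nbhs_dnbhs_neq.
rewrite /= mulmxDl -scalemxAl opprD addrACA subrr add0r addrK.
by rewrite scalerA mulVf// scale1r.
Unshelve. all: by end_near. Qed.

(** The rows of [B] are preimages of the basis vectors under the differential, so [F] restricted to
    the affine slice p + z B has derivative the identity at 0. The section is the local inverse of
    this restriction followed by the slice. *)
Lemma submersion_section m d (U : set 'rV[R]_m) (F : 'rV[R]_m -> 'rV[R]_d) p :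
  smooth_on U F -> U p -> range ('d F p) = setT ->
  exists (O : set 'rV[R]_d) G, [/\ O (F p), smooth_on O G, G (F p) = p &
    forall y, O y -> U (G y) /\ F (G y) = y].
Proof.
move=> sF Up rF.
have ontoF i : exists u, 'd F p u = delta_mx 0 i.
  have : range ('d F p) (delta_mx 0 i) by rewrite rF.
  by case=> u _ <-; exists u.
pose B : 'M[R]_(d, m) := \matrix_i sval (cid (ontoF i)).
pose aff (z : 'rV[R]_d) := p + z *m B.
have aff0 : aff 0 = p by rewrite /aff mul0mx addr0.
have saff : smooth_on setT aff.
  apply: smooth_onD; first by apply: smooth_on_cst; exact: openT.
  by apply: smooth_on_mul_mx; [apply: smooth_on_id|apply: smooth_on_cst]; exact: openT.
have sk := smooth_on_comp saff sF.
have p0U : (setT `&` aff @^-1` U) 0 by split=> //=; rewrite aff0.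
have dk i : 'D_(delta_mx 0 i) (F \o aff) 0 = delta_mx 0 i.
  have daff : derivable aff 0 (delta_mx 0 i) by exact: smooth_on_derivable saff I.
  have dF : differentiable F (aff 0).
    by rewrite aff0; exact: smooth_on_differentiable sF Up.
  rewrite (derive_compdir daff dF).2 derive_affine aff0 deriveE -?aff0// aff0.
  by rewrite -rowE rowK; case: cid.
have [N [G [Nk sG G0 GP]]] := inverse_function sk p0U dk.
exists N, (aff \o G); split.
- by move: Nk; rewrite /= aff0.
- apply: smooth_on_sub (smooth_on_comp sG saff); first exact: sG.1.
  by move=> y Ny; split.
- by move: G0; rewrite /= aff0 => ->.
- by move=> y /GP[[_ ?] ?].
Qed.

Lemma open_local (V : normedModType R) (A : set V) :
  (forall x, A x -> exists O, [/\ open O, O x & O `<=` A]) -> open A.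
Proof.
move=> oA; rewrite openE => x /oA[N [oN Nx sN]].
by apply: filterS sN _; exact: open_nbhs_nbhs.
Qed.

Lemma open_gt0 (V : normedModType R) (f : V -> R) : smooth_on setT f -> open [set x | 0 < f x].
Proof.
move=> sf; rewrite -[X in open X]setTI.
exact: (smooth_on_preim sf (@open_gt R 0)).
Qed.

Lemma open_forall_gt0 (V : normedModType R) (J : finType) (f : J -> V -> R) :
  (forall i, smooth_on setT (f i)) -> open [set x | forall i, 0 < f i x].
Proof.
move=> sf; rewrite openE => x px.
change (\forall y \near x, forall i, 0 < f i y).
apply: filter_forall => i.
exact: (open_nbhs_nbhs (conj (open_gt0 (sf i)) (px i))).
Qed.

End SmoothOn.

(** * Charts of quotients *)

Section GoodCharts.
Context {R : realType} {T : Type} {m d : nat}.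
Variables (M : set T) (e : T -> 'rV[R]_m) (E : T -> T -> Prop).
Local Notation q := (eclass M E).
Implicit Types (b c : chart R (set T) d) (x : T).

(* [b] is smooth in the ambient coordinates [e] near [x], and the quotient map
   has a smooth local section through [x] over the chart [b]. *)
Definition good_at b x := [/\ cdom b (q x),
  exists O H, [/\ O (e x), smooth_on O H & forall x', M x' -> O (e x') ->
    cdom b (q x') /\ b (q x') = H (e x')]
  & exists O G, [/\ O (b (q x)), smooth_on O G, G (b (q x)) = e x &
    forall z, O z -> exists x',
      [/\ M x', e x' = G z, cdom b (q x') & b (q x') = z]]].

Definition good_chart b :=
  is_chart (quotient M E) b /\ forall x, M x -> cdom b (q x) -> good_at b x.

Lemma chart_inj b y y' : is_chart (quotient M E) b ->
  cdom b y -> cdom b y' -> b y = b y' -> y = y'.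
Proof. by move=> [_ bi _] by_ by'; apply: bi; rewrite inE. Qed.

Lemma quotient_repr y : quotient M E y -> exists2 x, M x & q x = y.
Proof. by case=> x Mx <-; exists x. Qed.

(** The transition map is the section belonging to [b] followed by the ambient expression of
    [b']. *)
Lemma good_good_at b b' x : good_chart b -> good_chart b' -> M x ->
  cdom b (q x) -> cdom b' (q x) -> exists O F, [/\ O (b (q x)), smooth_on O F &
    forall z, O z -> exists y, [/\ cdom b y, cdom b' y, b y = z & b' y = F z]].
Proof.
move=> [bc bg] [_ bg'] Mx bx b'x.
have [_ _ [N [G [Nx sG GE GP]]]] := bg _ Mx bx.
have [_ [N' [H [N'x sH HP]]] _] := bg' _ Mx b'x.
exists (N `&` G @^-1` N'), (H \o G); split.
- by split=> //=; rewrite GE.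
- exact: smooth_on_comp sG sH.
- move=> z [Nz N'z]; have [x' [Mx' ex' bx' bx'z]] := GP _ Nz.
  have [|b'x' Hx'] := HP x' Mx'; first by rewrite ex'.
  by exists (q x'); split; rewrite //= -ex'.
Qed.

Lemma good_compat_half b b' : good_chart b -> good_chart b' ->
  open (b @` (cdom b `&` cdom b')) /\ smooth_wrt (cdom b `&` cdom b') b b'.
Proof.
move=> gb gb'; have bc := gb.1; split.
  apply: open_local => _ [y [yb yb'] <-].
  have [bM _ _] := bc; have [x Mx xy] := quotient_repr (bM _ yb); subst y.
  have [N [F [Nx sF FP]]] := good_good_at gb gb' Mx yb yb'.
  exists N; split=> //; first exact: sF.1.
  by move=> z /FP[y [by_ by' bz _]]; exists y.
move=> y [yb yb']; have [bM _ _] := bc.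
have [x Mx xy] := quotient_repr (bM _ yb); subst y.
have [N [F [Nx sF FP]]] := good_good_at gb gb' Mx yb yb'.
exists N, F; split=> // y' [y'b _] /FP[y [by_ _ bz <-]].
by rewrite (chart_inj bc by_ y'b bz).
Qed.

Lemma good_compatible b b' : good_chart b -> good_chart b' -> compatible b b'.
Proof.
move=> gb gb'; have [p1 s1] := good_compat_half gb gb'.
have [p2 s2] := good_compat_half gb' gb.
by split=> //; [rewrite setIC|rewrite [X in smooth_wrt X]setIC].
Qed.

(** At each point the submersion property supplies one good chart; a smooth change of coordinates
    carries goodness from it to every other chart of the atlas there. *)
Lemma good_transfer b c x : is_chart (quotient M E) b ->
  is_chart (quotient M E) c -> M x -> good_at b x -> compatible b c -> cdom c (q x) ->
  good_at c x.
Proof.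
move=> bc cc Mx [bx [N [H [Nx sH HP]]] [N' [G [N'x sG GE GP]]]] [pW pW' sbc scb] cx.
have xbc : (cdom b `&` cdom c) (q x) by [].
split=> //.
- have [N2 [F [N2x sF FP]]] := sbc _ xbc.
  (* [F] agrees with [c] only at values of [b] taken on both domains. Intersecting with this open
     image also forces nearby classes into [cdom c]. *)
  pose N3 := N2 `&` b @` (cdom b `&` cdom c).
  have oN3 : open N3 by apply: openI => //; exact: sF.1.
  have sF3 : smooth_on N3 F by apply: smooth_on_sub sF => // z [].
  exists (N `&` H @^-1` N3), (F \o H); split.
  + split=> //=; rewrite -(HP x Mx Nx).2.
    by split; [exact: N2x|exists (q x)].
  + exact: smooth_on_comp sH sF3.
  + move=> x' Mx' [Nx' [/= N2x' [y [by_ cy] byx']]].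
    have [bx' bHx'] := HP _ Mx' Nx'.
    have yE : y = q x' by apply: (chart_inj bc by_ bx'); rewrite byx' bHx'.
    rewrite -yE in bx' bHx' *; split=> //.
    by rewrite FP// byx'.
- have [N2 [F [N2x sF FP]]] := scb _ xbc.
  pose N3 := c @` (cdom b `&` cdom c).
  have sG' := smooth_on_comp sF sG.
  exists ((N2 `&` F @^-1` N') `&` N3), (G \o F); split.
  + split; last by exists (q x).
    by split=> //=; rewrite -(FP (q x)).
  + by apply: (smooth_on_sub _ _ sG') => [|z []//]; apply: openI => //; exact: sG'.1.
  + by rewrite /= -(FP (q x)).
  + move=> z [[N2z N'z] [y [by_ cy] cyz]].
    have [x' [Mx' ex' bx' bx'z]] := GP _ N'z.
    have yE : y = q x'.
      by apply: (chart_inj bc by_ bx'); rewrite bx'z -cyz; apply: FP => //; rewrite cyz.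
    by exists x'; split=> //; rewrite -yE.
Qed.

Lemma embedded_atlasP k (c : chart R T k) x : embedded_atlas e M c -> cdom c x ->
  [/\ M x,
   exists O C, [/\ O (e x), smooth_on O C &
     forall y, M y -> O (e y) -> cdom c y /\ c y = C (e y)]
   & exists O G, [/\ O (c x), smooth_on O G &
     forall y, cdom c y -> O (c y) -> e y = G (c y)]].
Proof.
move=> [[cM _ _] cP] cx; have [_ [->/=]] := cP _ cx.
case=> _ [N [oN Nx NP]] sce sec; split; first exact: cM.
  have [N' [C [N'x sC CP]]] := sec _ (conj cx I).
  exists (N `&` N'), C; split=> //.
    by apply: (smooth_on_sub _ _ sC) => [|z []//]; apply: openI => //; exact: sC.1.
  move=> y My [Ny N'y]; have cy := NP _ My I Ny; split=> //.
  exact: CP.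
have [N' [G [N'x sG GP]]] := sce _ (conj cx I).
by exists N', G; split=> // y cy N'y; apply: GP.
Qed.

(** The inverse function theorem enters here: a local section of the coordinate expression [F],
    followed by the parametrisation of the embedded chart [c], is an ambient section of the quotient
    map. *)
Lemma submersion_good_at k (c : chart R T k) b F x :
  embedded_atlas e M c -> cdom c x -> local_expr q c b F ->
  range ('d F (c x)) = setT -> good_at b x.
Proof.
move=> ac cx [cb sF bF] rF; have cc := ac.1.
have qb y : cdom c y -> cdom b (q y) by move=> cy; apply: cb; exists y.
have [Mx [N [C [Nx sC CP]]] [N' [G [N'x sG GP]]]] := embedded_atlasP ac cx.
have Fx : (c @` cdom c) (c x) by exists x.
split; first exact: qb.
  exists (N `&` C @^-1` (c @` cdom c)), (F \o C); split.
  - by split=> //=; rewrite -(CP x Mx Nx).2; exists x.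
  - exact: smooth_on_comp sC sF.
  - move=> y My [Ny _]; have [cy cyE] := CP _ My Ny.
    by split; [exact: qb|rewrite bF//= -cyE].
have [W [S [Wx sS SE SP]]] := submersion_section sF Fx rF.
have qxE : b (q x) = F (c x) by exact: bF.
exists (W `&` S @^-1` N'), (G \o S); split.
- by split; rewrite ?qxE//= SE.
- exact: smooth_on_comp sS sG.
- by rewrite qxE /= SE -GP.
- move=> z [Wz N'z]; have [[y cy cyS] FS] := SP _ Wz.
  exists y; split.
  + by case: cc => cM _ _; exact: cM.
  + by rewrite /= -cyS GP// cyS.
  + exact: qb.
  + by rewrite bF// cyS.
Qed.

Lemma structure_good k (Q : set (chart R (set T) d)) b :
  quotient_structure M (embedded_atlas (k := k) e M) E Q -> Q b -> good_chart b.
Proof.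
move=> [[Qc _ Qcomp _ _] sub] Qb; split; first exact: Qc.
move=> x Mx bx; have [c [b1 [F [ac Qb1 cx lF rF]]]] := sub _ Mx.
apply: (@good_transfer b1) => //; [exact: Qc|exact: Qc| |exact: Qcomp].
exact: submersion_good_at ac cx lF rF.
Qed.

(** Goodness does not mention the atlas. All charts of [Q] are good, good charts are mutually
    compatible, and [Q] is maximal, so [Q] contains every good chart. *)
Lemma quotient_structure_unique k (Q : set (chart R (set T) d)) :
  quotient_structure M (embedded_atlas (k := k) e M) E Q -> Q = good_chart.
Proof.
move=> QS; apply/seteqP; split=> b; first exact: structure_good QS.
move=> gb; have [[_ _ _ Qmax _] _] := QS; apply: Qmax; first exact: gb.1.
by move=> c Qc; apply: good_compatible => //; exact: structure_good QS Qc.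
Qed.

Lemma good_submersion k (c : chart R T k) b x :
  embedded_atlas e M c -> cdom c x -> good_at b x ->
  exists (c' : chart R T k) F, [/\ embedded_atlas e M c', cdom c' x, local_expr q c' b F
                 & range ('d F (c' x)) = setT] .
Proof.
move=> ac cx [bx [N [H [Nx sH HP]]] [W [S [Wx sS SE SP]]]].
have [Mx [N1 [C [N1x sC CP]]] [N2 [G [N2x sG GP]]]] := embedded_atlasP ac cx.
have [[cM ci oc] _] := ac.
(* [c] is shrunk to the points where [H] describes [b] and [G] recovers the ambient coordinates, so
   that [H \o G] expresses the quotient map on all of [D]. *)
pose D := [set y | [/\ cdom c y, N (e y) & N2 (c y)]].
have Dc : D `<=` cdom c by move=> y [].
have Dx : D x by [].
have DE : c @` D = (c @` cdom c) `&` (N2 `&` G @^-1` N).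
  apply/seteqP; split=> [_ [y [cy Ny N2y] <-]|_ [[y cy <-] [N2y Ny]]].
    by split; [exists y|split; rewrite //= -GP].
  by exists y => //; split=> //; rewrite GP.
have oD : open (c @` D).
  by rewrite DE; apply: openI => //; exact: smooth_on_preim sG sH.1.
have sF : smooth_on (c @` D) (H \o G).
  by apply: (smooth_on_sub oD _ (smooth_on_comp sG sH)); rewrite DE => z [].
exists (Chart D c), (H \o G); split=> //.
- split; first split=> //.
  + by move=> y /Dc/cM.
  + by move=> y y'; rewrite !inE => /Dc cy /Dc cy'; apply: ci; rewrite inE.
  + move=> y Dy; have [cy Ny N2y] := Dy; exists (Chart setT e); split=> //; split=> //.
    * have [My [N3 [C3 [N3y sC3 C3P]]] _] := embedded_atlasP ac cy.
      exists ((N3 `&` C3 @^-1` N2) `&` N); split.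
      - by apply: openI; [exact: smooth_on_preim sC3 sG.1|exact: sH.1].
      - by split=> //; split=> //=; rewrite -(C3P _ My N3y).2.
      - move=> y' My' _ [[N3y' /= N2y'] Ny'].
        have [cy' cyE] := C3P _ My' N3y'.
        by split=> //=; rewrite cyE.
    * move=> y1 [D1 _]; have [_ _ [N3 [G3 [N3y sG3 G3P]]]] := embedded_atlasP ac (Dc _ D1).
      by exists N3, G3; split=> // y' [/Dc cy' _]; exact: G3P.
    * move=> y1 [D1 _]; have [_ [N3 [C3 [N3y sC3 C3P]]] _] := embedded_atlasP ac (Dc _ D1).
      exists N3, C3; split=> // y' [/Dc cy' _] N3y'.
      by apply: (C3P _ _ N3y').2; exact: cM.
- split=> //.
  + by move=> _ [y [cy Ny _] <-]; exact: (HP _ (cM _ cy) Ny).1.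
  + by move=> y [cy Ny N2y] /=; rewrite (HP _ (cM _ cy) Ny).2 GP.
- apply/seteqP; split=> // v _.
  (* Near [z] the map [K], from values of [b] to values of [c], is a right inverse of [H \o G]; so
     the derivative of [K] along [v] is a preimage of [v]. *)
  pose K := C \o S; set z := b (q x) in Wx SE.
  have sK := smooth_on_comp sS sC.
  have Kz : (W `&` S @^-1` N1) z by split=> //=; rewrite SE.
  have KzE : K z = c x by rewrite /K /= SE (CP _ Mx N1x).2.
  have dF : differentiable (H \o G) (K z).
    by rewrite KzE; apply: (smooth_on_differentiable sF); exists x.
  have dK : derivable K z v by exact: smooth_on_derivable sK Kz.
  exists ('D_v K z) => //; rewrite /= -KzE -deriveE// -(derive_compdir dK dF).2.
  rewrite -[RHS](derive_id z v); apply: near_eq_derive.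
  have oN : open ((W `&` S @^-1` N1) `&` K @^-1` (c @` D)).
    exact: smooth_on_preim sK oD.
  have oN' := smooth_on_preim sS sH.1.
  apply: filterS (open_nbhs_nbhs (conj (openI oN oN') _)); last first.
    split; last by split=> //=; rewrite SE.
    by split=> //=; rewrite -/K -/(K z) KzE; exists x.
  move=> w [[[Ww N1w] [y Dy cyK]] [_ Nw]].
  have [x' [Mx' ex' bx' bx'w]] := SP _ Ww.
  have N1x' : N1 (e x') by rewrite ex'.
  have [cx' cx'E] := CP _ Mx' N1x'.
  have Kw : K w = c x' by rewrite /K /= -ex' -cx'E.
  have yx' : y = x' by apply: ci; rewrite ?inE//; [exact: Dc|rewrite cyK Kw].
  have [_ Ny N2y] := Dy; rewrite yx' in Ny N2y.
  have Nx' := Ny.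
  by rewrite /= -/(K w) Kw -GP// -(HP _ Mx' Nx').2 bx'w.
Qed.

Lemma good_quotient_structure k :
  (forall x, M x -> exists2 c : chart R T k, embedded_atlas e M c & cdom c x) ->
  (forall x, M x -> exists2 b, good_chart b & cdom b (q x)) ->
  mfd_hausdorff (quotient M E) good_chart ->
  mfd_second_countable (quotient M E) good_chart ->
  quotient_structure M (embedded_atlas (k := k) e M) E good_chart.
Proof.
move=> embc covb Hd sc; split; [split=> //|].
- by move=> b [].
- by move=> y /quotient_repr[x Mx <-]; have [b gb bx] := covb _ Mx; exists b.
- exact: good_compatible.
- move=> c cc comp; split=> // x Mx cx; have [b gb bx] := covb _ Mx.
  apply: (@good_transfer b) => //; [exact: gb.1|exact: gb.2|].
  by have [? ? ? ?] := comp _ gb; split=> //; rewrite setIC.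
- move=> x Mx; have [b gb bx] := covb _ Mx; have [c ac cx] := embc _ Mx.
  have [c' [F [ac' c'x lF rF]]] := good_submersion ac cx (gb.2 _ Mx bx).
  by exists c', b, F.
Qed.

End GoodCharts.

(** * The group U_0 and its automorphisms *)

Section U0Coordinates.
Context {R : realType}.
Local Notation C := R[i].
Local Notation Re := (@complex.Re R).
Local Notation Im := (@complex.Im R).
Implicit Types (A B : U0 R) (z w : C).

Definition rot A : C := U0mx A 0 0.
Definition trans A : C := U0mx A 0 1.

Lemma complex_ext z w : Re z = Re w -> Im z = Im w -> z = w.
Proof. by case: z w => [a b] [a' b'] /= -> ->. Qed.

Lemma norm1_conjc z : (`|z| == 1) = (z * z^*%C == 1).
Proof.
rewrite -sqr_normc; apply/eqP/eqP => [->|z1]; first by rewrite expr1n.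
by apply/eqP; rewrite -(@eqrXn2 _ 2%N) ?z1 ?expr1n.
Qed.

Lemma rotJ A : rot A * (rot A)^*%C = 1.
Proof.
by case: A => A Ap; apply/eqP; rewrite -norm1_conjc; case/and3P: (Ap).
Qed.

Lemma U0mxE A : U0mx A = mx2 (rot A) (trans A) 0 (rot A)^*%C.
Proof.
have [/eqP A0 /eqP A1] : U0mx A 1 0 == 0 /\ U0mx A 1 1 == (rot A)^*%C.
  by rewrite /rot; case: A => A Ap; case/and3P: (Ap).
by apply: mx2P; rewrite !mxE.
Qed.

Lemma U0_ext A B : rot A = rot B -> trans A = trans B -> A = B.
Proof. by move=> ab tb; apply: val_inj; rewrite /= !U0mxE ab tb. Qed.

Lemma U0_of_pred (a b : C) : a * a^*%C = 1 -> U0_pred (mx2 a b 0 a^*%C).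
Proof. by move=> /eqP; rewrite -norm1_conjc /U0_pred !mxE /= !eqxx. Qed.

(** The value is the identity when [a] is not of modulus 1; the lemmas about it assume
    [a * a^*%C = 1]. *)
Definition U0_of (a b : C) : U0 R := insubd (1%g : U0 R) (mx2 a b 0 a^*%C).

Lemma U0_ofE a b : a * a^*%C = 1 -> U0mx (U0_of a b) = mx2 a b 0 a^*%C.
Proof. by move=> /(U0_of_pred b) ab; rewrite -[U0mx _]/(val _) insubdK. Qed.

Lemma rot_of a b : a * a^*%C = 1 -> rot (U0_of a b) = a.
Proof. by move=> aJ; rewrite /rot U0_ofE// mxE. Qed.

Lemma trans_of a b : a * a^*%C = 1 -> trans (U0_of a b) = b.
Proof. by move=> aJ; rewrite /trans U0_ofE// mxE. Qed.

Lemma U0mulE A B : U0mx (A * B)%g = U0mx A *m U0mx B. Proof. by []. Qed.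

Lemma rotM A B : rot (A * B)%g = rot A * rot B.
Proof. by rewrite /rot U0mulE mulmx2E (U0mxE B) !mxE /= mulr0 addr0. Qed.

Lemma transM A B : trans (A * B)%g = rot A * trans B + trans A * (rot B)^*%C.
Proof. by rewrite /trans U0mulE mulmx2E {2}(U0mxE B) !mxE. Qed.

Lemma rot1 : rot 1%g = 1. Proof. by rewrite /rot mxE. Qed.
Lemma trans1 : trans 1%g = 0. Proof. by rewrite /trans mxE. Qed.

Lemma U0V A : (A^-1)%g = U0_of (rot A)^*%C (- trans A).
Proof.
have aJ : (rot A)^*%C * (rot A)^*%C^*%C = 1 by rewrite conjcK mulrC rotJ.
by apply: U0_ext; rewrite ?rot_of ?trans_of// /rot /trans -[U0mx _]/(U0_invmx A)
  /U0_invmx !mxE //= {1}U0mxE mxE.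
Qed.

Lemma rotV A : rot (A^-1)%g = (rot A)^*%C.
Proof. by rewrite U0V rot_of// conjcK mulrC rotJ. Qed.

Lemma transV A : trans (A^-1)%g = - trans A.
Proof. by rewrite U0V trans_of// conjcK mulrC rotJ. Qed.

Definition cj (k : bool) z : C := if k then z^*%C else z.

Lemma cjD k z w : cj k (z + w) = cj k z + cj k w.
Proof. by case: k => //=; rewrite rmorphD. Qed.
Lemma cjB k z w : cj k (z - w) = cj k z - cj k w.
Proof. by case: k => //=; rewrite rmorphB. Qed.
Lemma cjM k z w : cj k (z * w) = cj k z * cj k w.
Proof. by case: k => //=; rewrite rmorphM. Qed.
Lemma cjC k z : cj k z^*%C = (cj k z)^*%C. Proof. by case: k. Qed.
Lemma cj1 k : cj k 1 = 1. Proof. by case: k; rewrite /cj ?conjc1. Qed.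
Lemma cjr k (x : R) : cj k x%:C%C = x%:C%C. Proof. by case: k; rewrite /cj ?conjc_real. Qed.
Lemma cjK k : involutive (cj k). Proof. by case: k => z //=; rewrite conjcK. Qed.
Lemma cj_eq0 k z : (cj k z == 0) = (z == 0).
Proof. by case: k => //=; rewrite conjc_eq0. Qed.

Lemma cj_unit k z : z * z^*%C = 1 -> cj k z * (cj k z)^*%C = 1.
Proof. by move=> z1; rewrite -cjC -cjM z1 cj1. Qed.

(** The imaginary part obeys the product rule [transM] of the translation part, with rotation parts
    twisted by [cj k]. Hence a multiple of it may be added to the translation part of an
    automorphism. *)
Lemma Im_mulE k z w : (Im (z * w))%:C%C =
  cj k z * (Im w)%:C%C + (Im z)%:C%C * (cj k w)^*%C.
Proof.
case: k; case: z => a b; case: w => a' b'; apply: complex_ext => /=; ring.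
Qed.

Definition autU0 k (l m : C) A : U0 R :=
  U0_of (cj k (rot A)) (l * cj k (trans A) + m * (Im (rot A))%:C%C).

Lemma rot_aut k l m A : rot (autU0 k l m A) = cj k (rot A).
Proof. by rewrite rot_of//; exact/cj_unit/rotJ. Qed.

Lemma trans_aut k l m A :
  trans (autU0 k l m A) = l * cj k (trans A) + m * (Im (rot A))%:C%C.
Proof. by rewrite trans_of//; exact/cj_unit/rotJ. Qed.

Lemma autU0M k l m : {morph autU0 k l m : A B / (A * B)%g}.
Proof.
move=> A B; apply: U0_ext; first by rewrite rotM !rot_aut rotM cjM.
rewrite transM !rot_aut !trans_aut rotM transM (Im_mulE k) cjD !cjM !cjC.
ring.
Qed.

Definition aut_inv_lin k (l : C) := cj k l^-1.
(** Obtained by solving b' = l b^k + m Im a for b. For the antiholomorphic case the imaginary part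
    of the new rotation part is - Im a, which cancels the minus sign. *)
Definition aut_inv_tr k (l m : C) := if k then (l^-1 * m)^*%C else - (l^-1 * m).

Lemma autU0K k l m : l != 0 ->
  cancel (autU0 k l m) (autU0 k (aut_inv_lin k l) (aut_inv_tr k l m)).
Proof.
move=> l0 A; apply: U0_ext; rewrite ?rot_aut ?cjK// !trans_aut rot_aut.
rewrite /aut_inv_lin /aut_inv_tr cjD !cjM cjK cjr mulrDr mulrA -cjM mulVf// cj1 mul1r.
rewrite -addrA mulrA -[X in _ = X]addr0; congr (_ + _).
case: k => /=; last by rewrite mulNr subrr.
have -> : Im (rot A)^*%C = - Im (rot A) by case: (rot A).
by rewrite !rmorphM rmorphN; ring.
Qed.

Lemma aut_inv_lin_neq0 k l : l != 0 -> aut_inv_lin k l != 0.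
Proof. by move=> l0; rewrite cj_eq0 invr_eq0. Qed.

Lemma aut_invK k l m : l != 0 ->
  aut_inv_lin k (aut_inv_lin k l) = l /\
  aut_inv_tr k (aut_inv_lin k l) (aut_inv_tr k l m) = m.
Proof.
move=> l0; rewrite /aut_inv_lin /aut_inv_tr; case: k => /=.
  by rewrite -conjc_inv invrK conjcK; split=> //; rewrite -rmorphM conjcK mulVKf.
by rewrite invrK; split=> //; rewrite mulrN opprK mulVKf.
Qed.

Lemma autU0VK k l m : l != 0 ->
  cancel (autU0 k (aut_inv_lin k l) (aut_inv_tr k l m)) (autU0 k l m).
Proof.
move=> l0; have [E1 E2] := aut_invK k m l0.
by have := autU0K k (aut_inv_tr k l m) (aut_inv_lin_neq0 k l0); rewrite E1 E2.
Qed.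

End U0Coordinates.

Section ComplexSmooth.
Context {R : realType}.
Local Notation C := R[i].
Local Notation Re := (@complex.Re R).
Local Notation Im := (@complex.Im R).

Definition csmooth (V : normedModType R) (U : set V) (f : V -> C) :=
  smooth_on U (fun x => Re (f x)) /\ smooth_on U (fun x => Im (f x)).

Section Closure.
Variables (V : normedModType R) (U : set V).
Implicit Types f g : V -> C.

Lemma csmooth_eq f g : (forall x, U x -> f x = g x) -> csmooth U f -> csmooth U g.
Proof.
by move=> fg [sr si]; split; [apply: smooth_on_eq sr|apply: smooth_on_eq si] => x /fg ->.
Qed.

Lemma csmooth_sub (U' : set V) f : open U' -> U' `<=` U -> csmooth U f -> csmooth U' f.
Proof. by move=> oU' sU [sr si]; split; [apply: smooth_on_sub sr|apply: smooth_on_sub si]. Qed.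

Lemma csmooth_cst (z : C) : open U -> csmooth U (fun=> z).
Proof. by move=> oU; split; exact: smooth_on_cst. Qed.

Lemma csmooth_real (f : V -> R) : smooth_on U f -> csmooth U (fun x => (f x)%:C).
Proof. by move=> sf; split=> //; apply: smooth_on_cst; exact: sf.1. Qed.

Lemma csmoothD f g : csmooth U f -> csmooth U g -> csmooth U (fun x => f x + g x).
Proof.
move=> [fr fi] [gr gi]; split.
  apply: smooth_on_eq (smooth_onD fr gr) => x _; by case: (f x) (g x) => a b [].
apply: smooth_on_eq (smooth_onD fi gi) => x _; by case: (f x) (g x) => a b [].
Qed.

Lemma csmoothN f : csmooth U f -> csmooth U (fun x => - f x).
Proof.
move=> [fr fi]; split.
  apply: smooth_on_eq (smooth_onN fr) => x _; by case: (f x).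
apply: smooth_on_eq (smooth_onN fi) => x _; by case: (f x).
Qed.

Lemma csmoothB f g : csmooth U f -> csmooth U g -> csmooth U (fun x => f x - g x).
Proof. by move=> sf sg; apply: csmoothD => //; exact: csmoothN. Qed.

Lemma csmoothM f g : csmooth U f -> csmooth U g -> csmooth U (fun x => f x * g x).
Proof.
move=> [fr fi] [gr gi]; split.
  apply: smooth_on_eq (smooth_onD (smooth_onM fr gr) (smooth_onN (smooth_onM fi gi))) => x _.
  by case: (f x) (g x) => a b [].
apply: smooth_on_eq (smooth_onD (smooth_onM fr gi) (smooth_onM fi gr)) => x _.
by case: (f x) (g x) => a b [].
Qed.

Lemma csmoothJ f : csmooth U f -> csmooth U (fun x => (f x)^*%C).
Proof.
move=> [fr fi]; split.
  apply: smooth_on_eq fr => x _; by case: (f x).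
apply: smooth_on_eq (smooth_onN fi) => x _; by case: (f x).
Qed.

Lemma csmooth_cj k f : csmooth U f -> csmooth U (fun x => cj k (f x)).
Proof. by case: k => //; exact: csmoothJ. Qed.

Lemma csmooth_Im f : csmooth U f -> csmooth U (fun x => (Im (f x))%:C).
Proof. by move=> [_ fi]; exact: csmooth_real. Qed.

Lemma csmooth_sum (I : Type) (r : seq I) (P : pred I) (f : I -> V -> C) : open U ->
  (forall i, P i -> csmooth U (f i)) ->
  csmooth U (fun x => \sum_(i <- r | P i) f i x).
Proof.
move=> oU sf; elim: r => [|i r IH].
  by apply: (csmooth_eq (f := fun=> 0)) (csmooth_cst 0 oU) => x _; rewrite big_nil.
have [Pi|Pi] := boolP (P i).
  by apply: csmooth_eq (csmoothD (sf _ Pi) IH) => x _; rewrite big_cons Pi.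
by apply: csmooth_eq IH => x _; rewrite big_cons (negbTE Pi).
Qed.

Lemma sqr_complex_gt0 (z : C) : z != 0 -> 0 < Re z ^+ 2 + Im z ^+ 2.
Proof.
move=> z0; rewrite lt_neqAle addr_ge0 ?sqr_ge0// andbT eq_sym.
apply: contra z0; rewrite paddr_eq0 ?sqr_ge0// !sqrf_eq0.
by case: z => a b /= /andP[/eqP-> /eqP->].
Qed.

Lemma csmoothV f : (forall x, U x -> f x != 0) -> csmooth U f ->
  csmooth U (fun x => (f x)^-1).
Proof.
move=> f0 sf; have sJ := csmoothJ sf; have [Mr _] := csmoothM sf sJ.
have NE x : Re (f x * (f x)^*%C) = Re (f x) ^+ 2 + Im (f x) ^+ 2.
  by case: (f x) => a b /=; ring.
have N0 x : U x -> Re (f x * (f x)^*%C) != 0.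
  by move=> /f0/sqr_complex_gt0; rewrite NE lt0r => /andP[].
apply: csmooth_eq (csmoothM sJ (csmooth_real (smooth_onV N0 Mr))) => x Ux.
have := N0 _ Ux; rewrite NE; case: (f x) => a b /= ab0.
by apply: complex_ext => /=; field.
Qed.

End Closure.

Lemma mxvec_ind m p (P : 'I_(m * p) -> Prop) :
  (forall i j, P (mxvec_index i j)) -> forall l, P l.
Proof. by move=> PP l; case/mxvec_indexP: l. Qed.

Lemma smooth_mxvec (V : normedModType R) m p (U : set V) (f : V -> 'M[R]_(m, p)) :
  open U -> (forall i j, smooth_on U (fun x => f x i j)) ->
  smooth_on U (fun x => mxvec (f x)).
Proof.
move=> oU fij; apply: smooth_on_mx => // i; rewrite (ord1 i).
apply: mxvec_ind => k l; apply: smooth_on_eq (fij k l) => x _.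
by rewrite mxvecE.
Qed.

Definition centry m p (X : 'rV[R]_(m * p + m * p)) i j : C :=
  X 0 (lshift _ (mxvec_index i j)) +i* X 0 (rshift _ (mxvec_index i j)).

Lemma re_imK m p (A : 'M[C]_(m, p)) i j : centry (re_im A) i j = A i j.
Proof.
by apply: complex_ext; rewrite /centry /re_im ?row_mxEl ?row_mxEr /= mxvecE mxE.
Qed.

Lemma csmooth_centry m p (U : set 'rV[R]_(m * p + m * p)) i j : open U ->
  csmooth U (fun X => centry X i j).
Proof. by move=> oU; split; exact: smooth_on_coord. Qed.

Lemma smooth_re_im (V : normedModType R) m p (U : set V) (f : V -> 'M[C]_(m, p)) :
  open U -> (forall i j, csmooth U (fun x => f x i j)) ->
  smooth_on U (fun x => re_im (f x)).
Proof.
move=> oU fij; apply: smooth_on_mx => // i l; rewrite (ord1 i).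
case: (split_ordP l) => l' ->.
  elim/mxvec_ind: l' => k j; apply: smooth_on_eq (fij k j).1 => x _.
  by rewrite row_mxEl mxvecE mxE.
elim/mxvec_ind: l' => k j; apply: smooth_on_eq (fij k j).2 => x _.
by rewrite row_mxEr mxvecE mxE.
Qed.

Lemma csmooth_mx2 (V : normedModType R) (U : set V) (f g h k : V -> C) i j :
  csmooth U f -> csmooth U g -> csmooth U h -> csmooth U k ->
  csmooth U (fun x => mx2 (f x) (g x) (h x) (k x) i j).
Proof.
move=> sf sg sh sk.
have [->|i0] := eqVneq i 0; have [->|j0] := eqVneq j 0.
- by apply: csmooth_eq sf => x _; rewrite mxE.
- by apply: csmooth_eq sg => x _; rewrite mxE eqxx (negbTE j0).
- by apply: csmooth_eq sh => x _; rewrite mxE eqxx (negbTE i0).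
- by apply: csmooth_eq sk => x _; rewrite mxE (negbTE i0) (negbTE j0).
Qed.

Definition U0_pt (a b : C) := re_im (mx2 a b 0 a^*%C).

Lemma U0_coordE (A : U0 R) : U0_coord A = U0_pt (rot A) (trans A).
Proof. by rewrite /U0_coord U0mxE. Qed.

Lemma smooth_U0_pt (V : normedModType R) (U : set V) (a b : V -> C) :
  csmooth U a -> csmooth U b -> smooth_on U (fun x => U0_pt (a x) (b x)).
Proof.
move=> sa sb; have oU := sa.1.1; apply: smooth_re_im => // i j.
by apply: csmooth_mx2 => //; [exact: csmooth_cst|exact: csmoothJ].
Qed.

Lemma centry_rot (A : U0 R) : centry (U0_coord A) 0 0 = rot A.
Proof. by rewrite U0_coordE re_imK mxE. Qed.

Lemma centry_trans (A : U0 R) : centry (U0_coord A) 0 1 = trans A.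
Proof. by rewrite U0_coordE re_imK mxE. Qed.

Lemma smooth_autU0 k (l m : C) :
  smooth_wrt setT (@U0_coord R) (@U0_coord R \o autU0 k l m).
Proof.
move=> A _; exists setT, (fun X => U0_pt (cj k (centry X 0 0))
  (l * cj k (centry X 0 1) + m * (Im (centry X 0 0))%:C)).
have oT := @openT 'rV[R]_(2 * 2 + 2 * 2).
split=> //; last first.
  by move=> B _ _; rewrite centry_rot centry_trans /= U0_coordE rot_aut trans_aut.
apply: smooth_U0_pt.
  by apply: csmooth_cj; exact: csmooth_centry.
apply: csmoothD; apply: csmoothM; try exact: csmooth_cst.
  by apply: csmooth_cj; exact: csmooth_centry.
by apply: csmooth_Im; exact: csmooth_centry.
Qed.

Lemma autU0_AutU0 k (l m : C) : l != 0 -> AutU0 (@autU0 R k l m).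
Proof.
move=> l0; split; [exact: autU0M|exact: smooth_autU0|].
exists (autU0 k (aut_inv_lin k l) (aut_inv_tr k l m)); split.
- exact: autU0K.
- exact: autU0VK.
- exact: smooth_autU0.
Qed.

Definition rep_pt n (a b : 'I_n -> C) : 'rV[R]_(n * (2 * 2 + 2 * 2)) :=
  mxvec (\matrix_(i, j) U0_pt (a i) (b i) 0 j).

Lemma rep_coordE (F : groupType) n (s : 'I_n -> F) (rho : F -> U0 R) :
  rep_coord s rho = rep_pt (fun i => rot (rho (s i))) (fun i => trans (rho (s i))).
Proof.
by congr mxvec; apply/matrixP => i j; rewrite mxE U0_coordE [RHS]mxE.
Qed.

Lemma smooth_rep_pt (V : normedModType R) n (U : set V) (a b : 'I_n -> V -> C) :
  open U -> (forall i, csmooth U (a i)) -> (forall i, csmooth U (b i)) ->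
  smooth_on U (fun x => rep_pt (fun i => a i x) (fun i => b i x)).
Proof.
move=> oU sa sb; apply: smooth_mxvec => // i j.
have [_ CU] := smooth_U0_pt (sa i) (sb i).
split=> // k; have := (Ck_on_mx k _ oU).1 (CU k) 0 j.
by apply: Ck_on_eq => // x _; rewrite mxE.
Qed.

Definition rep_entry n (X : 'rV[R]_(n * (2 * 2 + 2 * 2))) i j k : C :=
  centry (row i (vec_mx X)) j k.

Definition rot_at n (X : 'rV[R]_(n * (2 * 2 + 2 * 2))) i := rep_entry X i 0 0.
Definition trans_at n (X : 'rV[R]_(n * (2 * 2 + 2 * 2))) i := rep_entry X i 0 1.

Lemma rep_entry_pt n (a b : 'I_n -> C) i j k :
  rep_entry (rep_pt a b) i j k = mx2 (a i) (b i) 0 (a i)^*%C j k.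
Proof.
rewrite -(re_imK (mx2 (a i) (b i) 0 (a i)^*%C)) /rep_entry /rep_pt mxvecK.
by congr (centry _ j k); apply/rowP => l; rewrite !mxE.
Qed.

Lemma rot_at_pt n (a b : 'I_n -> C) i : rot_at (rep_pt a b) i = a i.
Proof. by rewrite /rot_at rep_entry_pt mxE. Qed.

Lemma trans_at_pt n (a b : 'I_n -> C) i : trans_at (rep_pt a b) i = b i.
Proof. by rewrite /trans_at rep_entry_pt mxE. Qed.

Lemma rot_at_coord (F : groupType) n (s : 'I_n -> F) (rho : F -> U0 R) i :
  rot_at (rep_coord s rho) i = rot (rho (s i)).
Proof. by rewrite rep_coordE rot_at_pt. Qed.

Lemma trans_at_coord (F : groupType) n (s : 'I_n -> F) (rho : F -> U0 R) i :
  trans_at (rep_coord s rho) i = trans (rho (s i)).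
Proof. by rewrite rep_coordE trans_at_pt. Qed.

Lemma csmooth_rep_entry n (U : set 'rV[R]_(n * (2 * 2 + 2 * 2))) i j k : open U ->
  csmooth U (fun X => rep_entry X i j k).
Proof.
move=> oU; rewrite /rep_entry /centry; split => /=.
  apply: smooth_on_eq (smooth_on_coord 0 (mxvec_index i (lshift _ (mxvec_index j k))) oU).
  by move=> X _; rewrite !mxE.
apply: smooth_on_eq (smooth_on_coord 0 (mxvec_index i (rshift _ (mxvec_index j k))) oU).
by move=> X _; rewrite !mxE.
Qed.

End ComplexSmooth.

(** * Classification of the automorphisms of U_0 *)

Section AutClassification.
Import Normc.
Context {R : realType}.
Local Notation C := R[i].
Local Notation Re := (@complex.Re R).
Local Notation Im := (@complex.Im R).

(** The defect f x - x f(1) is additive in x and vanishes at integers, so p times it is the defect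
    at the fractional part of p x. This is bounded independently of p, and the Archimedean property
    makes the defect zero. *)
Lemma bounded_additive_linear (f : R -> C) (M : R) :
  {morph f : x y / x + y} -> (forall x, `|x| <= 1 -> normc (f x) <= M) ->
  forall x, f x = x%:C * f 1.
Proof.
move=> fD fM x.
have f0 : f 0 = 0 by apply: (@addrI _ (f 0)); rewrite -fD !addr0.
have fN y : f (- y) = - f y by apply: (@addrI _ (f y)); rewrite -fD !subrr.
have fn y p : f (y *+ p) = f y *+ p.
  by elim: p => [|p IH]; rewrite ?mulr0n// !mulrS fD IH.
have fz y (z : int) : f (y *~ z) = f y *~ z.
  by case: z => p; rewrite ?NegzE ?mulrNz ?fN fn.
have M0 : 0 <= M by apply: le_trans (fM 0 _); rewrite ?normr0// f0 normc0.
have bd (p : nat) : normc (f x - x%:C * f 1) *+ p <= M + M.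
  pose z := Num.floor (x *+ p).
  have /andP[z1 z2] : z%:~R <= x *+ p < (z + 1)%:~R.
    by rewrite Num.Theory.floor_le_tmp/= Num.Theory.floorD1_gt.
  pose y := x *+ p - z%:~R.
  have y01 : `|y| <= 1.
    by rewrite ger0_norm /y ?subr_ge0// lerBlDl ltW// -intrD1.
  have -> : normc (f x - x%:C * f 1) *+ p = normc (f y - y%:C * f 1).
    rewrite -normcMn; congr normc.
    rewrite /y fD fN fn -[z%:~R]/(1 *~ z) fz rmorphB rmorphMn rmorph_int.
    by rewrite mulrBl mulrzl opprB addrA subrK mulrnBl mulrnAl.
  apply: le_trans (le_normcD _ _) _; rewrite normcN normcM lerD//; first exact: fM.
  have -> : normc y%:C = `|y| by rewrite /normc /= expr0n addr0 sqrtr_sqr.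
  by rewrite -[leRHS]mul1r ler_pM// ?fM ?normr1// /normc; case: (f 1) => ? ?; rewrite sqrtr_ge0.
apply/subr0_eq/eq0_normc.
have N0 : 0 <= normc (f x - x%:C * f 1).
  by case: (_ - _) => ? ?; rewrite sqrtr_ge0.
apply/eqP; rewrite eq_le N0 andbT leNgt; apply/negP => Npos.
have := bd (Num.bound ((M + M) / normc (f x - x%:C * f 1))).
have := archi_boundP (divr_ge0 (addr_ge0 M0 M0) N0).
rewrite ltr_pdivrMr// [ltRHS]mulr_natl => H1 H2.
by have := lt_le_trans H1 H2; rewrite ltxx.
Qed.

Lemma unit_sqrt (u : C) : u * u^*%C = 1 ->
  exists2 a, a * a^*%C = 1 & a ^+ 2 = u.
Proof.
move=> u1; exists (sqrtc u); last exact: sqr_sqrtc.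
apply/eqP; rewrite -norm1_conjc -(@eqrXn2 _ 2%N)// -normrX sqr_sqrtc expr1n.
by rewrite norm1_conjc u1.
Qed.

(** The translations [U b] are preserved because they are commutators, which gives an additive map
    [L] of the plane. Conjugation by the diagonal elements [D a] makes [L] commute with rotations up
    to rotations, hence bounded and real linear, and then complex linear or antilinear. The images
    of the [D a] are finally recovered from this and from their commuting with [D 'i]. *)
Lemma AutU0P (g : U0 R -> U0 R) : AutU0 g ->
  exists k l m, l != 0 /\ g = autU0 k l m.
Proof.
move=> [gM _ [h [gK _ _]]].
have ginj : injective g := can_inj gK.
have one1 : (1 : C) * 1^*%C = 1 by rewrite conjc1 mulr1.
have i1 : 'i%C * ('i%C)^*%C = 1 :> C by apply: complex_ext => /=; ring.
have g1 : g 1%g = 1%g.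
  by apply: (@mulgI _ (g 1%g)); rewrite -gM !mulg1.
pose U b := U0_of (1 : C) b; pose D a := U0_of a (0 : C).
have rotgJ A : rot (g A) * (rot (g A))^*%C = 1 := rotJ _.
have rot0 A : rot (g A) != 0.
  by apply: contra_eq_neq (rotgJ A) => ->; rewrite mul0r eq_sym oner_neq0.
have rotU b : rot (g (U b)) = 1.
  (* [D 'i] conjugates [U hb] to [U (- hb)], so [U b] is the commutator of [D 'i] and [U hb];
     rotation parts multiply in a commutative group and are 1 on commutators. *)
  pose hb : C := - b / 2.
  have : (U b * (U hb * D 'i%C) = D 'i%C * U hb)%g.
    apply: U0_ext; rewrite !(rotM, transM) !(rot_of, trans_of)//; first by ring.
    have iJ : ('i%C)^*%C = - 'i%C :> C by apply: complex_ext => /=; ring.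
    have bE : b = - (hb + hb) by rewrite /hb; field.
    by rewrite {1}bE !mul1r iJ; ring.
  move=> /(congr1 (@rot R \o g)); rewrite /= !gM !rotM.
  rewrite [rot (g (D _)) * _]mulrC => E.
  apply: (mulIf (rot0 (U hb))); apply: (mulIf (rot0 (D 'i%C))).
  by rewrite mul1r -mulrA.
pose L b := trans (g (U b)).
have LD : {morph L : b c / b + c}.
  move=> b c; rewrite /L -[in LHS](_ : (U b * U c)%g = U (b + c)).
    by rewrite gM transM !rotU conjc1 mulr1 mul1r addrC.
  apply: U0_ext; rewrite !(rotM, transM) !(rot_of, trans_of)// ?conjc1; ring.
have L0 b : L b = 0 -> b = 0.
  move=> Lb; have : g (U b) = g 1%g.
    by rewrite g1; apply: U0_ext; rewrite ?rotU ?rot1 ?trans1.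
  by move=> /ginj/(congr1 (@trans R)); rewrite trans_of// trans1.
(* Conjugation by [D a] rotates translations by a^2, and its image under [g] rotates them by the
   square of the new rotation part. *)
have LDiag a b : a * a^*%C = 1 -> L (a ^+ 2 * b) = rot (g (D a)) ^+ 2 * L b.
  move=> a1; have : (D a * U b = U (a ^+ 2 * b)%R * D a)%g.
    apply: U0_ext; rewrite !(rotM, transM) !(rot_of, trans_of)//; first by ring.
    by rewrite conjc1 expr2 mul0r mul1r add0r addr0 -!mulrA
      [b * _]mulrC [a * (a^*%C * _)]mulrA a1 mul1r.
  move=> /(congr1 (@trans R \o g)); rewrite /= !gM !transM !rotU conjc1 mulr1 mul1r.
  rewrite addrC => /addrI E.
  have {}E : rot (g (D a)) * L b = L (a ^+ 2 * b) * (rot (g (D a)))^*%C by [].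
  by rewrite [in RHS]expr2 -mulrA E mulrCA rotgJ mulr1.
have Lunit u : u * u^*%C = 1 -> exists2 w, w * w^*%C = 1 & forall b, L (u * b) = w * L b.
  move=> /unit_sqrt[a a1 <-]; exists (rot (g (D a)) ^+ 2); last by move=> c; exact: LDiag.
  by rewrite rmorphXn -exprMn rotgJ expr1n.
have Lnorm u b : u * u^*%C = 1 -> normc (L (u * b)) = normc (L b).
  move=> /Lunit[w /eqP]; rewrite -norm1_conjc => /eqP/(congr1 Re) w1 ->.
  by rewrite normcM (_ : normc w = 1) ?mul1r.
have Lreal b (x : R) : L (x%:C * b) = x%:C * L b.
  have LbD : {morph (fun x : R => L (x%:C * b)) : x y / x + y}.
    by move=> y z /=; rewrite rmorphD mulrDl LD.
  rewrite (bounded_additive_linear (M := normc (L b)) LbD) ?rmorph1 ?mul1r//.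
  (* A real [y] in [-1, 1] is the average of the unit numbers [u] and its conjugate, and multiplying
     the argument of [L] by a unit number preserves the norm of the value. So the values at y b are
     bounded by the norm of [L b]. *)
  move=> y y1; pose t := Num.sqrt (1 - y ^+ 2).
  have t2 : t ^+ 2 = 1 - y ^+ 2.
    by rewrite sqr_sqrtr// subr_ge0 -real_normK ?num_real// expr_le1.
  pose u : C := Complex y t.
  have u1 : u * u^*%C = 1.
    by apply: complex_ext => /=; [rewrite mulrN opprK -!expr2 t2|]; ring.
  have uJ1 : u^*%C * (u^*%C)^*%C = 1 by rewrite conjcK mulrC.
  have : L (y%:C * b) *+ 2 = L (u * b) + L (u^*%C * b).
    rewrite -LD -mulrDl -[X in _ = L (X * _)](_ : y%:C *+ 2 = _).
      by rewrite mulrnAl !mulr2n LD.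
    by apply: complex_ext; rewrite mulr2n /= ?subrr ?addr0.
  move=> /(congr1 (@normc R)); rewrite normcMn => E.
  have := le_normcD (L (u * b)) (L (u^*%C * b)); rewrite -E (Lnorm u)// (Lnorm u^*%C)//.
  move: (normc _) (normc _) => p p'; lra.
have l0 : L 1 != 0 by apply: contra_neq (oner_neq0 C); exact: L0.
have [w _ Lw] := Lunit 'i%C i1.
have w2 : w ^+ 2 = -1.
  apply: (mulIf l0); rewrite expr2 -mulrA -!Lw mulr1.
  have -> : 'i%C * 'i%C = (-1)%:C * 1 :> C by apply: complex_ext => /=; ring.
  by rewrite Lreal rmorphN rmorph1.
have LE b : L b = (Re b)%:C * L 1 + (Im b)%:C * (w * L 1).
  rewrite -Lw -!Lreal -LD mulr1; congr L; case: b => p q.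
  by apply: complex_ext => /=; ring.
have [k wk] : exists k, w = cj k 'i%C.
  have : (w - 'i%C) * (w + 'i%C) == 0 by rewrite -subr_sqr w2 sqr_i subrr.
  rewrite mulf_eq0 subr_eq0 addr_eq0 => /orP[] /eqP ->; [by exists false|exists true].
  by apply: complex_ext => /=; ring.
pose l := L 1.
have Lcj b : L b = l * cj k b.
  rewrite LE wk -/l (_ : cj k b = (Re b)%:C + (Im b)%:C * cj k 'i%C); first by ring.
  by case: (k); case: b => p q; apply: complex_ext => /=; ring.
have th2 a : a * a^*%C = 1 -> rot (g (D a)) ^+ 2 = cj k (a ^+ 2).
  move=> a1; apply: (mulIf l0); rewrite -LDiag// mulr1 Lcj mulrC.
  by [].
(* [th2] determines only the square of the rotation part. Its sign is fixed by writing [a] itself as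
   the square of a unit number [r], since [D (r ^+ 2)] is the square of [D r]. *)
have thE a : a * a^*%C = 1 -> rot (g (D a)) = cj k a.
  move=> /unit_sqrt[r r1 <-]; rewrite -th2// [RHS]expr2 -rotM -gM; congr (rot (g _)).
  by apply: U0_ext; rewrite !(rotM, transM) !(rot_of, trans_of)// ?rmorphM ?mulr0 ?mul0r ?addr0//;
    rewrite mulrACA r1 mulr1.
pose m := trans (g (D 'i%C)).
have tauE a : a * a^*%C = 1 -> trans (g (D a)) = m * (Im a)%:C.
  (* Comparing the translation parts of the two sides after applying [g] gives a linear equation
     that expresses that of [g (D a)] by [m]. *)
  move=> a1; have : (D a * D 'i%C = D 'i%C * D a)%g.
    by apply: U0_ext; rewrite !(rotM, transM) !(rot_of, trans_of)// ?mulr0 ?mul0r// mulrC.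
  move=> /(congr1 (@trans R \o g)); rewrite /= !gM !transM !thE// -/m => E.
  have : trans (g (D a)) * (cj k ('i%C)^*%C - cj k 'i%C) = m * (cj k a^*%C - cj k a).
    rewrite !cjC !mulrBr; apply/eqP; rewrite subr_eq addrAC eq_sym subr_eq; apply/eqP.
    by rewrite [RHS]addrC [in RHS]mulrC addrC E; ring.
  have cji : cj k ('i%C)^*%C - cj k 'i%C != 0 :> C.
    by apply/eqP => /(congr1 Im); case: (k) => /=; lra.
  have -> : cj k a^*%C - cj k a = (Im a)%:C * (cj k ('i%C)^*%C - cj k 'i%C).
    by case: (k); case: (a) => p q; apply: complex_ext => /=; ring.
  by rewrite mulrA => /(mulIf cji).
exists k, l, m; split=> //; apply/funext => A.
have -> : A = (U (trans A * rot A)%R * D (rot A))%g.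
  have aJ := rotJ A.
  by apply: U0_ext; rewrite !(rotM, transM) !(rot_of, trans_of)// ?mul1r// add0r -mulrA aJ mulr1.
set A' := (_ * _)%g.
have aJ := rotJ A.
have rA' : rot A' = rot A by rewrite rotM !rot_of// mul1r.
have tA' : trans A' = trans A.
  by rewrite transM !(rot_of, trans_of)// mulr0 add0r -mulrA aJ mulr1.
apply: U0_ext; first by rewrite rot_aut rA' gM rotM rotU thE// mul1r.
rewrite trans_aut rA' tA' gM transM rotU thE// tauE// mul1r addrC; congr (_ + _).
rewrite -/(L _) Lcj cjM -!mulrA -cjC -cjM aJ cj1.
by rewrite mulr1.
Qed.

End AutClassification.

(** * Representations into U_0 and their invariants *)

Section RcU0Structure.
Context {R : realType} {F : groupType} {n : nat}.
Variables (c : R) (s : 'I_n -> F).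
Hypotheses (hc : -2 < c < 2) (hF : free_on s).
Variable (i0 : 'I_n).
Local Notation C := R[i].
Local Notation Re := (@complex.Re R).
Local Notation Im := (@complex.Im R).
Implicit Types (rho : F -> U0 R) (X : 'rV[R]_(n * (2 * 2 + 2 * 2))).

(** This is sin(alpha) for alpha = acos (c / 2). *)
Definition sina : R := Num.sqrt (1 - (c / 2) ^+ 2).

Lemma sina_gt0 : 0 < sina.
Proof.
rewrite sqrtr_gt0 subr_gt0 -real_normK ?num_real// expr_lt1//.
by move/andP: hc => [c1 c2]; rewrite ltr_norml; apply/andP; split; lra.
Qed.

Lemma sina2 : sina ^+ 2 = 1 - (c / 2) ^+ 2.
Proof. by rewrite sqr_sqrtr// ltW// -sqrtr_gt0; exact: sina_gt0. Qed.

Lemma sina_neq0 : sina != 0. Proof. by rewrite gt_eqF// sina_gt0. Qed.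

Lemma sinaC_neq0 : sina%:C != 0 :> C.
Proof. by rewrite (fmorph_eq0 (real_complex R)) sina_neq0. Qed.

Lemma free_hom (f : 'I_n -> U0 R) : exists rho : F -> U0 R,
  {morph rho : x y / (x * y)%g} /\ forall i, rho (s i) = f i.
Proof. by have [rho [? _]] := hF f; exists rho. Qed.

Lemma free_hom_eq rho rho' :
  {morph rho : x y / (x * y)%g} -> {morph rho' : x y / (x * y)%g} ->
  (forall i, rho (s i) = rho' (s i)) -> rho = rho'.
Proof.
move=> rM rM' E; have [h [_ hu]] := hF (fun i => rho (s i)).
by rewrite -(hu rho) ?(hu rho')//; split.
Qed.

Lemma rep_coord_inj rho rho' :
  {morph rho : x y / (x * y)%g} -> {morph rho' : x y / (x * y)%g} ->
  rep_coord s rho = rep_coord s rho' -> rho = rho'.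
Proof.
move=> rM rM' E; apply: free_hom_eq => // i; apply: U0_ext.
  by rewrite -!(rot_at_coord s) E.
by rewrite -!(trans_at_coord s) E.
Qed.

Definition kap X i : R := Im (rot_at X i) / sina.
(** When [kap X i] is 1 or -1, this is a constant multiple, the same for all [i], of the fixed point
    of the rotation z -> a^2 z + a b by which the i-th matrix acts on the plane. *)
Definition wt X i : C := (kap X i)%:C * trans_at X i.

Lemma trace_U0 (A : U0 R) : \tr (U0mx A) = (2 * Re (rot A))%:C.
Proof.
rewrite U0mxE /mxtrace !big_ord_recl big_ord0 !mxE /= addr0.
by case: (rot A) => a b; apply: complex_ext => /=; ring.
Qed.

Lemma trace_eq_c (A : U0 R) : (\tr (U0mx A) = c%:C) <-> (Re (rot A) = c / 2).
Proof.
rewrite trace_U0; split=> [/complexI <-|->]; first by field.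
by congr (_%:C); field.
Qed.

Definition rot_c (k : R) : C := Complex (c / 2) (k * sina).

Lemma rot_cJ k : k ^+ 2 = 1 -> rot_c k * (rot_c k)^*%C = 1.
Proof.
move=> k2; apply: complex_ext => /=; last by ring.
by rewrite mulrN opprK -!expr2 [(k * _) ^+ 2]exprMn k2 sina2 mul1r subrKC.
Qed.

Lemma kap_sq X i : rot_at X i * (rot_at X i)^*%C = 1 -> Re (rot_at X i) = c / 2 ->
  kap X i ^+ 2 = 1.
Proof.
move=> /(congr1 Re) + cE; rewrite /kap expr_div_n sina2 -cE.
case: (rot_at X i) cE => a b /= cE; rewrite mulrN opprK -!expr2 => H.
have -> : b ^+ 2 = 1 - a ^+ 2 by rewrite -H [a ^+ 2 + _]addrC addrK.
by rewrite divff// cE -sina2 sqrf_eq0 sina_neq0.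
Qed.

Lemma rot_at_kap X i : Re (rot_at X i) = c / 2 -> rot_at X i = rot_c (kap X i).
Proof.
by move=> cE; apply: complex_ext => //=; rewrite divfK// sina_neq0.
Qed.

Lemma Im_rot_at X i : Im (rot_at X i) = kap X i * sina.
Proof. by rewrite divfK// sina_neq0. Qed.

Definition c_rep rho := {morph rho : x y / (x * y)%g} /\
  forall i, \tr (U0mx (rho (s i))) = c%:C.

Lemma c_rep_Re rho i : c_rep rho -> Re (rot_at (rep_coord s rho) i) = c / 2.
Proof. by move=> [_ /(_ i)/trace_eq_c]; rewrite rot_at_coord. Qed.

Lemma c_rep_kap rho i : c_rep rho -> kap (rep_coord s rho) i ^+ 2 = 1.
Proof.
move=> rc; apply: kap_sq; last exact: c_rep_Re.
by rewrite rot_at_coord rotJ.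
Qed.

Lemma c_rep_kapC rho i : c_rep rho ->
  (kap (rep_coord s rho) i)%:C * (kap (rep_coord s rho) i)%:C = 1 :> C.
Proof. by move=> rc; rewrite -rmorphM -expr2 c_rep_kap. Qed.

Lemma c_rep_trans rho i : c_rep rho ->
  trans_at (rep_coord s rho) i = (kap (rep_coord s rho) i)%:C * wt (rep_coord s rho) i.
Proof. by move=> rc; rewrite /wt mulrA c_rep_kapC// mul1r. Qed.

(** Conjugation by [k] kills the translation part at [s j] exactly when [wt] at [j] times the
    conjugate of [rot k] is - 2 i sin(alpha) [trans k], which does not depend on [j]. Conversely, a
    common value of [wt] determines a translation that diagonalises all the generators. *)
Lemma fully_reducible_wt rho : c_rep rho ->
  fully_reducible rho <-> forall i, wt (rep_coord s rho) i = wt (rep_coord s rho) i0.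
Proof.
move=> rc; have [rM _] := rc; have kE i := c_rep_kapC i rc.
have diagE (A : U0 R) : is_diag_mx (U0mx A) = (trans A == 0).
  apply/is_diag_mxP/eqP => [|t0 i j]; first by apply.
  rewrite U0mxE t0 mxE.
  have o2 (k : 'I_2) : k = 0 \/ k = 1.
    by case: k => [[|[|//]] ?]; [left | right]; apply/val_inj.
  by have [-> | ->] := o2 i; have [-> | ->] := o2 j.
have conjE (A k : U0 R) : trans (A ^ k)%g = (rot k)^*%C *
    (trans k * (rot A - (rot A)^*%C) + trans A * (rot k)^*%C).
  rewrite conjgE !transM rotV transV !rotM rmorphM; ring.
have rotE i : rot (rho (s i)) - (rot (rho (s i)))^*%C =
    2 * 'i%C * sina%:C * (kap (rep_coord s rho) i)%:C.
  rewrite -(rot_at_coord s) rot_at_kap ?c_rep_Re// /rot_c.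
  by apply: complex_ext => /=; ring.
split=> [[k kd] i|w0].
  have W j : wt (rep_coord s rho) j * (rot k)^*%C = - (2 * 'i%C * sina%:C * trans k).
    have := kd (s j); rewrite diagE conjE mulf_eq0 conjc_eq0.
    have k0 : rot k != 0.
      by apply: contra_eq_neq (rotJ k) => ->; rewrite mul0r eq_sym oner_neq0.
    rewrite (negbTE k0) /= rotE addr_eq0 => /eqP E.
    rewrite /wt trans_at_coord -mulrA -[trans _ * _]opprK -E.
    transitivity (- (2 * 'i%C * sina%:C * trans k) *
      ((kap (rep_coord s rho) j)%:C * (kap (rep_coord s rho) j)%:C)); first by ring.
    by rewrite kE mulr1.
  have k0 : (rot k)^*%C != 0.
    by apply: contra_eq_neq (rotJ k) => ->; rewrite mulr0 eq_sym oner_neq0.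
  by apply: (mulIf k0); rewrite !W.
have one1 : (1 : C) * 1^*%C = 1 by rewrite conjc1 mulr1.
pose q : C := - wt (rep_coord s rho) i0 / (2 * 'i%C * sina%:C).
have d0 : 2 * 'i%C * sina%:C != 0 :> C.
  rewrite !mulf_neq0// ?pnatr_eq0 ?sinaC_neq0//.
  by rewrite eq_complex /= eqxx oner_eq0.
exists (U0_of 1 q) => x; rewrite diagE; apply/eqP; set k := U0_of 1 q.
have [r1 r1E] : exists r1 : F -> U0 R, forall x, r1 x = (rho x ^ k)%g.
  by exists (fun x => (rho x ^ k)%g).
have r1M : {morph r1 : x y / (x * y)%g} by move=> y z; rewrite !r1E rM conjMg.
(* [r2] is the diagonal part of the conjugate [r1]. Both are homomorphisms and they agree on the
   generators, so freeness makes them equal. *)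
have [r2 r2E] : exists r2 : F -> U0 R, forall x, r2 x = U0_of (rot (r1 x)) 0.
  by exists (fun x => U0_of (rot (r1 x)) 0).
have rot2 y : rot (r2 y) = rot (r1 y) by rewrite r2E rot_of// rotJ.
have trans2 y : trans (r2 y) = 0 by rewrite r2E trans_of// rotJ.
have r2M : {morph r2 : x y / (x * y)%g}.
  move=> y z; apply: U0_ext; first by rewrite rot2 rotM 2!rot2 r1M rotM.
  by rewrite trans2 transM 2!trans2 mulr0 mul0r addr0.
have r12 : r1 = r2.
  apply: free_hom_eq => // i; apply: U0_ext; rewrite ?rot2 ?trans2//.
  rewrite r1E conjE rot_of// trans_of// conjc1 mul1r mulr1 rotE -(trans_at_coord s) c_rep_trans// w0.
  by rewrite /q mulrA (divfK d0); ring.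
by rewrite -r1E r12 trans2.
Qed.

Lemma RcU0P rho : RcU0 c s rho <-> c_rep rho /\
  exists k, wt (rep_coord s rho) k != wt (rep_coord s rho) i0.
Proof.
split=> [[rM rt nf]|[rc [k wk]]].
  have rc : c_rep rho by [].
  split=> //; apply: contrapT => nk; apply: nf; apply/fully_reducible_wt => // i.
  by apply/eqP; rewrite -[_ == _]negbK; apply/negP => wi; apply: nk; exists i.
have [rM rt] := rc; split=> // /(fully_reducible_wt rc)/(_ k)/eqP.
by rewrite (negbTE wk).
Qed.

End RcU0Structure.

Section EnumCoord.
Context {R : realType} {I : finType} (P : pred I) {d : nat}.
Hypothesis hd : #|{: {x | P x}}| = d.

(** Entries of a row vector are addressed by the elements of [I] satisfying [P], so that each keeps
    its meaning (generator, real or imaginary part); [enum_get] is 0 off [P]. *)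
Definition enum_idx (l : 'I_d) : I := val (enum_val (cast_ord (esym hd) l)).

Definition enum_get (Z : 'rV[R]_d) (x : I) : R :=
  if insub x is Some t then Z 0 (cast_ord hd (enum_rank (t : {x | P x}))) else 0.

Lemma enum_idxP l : P (enum_idx l). Proof. exact: valP. Qed.

Lemma enum_get_idx Z l : enum_get Z (enum_idx l) = Z 0 l.
Proof. by rewrite /enum_get /enum_idx valK enum_valK cast_ordKV. Qed.

Lemma enum_get_row (f : I -> R) x :
  P x -> enum_get (\row_l f (enum_idx l)) x = f x.
Proof.
by move=> Px; rewrite /enum_get insubT mxE /enum_idx cast_ordK enum_rankK.
Qed.

Lemma smooth_enum_get (U : set 'rV[R]_d) x : open U ->
  smooth_on U (fun Z => enum_get Z x).
Proof.
move=> oU; rewrite /enum_get; case: insub => [t|]; last exact: smooth_on_cst.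
exact: smooth_on_coord.
Qed.

End EnumCoord.

Section Invariants.
Context {R : realType} {F : groupType} {n : nat}.
Variables (c : R) (s : 'I_n -> F).
Hypotheses (hc : -2 < c < 2) (hF : free_on s).
Variable (i0 : 'I_n).
Local Notation C := R[i].
Local Notation Re := (@complex.Re R).
Local Notation Im := (@complex.Im R).
Implicit Types (rho : F -> U0 R) (X Y : 'rV[R]_(n * (2 * 2 + 2 * 2))).
Local Notation kap := (kap c).
Local Notation wt := (wt c).
Local Notation sina := (sina c).
Local Notation rep := (rep_coord s).

Definition sg (k : bool) : R := if k then -1 else 1.

Lemma sgM k : sg k * sg k = 1. Proof. by case: k; rewrite /sg ?mulrNN mulr1. Qed.
Lemma Im_cj k (z : C) : Im (cj k z) = sg k * Im z.
Proof. by case: k z => [] [a b] /=; rewrite ?mulN1r ?mul1r. Qed.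
Lemma Re_cj k (z : C) : Re (cj k z) = Re z.
Proof. by case: k z => [] []. Qed.
Lemma cjV k (z : C) : cj k z^-1 = (cj k z)^-1.
Proof. by case: k => //=; rewrite conjc_inv. Qed.

Definition act_rel k (l m : C) X Y := forall i, rot_at Y i = cj k (rot_at X i) /\
  trans_at Y i = l * cj k (trans_at X i) + m * (Im (rot_at X i))%:C.

Lemma act_rel_aut k l m rho : act_rel k l m (rep rho) (rep (autU0 k l m \o rho)).
Proof. by move=> i; rewrite !(rot_at_coord s, trans_at_coord s) /= rot_aut trans_aut. Qed.

Lemma AutU0_equivP rho rho' :
  {morph rho : x y / (x * y)%g} -> {morph rho' : x y / (x * y)%g} ->
  AutU0_equiv rho rho' <-> exists k l m, l != 0 /\ act_rel k l m (rep rho) (rep rho').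
Proof.
move=> rM rM'; split=> [[g /AutU0P[k [l [m [l0 ->]]]] ->]|[k [l [m [l0 kE]]]]].
  by exists k, l, m; split=> //; exact: act_rel_aut.
exists (autU0 k l m); first exact: autU0_AutU0.
apply: (free_hom_eq hF) => //.
  by move=> x y /=; rewrite rM autU0M.
move=> i; have [] := kE i; rewrite !(rot_at_coord s, trans_at_coord s) => E1 E2.
by apply: U0_ext; rewrite /= ?rot_aut ?trans_aut.
Qed.

Lemma kap_act k l m X Y i : act_rel k l m X Y -> kap Y i = sg k * kap X i.
Proof. by move=> /(_ i)[E _]; rewrite /kap E Im_cj mulrA. Qed.

(** Multiplied by [kap X i], the term m Im(a_i) = m kap_i sin(alpha) becomes m sin(alpha): the same
    translation for all points. *)
Lemma wt_act k l m X Y i : kap X i ^+ 2 = 1 -> act_rel k l m X Y ->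
  wt Y i = (sg k)%:C * (l * cj k (wt X i) + m * sina%:C).
Proof.
move=> kX aXY; rewrite /wt (kap_act _ aXY); have [_ ->] := aXY i.
rewrite (Im_rot_at hc) cjM cjr [(sg k * _)%:C]rmorphM [(kap X i * sina)%:C]rmorphM.
have kC : (kap X i)%:C * (kap X i)%:C = 1 :> C by rewrite -rmorphM -expr2 kX.
transitivity ((sg k)%:C * (l * ((kap X i)%:C * cj k (trans_at X i)) +
  m * sina%:C * ((kap X i)%:C * (kap X i)%:C))); first by ring.
by rewrite kC mulr1.
Qed.

Definition ratio X j i : C := (wt X i - wt X i0) / (wt X j - wt X i0).
(* An antiholomorphic automorphism conjugates [ratio] and changes the sign of
   [kap], which leaves [ratio_inv] unchanged. *)
Definition ratio_inv X j i : C :=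
  Complex (Re (ratio X j i)) (kap X i0 * Im (ratio X j i)).

Section Act.
Variables (k : bool) (l m : C) (X Y : 'rV[R]_(n * (2 * 2 + 2 * 2))).
Hypotheses (l0 : l != 0) (aXY : act_rel k l m X Y) (kX : forall i, kap X i ^+ 2 = 1).

Lemma wt_actB i j : wt Y i - wt Y j = (sg k)%:C * l * cj k (wt X i - wt X j).
Proof. rewrite (wt_act (kX i) aXY) (wt_act (kX j) aXY) cjB; ring. Qed.

Lemma sgC_neq0 : (sg k)%:C != 0 :> C.
Proof.
rewrite (fmorph_eq0 (real_complex R)); apply: contra_eq_neq (sgM k) => ->.
by rewrite mul0r eq_sym oner_neq0.
Qed.

Lemma wt_act_neq i j : (wt Y i != wt Y j) = (wt X i != wt X j).
Proof.
rewrite -subr_eq0 wt_actB !mulf_eq0 (negbTE sgC_neq0) (negbTE l0) /=.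
by rewrite cj_eq0 subr_eq0.
Qed.

Lemma ratio_act j i : ratio Y j i = cj k (ratio X j i).
Proof.
rewrite /ratio !wt_actB cjM cjV -mulf_div divff ?mul1r//.
by rewrite mulf_neq0// sgC_neq0.
Qed.

Lemma ratio_inv_act j i : ratio_inv Y j i = ratio_inv X j i.
Proof.
rewrite /ratio_inv ratio_act Re_cj Im_cj (kap_act _ aXY).
by congr Complex; rewrite mulrACA sgM mul1r.
Qed.

Lemma kap_act_mul i j : kap Y i * kap Y j = kap X i * kap X j.
Proof. by rewrite !(kap_act _ aXY) mulrACA sgM mul1r. Qed.

End Act.

(** [k] records whether the signs at [i0] agree, [l] is read off from the pair [j], [i0], and [m]
    from [i0]; equality of the ratios then carries the relation to the other points. *)
Lemma act_of_invariants X Y j :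
  (forall i, kap X i ^+ 2 = 1) -> (forall i, kap Y i ^+ 2 = 1) ->
  (forall i, Re (rot_at X i) = c / 2) -> (forall i, Re (rot_at Y i) = c / 2) ->
  wt X j != wt X i0 -> wt Y j != wt Y i0 ->
  (forall i, kap X i * kap X i0 = kap Y i * kap Y i0) ->
  (forall i, ratio_inv X j i = ratio_inv Y j i) ->
  exists k l m, l != 0 /\ act_rel k l m X Y.
Proof.
move=> kX kY rX rY wX wY kXY uXY.
pose k := kap X i0 != kap Y i0.
have k0 : kap Y i0 = sg k * kap X i0.
  have := kX i0; have := kY i0; rewrite /k /sg; case: eqVneq => /= [->|]; first by rewrite mul1r.
  move=> ne /eqP + /eqP; rewrite !sqrf_eq1 => /orP[] /eqP yE /orP[] /eqP xE;
    move: ne; rewrite xE yE ?eqxx// => _; lra.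
have kE i : kap Y i = sg k * kap X i.
  have kx0 : kap X i0 != 0 by apply: contra_eq_neq (kX i0) => ->; rewrite expr0n eq_sym oner_neq0.
  have sk0 : sg k != 0.
    by apply: contra_eq_neq (sgM k) => ->; rewrite mul0r eq_sym oner_neq0.
  apply: (mulIf (mulf_neq0 sk0 kx0)); rewrite -k0 -kXY k0.
  by rewrite [RHS]mulrACA sgM mul1r.
have rE i : ratio Y j i = cj k (ratio X j i).
  have := uXY i; rewrite /ratio_inv => -[E1 E2].
  apply: complex_ext; rewrite ?Re_cj// Im_cj.
  have ky0 : kap Y i0 != 0 by apply: contra_eq_neq (kY i0) => ->; rewrite expr0n eq_sym oner_neq0.
  apply: (mulfI ky0); rewrite -E2 k0.
  rewrite [RHS](_ : _ = sg k * sg k * (kap X i0 * Im (ratio X j i))); last by ring.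
  by rewrite sgM mul1r.
have dX0 : cj k (wt X j - wt X i0) != 0 by rewrite cj_eq0 subr_eq0.
have dY0 : wt Y j - wt Y i0 != 0 by rewrite subr_eq0.
have sk : (sg k)%:C * (sg k)%:C = 1 :> C by rewrite -rmorphM sgM.
pose l := (sg k)%:C * (wt Y j - wt Y i0) / cj k (wt X j - wt X i0).
pose m := ((sg k)%:C * wt Y i0 - l * cj k (wt X i0)) / sina%:C.
have wE i : wt Y i = (sg k)%:C * (l * cj k (wt X i) + m * sina%:C).
  rewrite /m divfK ?(sinaC_neq0 hc)//.
  rewrite [RHS](_ : _ = (sg k)%:C * (sg k)%:C * wt Y i0 +
    (sg k)%:C * l * (cj k (wt X i) - cj k (wt X i0))); last by ring.
  rewrite sk mul1r -cjB.
  have -> : wt X i - wt X i0 = ratio X j i * (wt X j - wt X i0) by rewrite divfK// subr_eq0.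
  rewrite cjM -rE /l.
  rewrite [(sg k)%:C * _ * _](_ : _ = (sg k)%:C * (sg k)%:C * ratio Y j i * (wt Y j - wt Y i0) *
     (cj k (wt X j - wt X i0) / cj k (wt X j - wt X i0))); last by ring.
  by rewrite divff// sk mul1r mulr1 /ratio divfK// addrC subrK.
exists k, l, m; split.
  rewrite !mulf_neq0 ?invr_eq0//.
  by apply: contra_eq_neq sk => ->; rewrite mul0r eq_sym oner_neq0.
have kC (Z : 'rV[R]_(n * (2 * 2 + 2 * 2))) i : kap Z i ^+ 2 = 1 ->
    (kap Z i)%:C * (kap Z i)%:C = 1 :> C.
  by move=> kZ; rewrite -rmorphM -expr2 kZ.
have tE (Z : 'rV[R]_(n * (2 * 2 + 2 * 2))) i : kap Z i ^+ 2 = 1 ->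
    trans_at Z i = (kap Z i)%:C * wt Z i.
  by move=> kZ; rewrite /wt mulrA kC// mul1r.
move=> i; split.
  rewrite (rot_at_kap hc (rX i)) (rot_at_kap hc (rY i)) kE.
  by apply: complex_ext; rewrite ?Re_cj// Im_cj /= mulrA.
rewrite (tE Y)// (tE X)// wE kE (Im_rot_at hc) cjM cjr
  [(sg k * _)%:C]rmorphM [(kap X i * sina)%:C]rmorphM.
transitivity ((sg k)%:C * (sg k)%:C * (kap X i)%:C * (l * cj k (wt X i) + m * sina%:C)); first by ring.
by rewrite sk; ring.
Qed.

Lemma csmooth_kap (U : set 'rV[R]_(n * (2 * 2 + 2 * 2))) i : open U ->
  smooth_on U (fun X => kap X i).
Proof.
move=> oU; apply: smooth_onM; last exact: smooth_on_cst.
exact: (csmooth_rep_entry _ _ _ oU).2.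
Qed.

Lemma csmooth_wt (U : set 'rV[R]_(n * (2 * 2 + 2 * 2))) i : open U ->
  csmooth U (fun X => wt X i).
Proof.
move=> oU; apply: csmoothM; first exact/csmooth_real/csmooth_kap.
exact: csmooth_rep_entry.
Qed.

Lemma open_wt_neq i k :
  open [set X : 'rV[R]_(n * (2 * 2 + 2 * 2)) | wt X i != wt X k].
Proof.
have oT := @openT 'rV[R]_(n * (2 * 2 + 2 * 2)).
rewrite [X in open X](_ : _ = [set Y | 0 < Re (wt Y i - wt Y k) ^+ 2 + Im (wt Y i - wt Y k) ^+ 2]).
  apply: open_gt0.
  have sB : csmooth setT (fun Y => wt Y i - wt Y k) by apply: csmoothB; exact: csmooth_wt.
  by apply: smooth_onD; apply: smooth_onM; [exact: sB.1|exact: sB.1|exact: sB.2|exact: sB.2].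
apply/seteqP; split=> Y wY.
  by apply: sqr_complex_gt0; rewrite subr_eq0.
have pos : 0 < Re (wt Y i - wt Y k) ^+ 2 + Im (wt Y i - wt Y k) ^+ 2 := wY.
change (wt Y i != wt Y k); apply/eqP => YE; move: pos.
by rewrite YE subrr /= expr0n addr0 ltxx.
Qed.

Lemma csmooth_ratio_inv (U : set 'rV[R]_(n * (2 * 2 + 2 * 2))) j i : open U ->
  (forall X, U X -> wt X j != wt X i0) ->
  csmooth U (fun X => ratio_inv X j i).
Proof.
move=> oU wU; have sr : csmooth U (fun X => ratio X j i).
  apply: csmoothM; first by apply: csmoothB; exact: csmooth_wt.
  apply: csmoothV; first by move=> X /wU; rewrite subr_eq0.
  by apply: csmoothB; exact: csmooth_wt.
split; first exact: sr.1.
by apply: smooth_onM; [exact: csmooth_kap|exact: sr.2].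
Qed.

End Invariants.

(** * The smooth structure of the quotient *)

Section Charts.
Context {R : realType} {F : groupType} {n : nat}.
Variables (c : R) (s : 'I_n -> F).
Hypotheses (hc : -2 < c < 2) (hF : free_on s).
Variables (i0 j : 'I_n).
Hypothesis (ji0 : j != i0).
Local Notation C := R[i].
Local Notation Re := (@complex.Re R).
Local Notation Im := (@complex.Im R).
Implicit Types (rho : F -> U0 R) (X Y : 'rV[R]_(n * (2 * 2 + 2 * 2))).
Local Notation kap := (kap c).
Local Notation wt := (wt c).
Local Notation sina := (sina c).
Local Notation rep := (rep_coord s).
Local Notation M := (RcU0 c s).
Local Notation E := (@AutU0_equiv R F).
Local Notation q := (eclass M E).
(** The ratios at [i0] and [j] are the constants 0 and 1, which leaves n - 2 complex coordinates;
    the boolean selects the imaginary part. *)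
Local Notation P := (fun x : 'I_n * bool => (x.1 != i0) && (x.1 != j)).
Variable d : nat.
Hypothesis hd : #|{: {x | P x}}| = d.
Implicit Types Z : 'rV[R]_d.

Lemma AutU0_equiv_refl rho : E rho rho.
Proof.
exists id => //; split=> //; last exists id; try split=> //; move=> A _;
  exists setT, id; split=> //; apply: smooth_on_id; exact: openT.
Qed.

Lemma AutU0_equiv_sym rho rho' : E rho rho' -> E rho' rho.
Proof.
move=> [g [gM gs [h [gK hK hs]]] ->]; exists h.
  split=> //; last by exists g.
  by move=> A B; apply: (can_inj gK); rewrite gM !hK.
by apply/funext => x /=; rewrite gK.
Qed.

Lemma AutU0_equiv_trans rho1 rho2 rho3 : E rho1 rho2 -> E rho2 rho3 -> E rho1 rho3.
Proof.
move=> [g [gM gs [h [gK hK hs]]] ->] [g' [gM' gs' [h' [gK' hK' hs']]] ->].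
have comp (f f' : U0 R -> U0 R) : smooth_wrt setT (@U0_coord R) (@U0_coord R \o f) ->
    smooth_wrt setT (@U0_coord R) (@U0_coord R \o f') ->
    smooth_wrt setT (@U0_coord R) (@U0_coord R \o (f' \o f)).
  move=> sf sf' A _; have [N [G [NA sG GE]]] := sf A I.
  have [N' [G' [NA' sG' GE']]] := sf' (f A) I.
  exists (N `&` G @^-1` N'), (G' \o G); split.
  - by split=> //=; rewrite -GE.
  - exact: smooth_on_comp.
  - move=> B _ [NB /= NB']; have gB := GE B I NB.
    by move: NB'; rewrite /= -gB => NB'; exact: (GE' (f B) I NB').
exists (g' \o g); last by [].
split; first by move=> A B /=; rewrite gM gM'.
  exact: comp.
exists (h \o h'); split; [| |exact: comp].
  by move=> A /=; rewrite gK' gK.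
by move=> A /=; rewrite hK hK'.
Qed.

Lemma eclassE rho rho' : M rho -> M rho' -> q rho = q rho' <-> E rho rho'.
Proof.
move=> Mr Mr'; split=> [qE|rr'].
  have : q rho' rho' by split=> //; exact: AutU0_equiv_refl.
  by rewrite -qE => -[].
apply/seteqP; split=> x [Mx xE]; split=> //.
  exact: AutU0_equiv_trans (AutU0_equiv_sym rr') xE.
exact: AutU0_equiv_trans rr' xE.
Qed.

Lemma RcU0_c_rep rho : M rho -> c_rep c s rho.
Proof. by case. Qed.

Lemma RcU0_morph rho : M rho -> {morph rho : x y / (x * y)%g}.
Proof. by case. Qed.

Lemma RcU0_act rho rho' : M rho -> M rho' -> E rho rho' ->
  exists k l m, l != 0 /\ act_rel k l m (rep rho) (rep rho').
Proof. by move=> Mr Mr' /(AutU0_equivP hF (RcU0_morph Mr) (RcU0_morph Mr')). Qed.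

Lemma RcU0_kap rho i : M rho -> kap (rep rho) i ^+ 2 = 1.
Proof. by move=> /RcU0_c_rep rc; exact: c_rep_kap. Qed.

Lemma rep_coord_pt rho (a b : 'I_n -> C) : (forall i, rot (rho (s i)) = a i) ->
  (forall i, trans (rho (s i)) = b i) -> rep rho = rep_pt a b.
Proof.
move=> ra tb; rewrite rep_coordE.
exact: (f_equal2 (@rep_pt R n) (funext ra) (funext tb)).
Qed.

Lemma rep_pt_realize (a b : 'I_n -> C) : (forall i, a i * (a i)^*%C = 1) ->
  exists rho, {morph rho : x y / (x * y)%g} /\ rep rho = rep_pt a b.
Proof.
move=> a1; have [rho [rM rE]] := free_hom hF (fun i => U0_of (a i) (b i)).
exists rho; split; first exact: rM.
by apply: rep_coord_pt => i; rewrite rE ?rot_of ?trans_of.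
Qed.

Definition coordZ X : 'rV[R]_d := \row_l (let x := enum_idx hd l in
  if x.2 then Im (ratio_inv c i0 X j x.1) else Re (ratio_inv c i0 X j x.1)).

Lemma enum_get_coordZ X b i : i != i0 -> i != j -> enum_get hd (coordZ X) (i, b) =
  if b then Im (ratio_inv c i0 X j i) else Re (ratio_inv c i0 X j i).
Proof.
move=> ii0 ij; have Pi : P (i, b) by rewrite /= ii0 ij.
by rewrite /coordZ (enum_get_row hd (fun x => if x.2 then Im (ratio_inv c i0 X j x.1)
  else Re (ratio_inv c i0 X j x.1)) Pi).
Qed.

Definition ratioZ X Z i : C := if i == i0 then 0 else if i == j then 1 else
  Complex (enum_get hd Z (i, false)) (kap X i0 * enum_get hd Z (i, true)).

Definition wtZ X Z i : C := wt X i0 + ratioZ X Z i * (wt X j - wt X i0).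

(** Section through [X]: the rotation parts and the points at [i0] and [j] are kept, and the other
    points are moved to the ratios prescribed by [Z]. *)
Definition sectZ X Z := rep_pt (rot_at X) (fun i => (kap X i)%:C * wtZ X Z i).

Lemma kap_sectZ X Z i : kap (sectZ X Z) i = kap X i.
Proof. by rewrite /kap rot_at_pt. Qed.

Lemma wt_sectZ X Z i : kap X i ^+ 2 = 1 -> wt (sectZ X Z) i = wtZ X Z i.
Proof.
move=> kX; rewrite /wt kap_sectZ trans_at_pt mulrA -rmorphM -expr2 kX.
by rewrite rmorph1 mul1r.
Qed.

Lemma ratioZ_i0 X Z : ratioZ X Z i0 = 0. Proof. by rewrite /ratioZ eqxx. Qed.
Lemma ratioZ_j X Z : ratioZ X Z j = 1.
Proof. by rewrite /ratioZ (negbTE ji0) eqxx. Qed.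

Lemma wtZ_i0 X Z : wtZ X Z i0 = wt X i0.
Proof. by rewrite /wtZ ratioZ_i0 mul0r addr0. Qed.
Lemma wtZ_j X Z : wtZ X Z j = wt X j.
Proof. by rewrite /wtZ ratioZ_j mul1r addrC subrK. Qed.

Section AtX.
Variable X : 'rV[R]_(n * (2 * 2 + 2 * 2)).
Hypotheses (kX : forall i, kap X i ^+ 2 = 1) (wX : wt X j != wt X i0).

Lemma ratio_sectZ Z i : ratio c i0 (sectZ X Z) j i = ratioZ X Z i.
Proof.
rewrite /ratio !wt_sectZ// wtZ_i0 wtZ_j /wtZ addrAC subrr add0r.
by rewrite mulfK// subr_eq0.
Qed.

Lemma coordZ_sectZ Z : coordZ (sectZ X Z) = Z.
Proof.
apply/rowP => l; rewrite mxE -(enum_get_idx hd) /ratio_inv ratio_sectZ kap_sectZ.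
have /andP[/negbTE xi0 /negbTE xj] := enum_idxP hd l.
rewrite /ratioZ xi0 xj; case: (enum_idx hd l) => i [] //=.
by rewrite mulrA -expr2 kX mul1r.
Qed.

Lemma ratioZ_coordZ i : ratioZ X (coordZ X) i = ratio c i0 X j i.
Proof.
rewrite /ratioZ; have [->|ii0] := eqVneq i i0; first by rewrite /ratio subrr mul0r.
have [->|ij] := eqVneq i j; first by rewrite /ratio divff// subr_eq0.
rewrite !enum_get_coordZ//.
by apply: complex_ext => //=; rewrite mulrA -expr2 kX mul1r.
Qed.

Lemma wtZ_coordZ i : wtZ X (coordZ X) i = wt X i.
Proof. by rewrite /wtZ ratioZ_coordZ /ratio divfK ?subr_eq0// addrC subrK. Qed.

End AtX.

Lemma sectZ_coordZ rho : M rho -> wt (rep rho) j != wt (rep rho) i0 ->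
  sectZ (rep rho) (coordZ (rep rho)) = rep rho.
Proof.
move=> Mr wr; have kr i := RcU0_kap i Mr.
apply/esym/rep_coord_pt => i; first by rewrite rot_at_coord.
rewrite wtZ_coordZ// -(trans_at_coord s); apply: (c_rep_trans hc).
exact: RcU0_c_rep.
Qed.

Lemma sectZ_realize rho Z : M rho -> wt (rep rho) j != wt (rep rho) i0 ->
  exists rho', M rho' /\ rep rho' = sectZ (rep rho) Z.
Proof.
move=> Mr wr; have kr i := RcU0_kap i Mr.
have [|rho' [rM rE]] := @rep_pt_realize (rot_at (rep rho))
  (fun i => (kap (rep rho) i)%:C * wtZ (rep rho) Z i).
  by move=> i; rewrite rot_at_coord rotJ.
exists rho'; split; last exact: rE.
apply/(RcU0P hc hF i0); split; last first.
  by exists j; rewrite rE !wt_sectZ// wtZ_j wtZ_i0.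
split; first exact: rM.
move=> i; apply/trace_eq_c; rewrite -(rot_at_coord s) rE rot_at_pt.
exact: (c_rep_Re _ (RcU0_c_rep Mr)).
Qed.

Definition pattern X (e : {ffun 'I_n -> bool}) :=
  forall i, (0 < kap X i * kap X i0) = e i.

Definition dom_class e : set (set (F -> U0 R)) :=
  [set D | exists rho, [/\ M rho, D = q rho, pattern (rep rho) e &
                          wt (rep rho) j != wt (rep rho) i0]].

Definition rep_class (D : set (F -> U0 R)) : F -> U0 R :=
  xget (fun=> 1%g) [set rho | M rho /\ q rho = D].

Definition class_chart e : chart R (set (F -> U0 R)) d :=
  Chart (dom_class e) (fun D => coordZ (rep (rep_class D))).

Lemma rep_classP rho : M rho -> M (rep_class (q rho)) /\ q (rep_class (q rho)) = q rho.
Proof. by move=> Mr; apply: (@xgetPex _ _ [set r | M r /\ q r = q rho]); exists rho. Qed.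

Lemma equiv_pattern rho rho' e : M rho -> M rho' -> E rho rho' ->
  pattern (rep rho) e -> pattern (rep rho') e.
Proof.
move=> Mr Mr' /(RcU0_act Mr Mr')[k [l [m [l0 a]]]] p i.
by rewrite (kap_act_mul c a) p.
Qed.

Lemma equiv_wt_neq rho rho' i : M rho -> M rho' -> E rho rho' ->
  (wt (rep rho') i != wt (rep rho') i0) = (wt (rep rho) i != wt (rep rho) i0).
Proof.
move=> Mr Mr' /(RcU0_act Mr Mr')[k [l [m [l0 a]]]].
by rewrite (wt_act_neq hc l0 a (fun i => RcU0_kap i Mr)).
Qed.

Lemma equiv_coordZ rho rho' : M rho -> M rho' -> E rho rho' ->
  coordZ (rep rho') = coordZ (rep rho).
Proof.
move=> Mr Mr' /(RcU0_act Mr Mr')[k [l [m [l0 a]]]]; apply/rowP => x.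
rewrite mxE [RHS]mxE; cbv zeta.
by rewrite (ratio_inv_act hc i0 l0 a (fun i => RcU0_kap i Mr)).
Qed.

Lemma class_chartP rho e : M rho -> cdom (class_chart e) (q rho) <->
  pattern (rep rho) e /\ wt (rep rho) j != wt (rep rho) i0.
Proof.
move=> Mr; split=> [[rho' [Mr' /esym/(eclassE Mr' Mr) r'r p w]]|[p w]]; last first.
  by exists rho.
split; first exact: equiv_pattern r'r p.
by rewrite (equiv_wt_neq j _ _ r'r).
Qed.

Lemma class_chartE rho e : M rho -> class_chart e (q rho) = coordZ (rep rho).
Proof.
move=> Mr; have [Mr' qr'] := rep_classP Mr.
by apply: equiv_coordZ => //; apply/eclassE.
Qed.

Lemma pattern_sign X e i : kap X i ^+ 2 = 1 -> kap X i0 ^+ 2 = 1 -> pattern X e ->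
  kap X i * kap X i0 = if e i then 1 else -1.
Proof.
move=> /eqP + /eqP + /(_ i) <-; rewrite !sqrf_eq1 => /orP[] /eqP-> /orP[] /eqP->;
  by rewrite ?mulrNN ?mulr1 ?mul1r ?ltr01 ?oppr_gt0 ?ltr10.
Qed.

Lemma ratio_inv_i0 X : ratio_inv c i0 X j i0 = 0.
Proof. by rewrite /ratio_inv /ratio subrr mul0r /= mulr0. Qed.

Lemma ratio_inv_j X : wt X j != wt X i0 -> ratio_inv c i0 X j j = 1.
Proof.
by move=> wX; rewrite /ratio_inv /ratio divff ?subr_eq0//= mulr0.
Qed.

Lemma coordZ_ratio_inv X Y i : wt X j != wt X i0 -> wt Y j != wt Y i0 ->
  coordZ X = coordZ Y -> ratio_inv c i0 X j i = ratio_inv c i0 Y j i.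
Proof.
move=> wX wY XY.
have [->|ii0] := eqVneq i i0; first by rewrite !ratio_inv_i0.
have [->|ij] := eqVneq i j; first by rewrite !ratio_inv_j.
have G (Z : 'rV[R]_(n * (2 * 2 + 2 * 2))) b := enum_get_coordZ Z b ii0 ij.
apply: complex_ext; first by have := G X false; rewrite XY G.
by have := G X true; rewrite XY G.
Qed.

Lemma class_chart_inj rho rho' e : M rho -> M rho' ->
  pattern (rep rho) e -> pattern (rep rho') e ->
  wt (rep rho) j != wt (rep rho) i0 -> wt (rep rho') j != wt (rep rho') i0 ->
  coordZ (rep rho) = coordZ (rep rho') -> E rho rho'.
Proof.
move=> Mr Mr' p p' w w' cE; apply/(AutU0_equivP hF (RcU0_morph Mr) (RcU0_morph Mr')).
have kr i := RcU0_kap i Mr; have kr' i := RcU0_kap i Mr'.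
apply: (act_of_invariants hc (i0 := i0) (j := j)) => //.
- by move=> i; exact: c_rep_Re (RcU0_c_rep Mr).
- by move=> i; exact: c_rep_Re (RcU0_c_rep Mr').
- by move=> i; rewrite (pattern_sign _ _ p)// (pattern_sign _ _ p').
- by move=> i; exact: coordZ_ratio_inv.
Qed.

Lemma smooth_coordZ (U : set 'rV[R]_(n * (2 * 2 + 2 * 2))) : open U ->
  (forall X, U X -> wt X j != wt X i0) -> smooth_on U coordZ.
Proof.
move=> oU wU; apply: smooth_on_mx => // i l; rewrite (ord1 i).
have [sr si] := csmooth_ratio_inv (enum_idx hd l).1 oU wU.
case xE: (enum_idx hd l).2.
  by apply: smooth_on_eq si => X _; rewrite mxE; cbv zeta; rewrite xE.
by apply: smooth_on_eq sr => X _; rewrite mxE; cbv zeta; rewrite xE.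
Qed.

Lemma smooth_sectZ X : smooth_on setT (sectZ X).
Proof.
have oT := @openT 'rV[R]_d.
apply: smooth_rep_pt => // i; first exact: csmooth_cst.
apply: csmoothM; first exact: csmooth_cst.
apply: csmoothD; first exact: csmooth_cst.
apply: csmoothM; last exact: csmooth_cst.
have [ii0|ii0] := eqVneq i i0.
  apply: (csmooth_eq (f := fun=> 0)) (csmooth_cst 0 oT) => Z _.
  by rewrite /ratioZ ii0 eqxx.
have [ij|ij] := eqVneq i j.
  apply: (csmooth_eq (f := fun=> 1)) (csmooth_cst 1 oT) => Z _.
  by rewrite /ratioZ ij eqxx (negbTE ji0).
apply: (csmooth_eq (f := fun Z => Complex (enum_get hd Z (i, false))
  (kap X i0 * enum_get hd Z (i, true)))).
  by move=> Z _; rewrite /ratioZ (negbTE ii0) (negbTE ij).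
split=> /=; first exact: smooth_enum_get.
by apply: smooth_onM; [exact: smooth_on_cst|exact: smooth_enum_get].
Qed.

(** Equality of sign patterns is phrased as positivity of a product, an open condition on the
    ambient space, where [kap] may take any real value. *)
Definition nbd_rep X : set 'rV[R]_(n * (2 * 2 + 2 * 2)) :=
  [set Y | forall i, 0 < kap Y i * kap Y i0 * (kap X i * kap X i0)] `&`
  [set Y | wt Y j != wt Y i0].

Lemma open_nbd_rep X : open (nbd_rep X).
Proof.
have oT := @openT 'rV[R]_(n * (2 * 2 + 2 * 2)).
apply: openI.
  apply: (@open_forall_gt0 _ _ _ (fun i Y => kap Y i * kap Y i0 * (kap X i * kap X i0))) => i.
  apply: smooth_onM; last exact: smooth_on_cst.
  by apply: smooth_onM; exact: csmooth_kap.
exact: open_wt_neq.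
Qed.

(** [sectZ] realises every [Z] without changing the pattern, so the image of the chart is the whole
    space and one section serves globally. *)
Lemma class_chart_good e : good_chart M rep E (class_chart e).
Proof.
have good_section rho : M rho -> cdom (class_chart e) (q rho) -> forall Z,
    exists rho', [/\ M rho', rep rho' = sectZ (rep rho) Z, cdom (class_chart e) (q rho')
                  & class_chart e (q rho') = Z].
  move=> Mr /(class_chartP e Mr)[p w] Z; have kr i := RcU0_kap i Mr.
  have [rho' [Mr' rE]] := sectZ_realize Z Mr w.
  exists rho'; split; [exact: Mr'|exact: rE| |]; last first.
    by rewrite class_chartE// rE coordZ_sectZ.
  apply/class_chartP; first exact: Mr'.
  rewrite rE; split; first by move=> i; rewrite !kap_sectZ p.
  by rewrite !wt_sectZ// wtZ_j wtZ_i0.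
split.
  split.
  - by move=> _ [rho [Mr -> _ _]]; exists rho.
  - move=> D D'; rewrite !inE => -[rho [Mr -> p w]] [rho' [Mr' -> p' w']].
    rewrite !class_chartE// => cE; apply/eclassE => //; exact: class_chart_inj p p' w w' cE.
  - apply: open_local => _ [D cD <-]; have [rho [Mr DE p w]] := cD.
    exists setT; split=> //; first exact: openT.
    move=> Z _; rewrite DE in cD; have [rho' [_ _ cD' <-]] := good_section _ Mr cD Z.
    by exists (q rho').
move=> rho Mr cD; have [p w] := (class_chartP e Mr).1 cD.
have kr i := RcU0_kap i Mr.
split=> //.
  exists (nbd_rep (rep rho)), coordZ; split.
  - split=> // i; have := kr i; have := kr i0 => k0 ki.
    by rewrite -expr2 exprMn k0 ki mulr1.
  - by apply: smooth_coordZ; [exact: open_nbd_rep|move=> X []].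
  - move=> rho' Mr' [pp w']; split; last exact: class_chartE.
    apply/class_chartP => //; split=> // i; rewrite -p.
    have := pp i; have [pos|npos] := ltP 0 (kap (rep rho) i * kap (rep rho) i0).
      by rewrite pmulr_lgt0.
    by move=> H; apply/negP => pos; move: H; rewrite ltNge pmulr_rle0// npos.
exists setT, (sectZ (rep rho)); split.
- by [].
- exact: smooth_sectZ.
- by rewrite class_chartE// sectZ_coordZ.
- by move=> Z _; exact: good_section.
Qed.

End Charts.

(** * Hausdorff and countability criteria for good charts *)

Section GoodTopology.
Context {R : realType} {T : Type} {m d : nat}.
Variables (M : set T) (e : T -> 'rV[R]_m) (E : T -> T -> Prop).
Local Notation q := (eclass M E).
Local Notation good := (good_chart (d := d) M e E).

Definition chart_preim (b : chart R (set T) d) (A : set 'rV[R]_d) : set (set T) :=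
  [set y | cdom b y /\ A (b y)].

Lemma good_preim_open b A : good b -> open A ->
  mfd_open (quotient M E) good (chart_preim b A).
Proof.
move=> gb oA; split; first by move=> y [by_ _]; case: gb => -[bM _ _] _; exact: bM.
move=> c gc; apply: open_local => _ [y [[by_ Ay] cy] <-].
have [[bM _ _] _] := gb; have [x Mx xy] := quotient_repr (bM _ by_); subst y.
have [N [F [Nx sF FP]]] := good_good_at gc gb Mx cy by_.
exists (N `&` F @^-1` A); split.
- exact: smooth_on_preim sF oA.
- have [y [cy' by' cyx bF]] := FP _ Nx.
  split=> //=; rewrite -bF.
  by rewrite (chart_inj gc.1 cy' cy cyx).
- move=> z [Nz /= Az]; have [y [cy' by' cyz bF]] := FP _ Nz.
  by exists y => //; split=> //; split=> //; rewrite bF.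
Qed.

Lemma good_hausdorff :
  (forall x x', M x -> M x' -> q x <> q x' -> exists b b' A A',
     [/\ good b /\ good b', open A /\ open A', chart_preim b A (q x),
         chart_preim b' A' (q x') &
         forall y, chart_preim b A y -> chart_preim b' A' y -> False]) ->
  mfd_hausdorff (quotient M E) good.
Proof.
move=> sep _ _ [x Mx <-] [x' Mx' <-] ne.
have [b [b' [A [A' [[gb gb'] [pA pA'] bx bx' dis]]]]] := sep _ _ Mx Mx' ne.
exists (chart_preim b A), (chart_preim b' A'); split=> //.
- exact: good_preim_open.
- exact: good_preim_open.
- by apply/seteqP; split=> // y [] /dis/[apply].
Qed.

Definition rat_box (v : 'rV[rat]_d) (k : nat) : set 'rV[R]_d :=
  [set z | forall l, `|z 0 l - ratr (v 0 l)| < k.+1%:R^-1].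

Lemma open_rat_box v k : open (rat_box v k).
Proof.
apply: open_local => z zv.
have k0 : 0 < (k.+1%:R^-1 : R) by rewrite invr_gt0.
pose r := \big[Order.min/k.+1%:R^-1]_l (k.+1%:R^-1 - `|z 0 l - ratr (v 0 l)|).
have r0 : 0 < r by apply: lt_bigmin => // l _; rewrite subr_gt0.
exists (ball z r); split; [exact: ball_open|exact: ballxx|].
move=> y; rewrite -ball_normE /= => zy l.
have yz : `|y 0 l - z 0 l| < r.
  apply: le_lt_trans zy; rewrite distrC.
  by have := rV_coord_le (z - y) l; rewrite !mxE.
have rl : r <= k.+1%:R^-1 - `|z 0 l - ratr (v 0 l)| by exact: bigmin_le.
apply: le_lt_trans (ler_distD (z 0 l) _ _) _.
by rewrite -ltrBrDr; exact: lt_le_trans yz rl.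
Qed.

Lemma good_second_countable (K : countType) (B : K -> chart R (set T) d) :
  (forall k, good (B k)) ->
  (forall x, M x -> exists k, cdom (B k) (q x)) ->
  mfd_second_countable (quotient M E) good.
Proof.
move=> gB covB.
pose basis k : set (set T) := match @unpickle (K * ('rV[rat]_d * nat))%type k with
  | Some (i, (v, p)) => chart_preim (B i) (rat_box v p) | None => set0 end.
exists basis; split.
  move=> k; rewrite /basis; case: unpickle => [[i [v p]]|].
    by apply: good_preim_open; [exact: gB|exact: open_rat_box].
  split=> // c _; rewrite set0I image_set0; exact: open0.
move=> N y [NM oN] Ny; have [x Mx xy] := quotient_repr (NM _ Ny); subst y.
have [i bx] := covB _ Mx; have [bc _] := gB i.
have /(_ (B i (q x))) := open_nbhs_nbhs (conj (oN _ (gB i)) _).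
have Bx : (B i @` (N `&` cdom (B i))) (B i (q x)) by exists (q x).
have /nbhs_ballP[r /= r0 rP] := open_nbhs_nbhs (conj (oN _ (gB i)) Bx).
move=> _.
(* Two points of one rational box differ by less than 2 / (p + 1), and this choice makes that
   smaller than [r]. *)
pose p := Num.bound (2 / r).
have pr : p.+1%:R^-1 + p.+1%:R^-1 < r.
  have : 2 / r < p%:R by apply: archi_boundP; rewrite divr_ge0// ltW.
  rewrite ltr_pdivrMr// => pr; rewrite -mulr2n -[ltLHS]mulr_natl ltr_pdivrMr//.
  rewrite mulrC; apply: lt_le_trans pr _; rewrite ler_pM2r//.
  by rewrite ler_nat.
have p0 : 0 < (p.+1%:R^-1 : R) by rewrite invr_gt0.
have rapp l : exists v : rat, `|B i (q x) 0 l - ratr v| < p.+1%:R^-1.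
  have [|v] := @rat_in_itvoo R (B i (q x) 0 l - p.+1%:R^-1) (B i (q x) 0 l + p.+1%:R^-1).
    by rewrite ltrD2l (lt_trans _ p0)// oppr_lt0.
  by rewrite in_itv /= => vI; exists v; rewrite ltr_distlC.
pose v : 'rV[rat]_d := \row_l sval (cid (rapp l)).
have vP l : `|B i (q x) 0 l - ratr (v 0 l)| < p.+1%:R^-1.
  by rewrite mxE; case: cid.
exists (pickle (i, (v, p))); rewrite /basis pickleK; first by split.
move=> y [biy ybox].
have : ball (B i (q x)) r (B i y).
  rewrite -ball_normE /=; apply: le_lt_trans pr; apply: rV_norm_le => [|l].
    by rewrite addr_ge0// ltW.
  rewrite !mxE; apply: le_trans (ler_distD (ratr (v 0 l)) _ _) _.
  by rewrite lerD// ltW// distrC ybox.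
move=> /rP[y' [Ny' biy'] yy'].
by rewrite -(chart_inj bc biy' biy yy').
Qed.

End GoodTopology.

Lemma card_chart_index n (i0 j : 'I_n) : j != i0 ->
  #|{: {x : 'I_n * bool | (x.1 != i0) && (x.1 != j)}}| = (2 * n - 4)%N.
Proof.
move=> ji0; rewrite card_sig.
rewrite (eq_card (B := [predX [predC pred2 i0 j] & predT])); last first.
  by move=> [i b]; rewrite !inE /= negb_or andbT.
rewrite cardX card_bool.
have := cardC (pred2 i0 j); rewrite card2 eq_sym ji0 card_ord.
set k := #|_| => nk.
by rewrite -[in RHS]nk mulnDr addKn mulnC.
Qed.

Lemma card_chart_index0 n :
  #|{: {x : 'I_n * bool | xpredT x}}| = (2 * n)%N.
Proof.
by rewrite card_sig (eq_card (B := predT)) ?card_prod ?card_ord ?card_bool 1?mulnC.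
Qed.

(** * Charts of [RcU0]: fixed signs, translation parts as coordinates *)

Section FrameCharts.
Context {R : realType} {F : groupType} {n : nat}.
Variables (c : R) (s : 'I_n -> F).
Hypotheses (hc : -2 < c < 2) (hF : free_on s).
Variable (i0 : 'I_n).
Local Notation C := R[i].
Local Notation Re := (@complex.Re R).
Local Notation Im := (@complex.Im R).
Implicit Types (rho : F -> U0 R) (X Y : 'rV[R]_(n * (2 * 2 + 2 * 2))).
Local Notation kap := (kap c).
Local Notation wt := (wt c).
Local Notation rep := (rep_coord s).
Local Notation M := (RcU0 c s).
Local Notation hd := (@card_chart_index0 n).
Implicit Types (Z : 'rV[R]_(2 * n)) (e : {ffun 'I_n -> bool}).

Definition frame_coord X : 'rV[R]_(2 * n) := \row_l (let x := enum_idx hd l in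
  if x.2 then Im (trans_at X x.1) else Re (trans_at X x.1)).

Definition frame_trans Z i : C :=
  Complex (enum_get hd Z (i, false)) (enum_get hd Z (i, true)).

Definition frame_pt e Z :=
  rep_pt (fun i => rot_c c (if e i then 1 else -1)) (frame_trans Z).

Lemma frame_trans_coord X i : frame_trans (frame_coord X) i = trans_at X i.
Proof.
rewrite /frame_trans /frame_coord !(enum_get_row hd (fun x =>
  if x.2 then Im (trans_at X x.1) else Re (trans_at X x.1))) //; exact: complex_ext.
Qed.

Lemma frame_coord_pt e Z : frame_coord (frame_pt e Z) = Z.
Proof.
apply/rowP => l; rewrite mxE -(enum_get_idx hd) /frame_pt; cbv zeta; rewrite trans_at_pt.
by case: (enum_idx hd l) => i [].
Qed.

Lemma kap_frame_pt e Z i : kap (frame_pt e Z) i = if e i then 1 else -1.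
Proof. by rewrite /kap /frame_pt rot_at_pt /= mulfK// sina_neq0. Qed.

Definition sign_of X e := forall i, (0 < kap X i) = e i.

Lemma frame_ptK rho e : M rho -> sign_of (rep rho) e ->
  frame_pt e (frame_coord (rep rho)) = rep rho.
Proof.
move=> Mr p; apply/esym/rep_coord_pt => i; last first.
  by rewrite frame_trans_coord trans_at_coord.
have rc := RcU0_c_rep Mr.
rewrite -(rot_at_coord s) (rot_at_kap hc (c_rep_Re i rc)); congr (rot_c c _).
have /eqP := c_rep_kap hc i rc; rewrite -p sqrf_eq1 => /orP[] /eqP ->.
  by rewrite ltr01.
by rewrite oppr_gt0 ltr10.
Qed.

Lemma frame_realize e Z : (exists k, wt (frame_pt e Z) k != wt (frame_pt e Z) i0) ->
  exists rho, [/\ M rho, rep rho = frame_pt e Z & sign_of (rep rho) e].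
Proof.
move=> [k wk].
have k2 i : (if e i then 1 else -1 : R) ^+ 2 = 1 by case: (e i); rewrite ?sqrrN expr1n.
have [|rho [rM rE]] := @rep_pt_realize _ _ _ s hF
   (fun i => rot_c c (if e i then 1 else -1)) (frame_trans Z).
  by move=> i; exact: rot_cJ.
have {}rE : rep rho = frame_pt e Z := rE.
exists rho; split; [|exact: rE|]; last first.
  move=> i; rewrite rE kap_frame_pt; case: (e i); first exact: ltr01.
  by rewrite oppr_gt0 ltr10.
apply/(RcU0P hc hF i0); split; last by exists k; rewrite rE.
split; first exact: rM.
by move=> i; apply/trace_eq_c; rewrite -(rot_at_coord s) rE /frame_pt rot_at_pt.
Qed.

Definition frame_chart e : chart R (F -> U0 R) (2 * n) :=
  Chart [set rho | M rho /\ sign_of (rep rho) e] (fun rho => frame_coord (rep rho)).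

Lemma smooth_frame_pt e : smooth_on setT (frame_pt e).
Proof.
have oT := @openT 'rV[R]_(2 * n).
apply: smooth_rep_pt => // i; first exact: csmooth_cst.
by split; exact: smooth_enum_get.
Qed.

Lemma smooth_frame_coord : smooth_on setT frame_coord.
Proof.
have oT := @openT 'rV[R]_(n * (2 * 2 + 2 * 2)).
apply: smooth_on_mx => // i l; rewrite (ord1 i).
have [sr si] := csmooth_rep_entry (enum_idx hd l).1 0 1 oT.
case xE: (enum_idx hd l).2.
  by apply: smooth_on_eq si => X _; rewrite mxE; cbv zeta; rewrite xE.
by apply: smooth_on_eq sr => X _; rewrite mxE; cbv zeta; rewrite xE.
Qed.

Lemma frame_chart_embedded e : RcU0_atlas c s (frame_chart e).
Proof.
split.
  split; first by move=> rho [].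
  - move=> rho rho'; rewrite !inE => -[Mr p] [Mr' p'] /= E.
    apply: (rep_coord_inj hF (RcU0_morph Mr) (RcU0_morph Mr')).
    by rewrite -(frame_ptK Mr p) -(frame_ptK Mr' p') E.
  - apply: open_local => _ [rho [Mr p] <-].
    have [rc [k wk]] := (RcU0P hc hF i0 rho).1 Mr.
    exists (setT `&` frame_pt e @^-1` [set X | wt X k != wt X i0]); split.
    + exact: smooth_on_preim (smooth_frame_pt e) (@open_wt_neq _ _ c k i0).
    + by split=> //; rewrite /preimage/= frame_ptK.
    + move=> Z [_ wZ]; have [|r [Mr' rE p']] := @frame_realize e Z; first by exists k.
      by exists r; [split|rewrite /= rE frame_coord_pt].
move=> rho [Mr p]; exists (Chart setT rep); split=> //; split=> //.
- exists [set X | forall i, 0 < kap X i * kap (rep rho) i]; split.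
  + apply: open_forall_gt0 => i; apply: smooth_onM; last by apply: smooth_on_cst; exact: openT.
    by apply: csmooth_kap; exact: openT.
  + by move=> i; rewrite -expr2 (c_rep_kap hc i (RcU0_c_rep Mr)) ltr01.
  + move=> r Mr' _ pr; split=> // i; rewrite -p.
    have [pos|npos] := ltP 0 (kap (rep rho) i); first by rewrite -(pmulr_lgt0 _ pos) pr.
    apply/negP => pos; have := pr i; rewrite /= pmulr_rgt0//.
    by rewrite ltNge npos.
- move=> r [[Mr' pr] _]; exists setT, (frame_pt e); split=> //; first exact: smooth_frame_pt.
  by move=> r' [[Mr'' pr'] _] _; rewrite /= frame_ptK.
- move=> r [[Mr' pr] _]; exists setT, frame_coord; split=> //; exact: smooth_frame_coord.
Qed.

End FrameCharts.

Section XcU0Structure.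
Context {R : realType} {F : groupType} {n : nat}.
Variables (c : R) (s : 'I_n -> F).
Hypotheses (hc : -2 < c < 2) (hF : free_on s).
Variable (i0 : 'I_n).
Local Notation C := R[i].
Local Notation Re := (@complex.Re R).
Local Notation Im := (@complex.Im R).
Implicit Types (rho : F -> U0 R) (X Y : 'rV[R]_(n * (2 * 2 + 2 * 2))).
Local Notation kap := (kap c).
Local Notation wt := (wt c).
Local Notation rep := (rep_coord s).
Local Notation M := (RcU0 c s).
Local Notation E := (@AutU0_equiv R F).
Local Notation q := (eclass M E).
Local Notation d := (2 * n - 4)%N.
Local Notation good := (good_chart (d := d) M rep E).
Local Notation hd ji0 := (card_chart_index ji0).
Local Notation rinv := (ratio_inv c i0).

(** Reads the ratios off a chart value alone, so that values of two charts at different classes can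
    be compared. *)
Definition chart_ratio (j : 'I_n) (ji0 : j != i0) (Z : 'rV[R]_d) i : C :=
  if i == i0 then 0 else if i == j then 1 else
  Complex (enum_get (hd ji0) Z (i, false)) (enum_get (hd ji0) Z (i, true)).

Lemma chart_ratioE j (ji0 : j != i0) X i : wt X j != wt X i0 ->
  chart_ratio ji0 (coordZ c (hd ji0) X) i = rinv X j i.
Proof.
move=> wX; rewrite /chart_ratio; have [->|ii0] := eqVneq i i0; first by rewrite ratio_inv_i0.
have [->|ij] := eqVneq i j; first by rewrite ratio_inv_j.
by rewrite !enum_get_coordZ//; exact: complex_ext.
Qed.

Lemma csmooth_chart_ratio j (ji0 : j != i0) i (V : normedModType R) (U : set V)
    (f : V -> 'rV[R]_d) : smooth_on U f -> csmooth U (fun x => chart_ratio ji0 (f x) i).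
Proof.
move=> sf; have oU := sf.1.
have [ii0|ii0] := eqVneq i i0.
  by apply: (csmooth_eq (f := fun=> 0)) (csmooth_cst 0 oU) => Z _; rewrite /chart_ratio ii0 eqxx.
have [ij|ij] := eqVneq i j.
  apply: (csmooth_eq (f := fun=> 1)) (csmooth_cst 1 oU) => Z _.
  by rewrite /chart_ratio ij eqxx (negbTE ji0).
apply: (csmooth_eq (f := fun x => Complex (enum_get (hd ji0) (f x) (i, false))
  (enum_get (hd ji0) (f x) (i, true)))).
  by move=> x _; rewrite /chart_ratio (negbTE ii0) (negbTE ij).
have sg x : smooth_on U (fun z => enum_get (hd ji0) (f z) x).
  rewrite /enum_get; case: insub => [t|]; last exact: smooth_on_cst.
  by split=> // k; exact: (Ck_on_mx k f oU).1 (sf.2 k) _ _.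
by split; exact: sg.
Qed.

(** Since [kap X i0] is 1 or -1, the twist in [ratio_inv] is the identity or conjugation and
    respects products. *)
Lemma ratio_inv_change X j j' i : kap X i0 ^+ 2 = 1 ->
  wt X j != wt X i0 -> wt X j' != wt X i0 ->
  rinv X j i = rinv X j' i * rinv X j j'.
Proof.
move=> k2 wj wj'.
have -> : rinv X j i = let z := ratio c i0 X j' i * ratio c i0 X j j' in
    Complex (Re z) (kap X i0 * Im z).
  by rewrite /ratio_inv /ratio mulrA divfK ?subr_eq0.
rewrite /ratio_inv; case: (ratio c i0 X j' i) => a b; case: (ratio c i0 X j j') => a' b' /=.
apply: complex_ext => /=; last by ring.
by rewrite [in RHS]mulrACA -expr2 k2 mul1r.
Qed.

(** Vanishing minors say that the two vectors of ratios are proportional, even though they are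
    normalised at different indices; evaluating at [j'] gives the factor, and renormalising at [j']
    makes the invariants equal. *)
Lemma minors_equiv rho rho' j j' : M rho -> M rho' ->
  wt (rep rho) j != wt (rep rho) i0 -> wt (rep rho') j' != wt (rep rho') i0 ->
  (forall i, kap (rep rho) i * kap (rep rho) i0 = kap (rep rho') i * kap (rep rho') i0) ->
  (forall k l, rinv (rep rho) j k * rinv (rep rho') j' l =
               rinv (rep rho) j l * rinv (rep rho') j' k) ->
  E rho rho'.
Proof.
move=> Mr Mr' wj wj' kE mE.
have kr i := RcU0_kap hc i Mr; have kr' i := RcU0_kap hc i Mr'.
have UE k : rinv (rep rho) j k = rinv (rep rho) j j' * rinv (rep rho') j' k.
  by have := mE k j'; rewrite (ratio_inv_j wj') mulr1.
have t0 : rinv (rep rho) j j' != 0.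
  apply/eqP => t0; have := UE j; rewrite (ratio_inv_j wj) t0 mul0r.
  by move/eqP; rewrite oner_eq0.
have wj1 : wt (rep rho) j' != wt (rep rho) i0.
  apply: contra t0 => /eqP w0; rewrite /ratio_inv /ratio w0 subrr mul0r /= mulr0.
  exact/eqP.
apply/(AutU0_equivP hF (RcU0_morph Mr) (RcU0_morph Mr')).
apply: (act_of_invariants hc (i0 := i0) (j := j')) => //.
- by move=> i; exact: c_rep_Re (RcU0_c_rep Mr).
- by move=> i; exact: c_rep_Re (RcU0_c_rep Mr').
- move=> i; apply: (mulIf t0); rewrite -(ratio_inv_change _ (kr i0) wj wj1) UE.
  by rewrite mulrC.
Qed.

Lemma RcU0_pattern rho : exists e : {ffun 'I_n -> bool}, pattern c i0 (rep rho) e.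
Proof. by exists [ffun i => 0 < kap (rep rho) i * kap (rep rho) i0] => i; rewrite ffunE. Qed.

(** Charts with different sign patterns have disjoint domains. For equal patterns some minor of the
    two ratio vectors is nonzero and stays so on a product of balls, while at the two chart values
    of one class every minor vanishes. *)
Lemma class_separated rho rho' : M rho -> M rho' -> q rho <> q rho' ->
  exists b b' A A',
     [/\ good b /\ good b', open A /\ open A', chart_preim b A (q rho),
         chart_preim b' A' (q rho') &
         forall y, chart_preim b A y -> chart_preim b' A' y -> False].
Proof.
move=> Mr Mr' ne.
have [rc [j wj]] := (RcU0P hc hF i0 rho).1 Mr.
have [rc' [j' wj']] := (RcU0P hc hF i0 rho').1 Mr'.
have ji0 : j != i0 by apply: contraNneq wj => ->.
have j'i0 : j' != i0 by apply: contraNneq wj' => ->.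
have [e p] := RcU0_pattern rho; have [e' p'] := RcU0_pattern rho'.
pose b := class_chart c s (hd ji0) e; pose b' := class_chart c s (hd j'i0) e'.
have gb : good b by exact: class_chart_good.
have gb' : good b' by exact: class_chart_good.
have bq : cdom b (q rho) by exact/(class_chartP hc hF).
have bq' : cdom b' (q rho') by exact/(class_chartP hc hF).
exists b, b'.
have [ee|ee] := eqVneq e e'; last first.
  exists setT, setT; split=> //; first by split; exact: openT.
  move=> y [[r [Mr1 -> pr _]] _] [b'r _].
  have [pr' _] := (class_chartP hc hF (hd j'i0) e' Mr1).1 b'r.
  by move/eqP: ee; apply; apply/ffunP => i; rewrite -pr -pr'.
pose mn k l (W : 'rV[R]_(d + d)) : C :=
  chart_ratio ji0 (lsubmx W) k * chart_ratio j'i0 (rsubmx W) l -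
  chart_ratio ji0 (lsubmx W) l * chart_ratio j'i0 (rsubmx W) k.
have smn k l : csmooth setT (mn k l).
  have oT := @openT 'rV[R]_(d + d).
  have sl : smooth_on setT (lsubmx : 'rV[R]_(d + d) -> 'rV[R]_d).
    apply: smooth_on_mx => // i x.
    by apply: smooth_on_eq (smooth_on_coord i (lshift d x) oT) => W _; rewrite mxE.
  have sr : smooth_on setT (rsubmx : 'rV[R]_(d + d) -> 'rV[R]_d).
    apply: smooth_on_mx => // i x.
    by apply: smooth_on_eq (smooth_on_coord i (rshift d x) oT) => W _; rewrite mxE.
  by apply: csmoothB; apply: csmoothM; exact: csmooth_chart_ratio.
have mnE r Z Z' k l : M r -> wt (rep r) j != wt (rep r) i0 -> wt (rep r) j' != wt (rep r) i0 ->
    coordZ c (hd ji0) (rep r) = Z -> coordZ c (hd j'i0) (rep r) = Z' ->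
    mn k l (row_mx Z Z') = 0.
  move=> Mr1 wr wr' <- <-; rewrite /mn row_mxKl row_mxKr !chart_ratioE//.
  have k2 := RcU0_kap hc i0 Mr1.
  by rewrite (ratio_inv_change k k2 wr wr') (ratio_inv_change l k2 wr wr'); ring.
have [k [l mkl]] : exists k l,
    mn k l (row_mx (b (q rho)) (b' (q rho'))) != 0.
  apply: contrapT => nkl; apply: ne; apply/eclassE => //.
  apply: (minors_equiv Mr Mr' wj wj').
    move=> i; have k2 := RcU0_kap hc i Mr; have k02 := RcU0_kap hc i0 Mr.
    have k2' := RcU0_kap hc i Mr'; have k02' := RcU0_kap hc i0 Mr'.
    by rewrite (pattern_sign k2 k02 p) (pattern_sign k2' k02' p') ee.
  move=> k l; apply/eqP; rewrite -subr_eq0 -[_ == _]negbK; apply/negP => kl.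
  apply: nkl; exists k, l.
  rewrite /mn row_mxKl row_mxKr /b /b' (class_chartE hc hF (hd ji0) e Mr).
  by rewrite (class_chartE hc hF (hd j'i0) e' Mr') !chart_ratioE.
have oN : open [set W | 0 < Re (mn k l W) ^+ 2 + Im (mn k l W) ^+ 2].
  apply: open_gt0; have [sr si] := smn k l.
  by apply: smooth_onD; apply: smooth_onM.
have /nbhs_ballP[r /= r0 rP] := open_nbhs_nbhs (conj oN (sqr_complex_gt0 mkl)).
have r20 : 0 < r / 2 by rewrite divr_gt0.
exists (ball (b (q rho)) (r / 2)), (ball (b' (q rho')) (r / 2)); split=> //.
- by split; exact: ball_open.
- by split=> //; exact: ballxx.
- by split=> //; exact: ballxx.
move=> y [by_ By] [by' By']; have [r1 [Mr1 yE pr wr]] := by_; subst y.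
have [pr' wr'] := (class_chartP hc hF (hd j'i0) e' Mr1).1 by'.
have : ball (row_mx (b (q rho)) (b' (q rho'))) r (row_mx (b (q r1)) (b' (q r1))).
  move: By By'; rewrite -!ball_normE /= => By By'.
  apply: (@le_lt_trans _ _ (r / 2)); last by rewrite ltr_pdivrMr// mulr_natr mulr2n ltrDl.
  apply: rV_norm_le => [|i]; first exact: ltW.
  rewrite opp_row_mx add_row_mx; case: (split_ordP i) => x ->.
    by rewrite row_mxEl (le_trans _ (ltW By))// rV_coord_le.
  by rewrite row_mxEr (le_trans _ (ltW By'))// rV_coord_le.
have bE : b (q r1) = coordZ c (hd ji0) (rep r1) := class_chartE hc hF (hd ji0) e Mr1.
have b'E : b' (q r1) = coordZ c (hd j'i0) (rep r1) := class_chartE hc hF (hd j'i0) e' Mr1.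
have m0 := mnE r1 _ _ k l Mr1 wr wr' (esym bE) (esym b'E).
move=> /rP; rewrite /mkset m0; apply/negP.
by rewrite -leNgt expr0n addr0.
Qed.

Lemma XcU0_structure : quotient_structure M (RcU0_atlas c s) E good.
Proof.
have cov rho : M rho -> exists (j : {j : 'I_n | j != i0}) e,
    cdom (class_chart c s (hd (svalP j)) e) (q rho).
  move=> Mr; have [rc [j wj]] := (RcU0P hc hF i0 rho).1 Mr.
  have ji0 : j != i0 by apply: contraNneq wj => ->.
  have [e p] := RcU0_pattern rho; exists (exist _ j ji0), e.
  by apply/(class_chartP hc hF).
apply: good_quotient_structure.
- move=> rho Mr; exists (frame_chart c s [ffun i => 0 < kap (rep rho) i]).
    exact: frame_chart_embedded.
  by split=> // i; rewrite ffunE.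
- move=> rho Mr; have [j [e be]] := cov _ Mr.
  by exists (class_chart c s (hd (svalP j)) e) => //; exact: (class_chart_good hc hF (svalP j)).
- by apply: good_hausdorff; exact: class_separated.
- apply: (@good_second_countable _ _ _ _ _ _ _ ({j : 'I_n | j != i0} * {ffun 'I_n -> bool})%type
    (fun k => class_chart c s (hd (svalP k.1)) k.2)).
    by move=> k; exact: (class_chart_good hc hF (svalP k.1)).
  by move=> rho /cov[j [e be]]; exists (j, e).
Qed.

End XcU0Structure.

(** * Properness of the action *)

Section ProperAction.
Context {R : realType} {F : groupType} {n : nat}.
Variables (c : R) (s : 'I_n -> F).
Hypotheses (hc : -2 < c < 2) (hF : free_on s).
Variable (i0 : 'I_n).
Local Notation C := R[i].
Local Notation Re := (@complex.Re R).
Local Notation Im := (@complex.Im R).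
Local Notation N := (n * (2 * 2 + 2 * 2))%N.
Implicit Types (rho : F -> U0 R) (X Y : 'rV[R]_N).
Local Notation kap := (kap c).
Local Notation wt := (wt c).
Local Notation sina := (sina c).
Local Notation rep := (rep_coord s).
Local Notation M := (RcU0 c s).

Lemma AutU0_acts_RcU0 : AutU0_acts c s.
Proof.
move=> g rho /AutU0P[k [l [m [l0 ->]]]] Mr.
have [rc [j wj]] := (RcU0P hc hF i0 rho).1 Mr.
have a := act_rel_aut s k l m rho.
apply/(RcU0P hc hF i0); split; last first.
  by exists j; rewrite (wt_act_neq hc l0 a (fun i => RcU0_kap hc i Mr)).
split; first by move=> x y /=; rewrite (RcU0_morph Mr) autU0M.
move=> i; apply/trace_eq_c; rewrite /= rot_aut Re_cj -(rot_at_coord s).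
exact: c_rep_Re rc.
Qed.

(** A preserved nonzero sign excludes conjugation, two distinct fixed points of the similarity give
    l = 1, and one of them then gives m = 0. *)
Lemma AutU0_free_RcU0 : AutU0_free c s.
Proof.
move=> g rho /AutU0P[k [l [m [l0 ->]]]] Mr gr.
have [rc [j wj]] := (RcU0P hc hF i0 rho).1 Mr.
have kr i := RcU0_kap hc i Mr.
have := act_rel_aut s k l m rho; rewrite gr => a.
have kf : k = false.
  have := kap_act c i0 a; case: (k) => //; rewrite /sg mulN1r => k0.
  have {}k0 : kap (rep rho) i0 = 0 by lra.
  by have := kr i0; rewrite k0 expr0n /= => /eqP; rewrite eq_sym oner_eq0.
subst k; have l1 : l = 1.
  have E := wt_actB hc a kr j i0.
  have d0 : wt (rep rho) j - wt (rep rho) i0 != 0 by rewrite subr_eq0.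
  by apply: (mulIf d0); rewrite mul1r [RHS]E /sg rmorph1 mul1r.
have m0 : m = 0.
  have E := wt_act hc (kr i0) a.
  have S0 := sinaC_neq0 hc; apply: (mulIf S0); rewrite mul0r.
  by apply: (@addrI _ (wt (rep rho) i0)); rewrite addr0 [RHS]E /sg l1 rmorph1 !mul1r.
apply/funext => A; apply: U0_ext; rewrite ?rot_aut ?trans_aut//.
by rewrite l1 m0 mul1r mul0r addr0.
Qed.

Lemma continuous_mx (T : topologicalType) p p' (f : T -> 'M[R]_(p, p')) :
  (forall i j, continuous (fun x => f x i j)) -> continuous f.
Proof.
move=> fc x; apply/cvgrPdist_lt => e e0; near=> y.
rewrite [ltLHS]/Num.Def.normr/= mx_normrE (bigmax_lt _ e0)//= => i _.
rewrite !mxE; move: i; near: y; apply: filter_forall => /= i.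
by move/cvgrPdist_lt: (fc i.1 i.2 x); apply.
Unshelve. all: by end_near. Qed.

Lemma continuous_row_mx (T : topologicalType) p p' (f : T -> 'rV[R]_p) (g : T -> 'rV[R]_p') :
  continuous f -> continuous g -> continuous (fun x => row_mx (f x) (g x)).
Proof.
move=> fc gc; apply: continuous_mx => i j; rewrite (ord1 i).
case: (split_ordP j) => l ->; move=> x.
  under eq_fun do rewrite row_mxEl.
  by apply: (@continuous_comp _ _ _ f (fun v => v 0 l)); [exact: fc|exact: coord_continuous].
under eq_fun do rewrite row_mxEr.
by apply: (@continuous_comp _ _ _ g (fun v => v 0 l)); [exact: gc|exact: coord_continuous].
Qed.

Definition aut_par k (v : 'rV[R]_(1 * 2 + 1 * 2)) : U0 R -> U0 R :=
  autU0 k (centry v 0 0) (centry v 0 1).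

Lemma smooth_rsubmx p p' : smooth_on setT (rsubmx : 'rV[R]_(p + p') -> 'rV[R]_p').
Proof.
have oT := @openT 'rV[R]_(p + p'); apply: smooth_on_mx => // i x.
by apply: smooth_on_eq (smooth_on_coord i (rshift p x) oT) => W _; rewrite mxE.
Qed.

Lemma smooth_lsubmx p p' : smooth_on setT (lsubmx : 'rV[R]_(p + p') -> 'rV[R]_p).
Proof.
have oT := @openT 'rV[R]_(p + p'); apply: smooth_on_mx => // i x.
by apply: smooth_on_eq (smooth_on_coord i (lshift p' x) oT) => W _; rewrite mxE.
Qed.

Lemma csmooth_centry_comp (V : normedModType R) (U : set V) p p'
    (f : V -> 'rV[R]_(p * p' + p * p')) i j :
  smooth_on U f -> csmooth U (fun x => centry (f x) i j).
Proof.
move=> sf; have oU := sf.1.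
by split; split=> // k; exact: (Ck_on_mx k f oU).1 (sf.2 k) _ _.
Qed.

Lemma csmooth_rep_entry_comp (V : normedModType R) (U : set V)
    (f : V -> 'rV[R]_N) i j k :
  smooth_on U f -> csmooth U (fun x => rep_entry (f x) i j k).
Proof.
move=> sf; apply: csmooth_centry_comp; have oU := sf.1.
apply: smooth_on_mx => // a b; split=> // r.
apply: Ck_on_eq ((Ck_on_mx r f oU).1 (sf.2 r) 0 (mxvec_index i b)) => // x _.
by rewrite !mxE.
Qed.

(** Joint continuity in parameters and group element curries to continuity into the compact-open
    topology; it can be tested after [U0_coord], which induces the topology of U_0. *)
Lemma continuous_aut_par k :
  continuous (aut_par k : _ -> {compact-open, U0 R -> U0 R}).
Proof.
pose h (p : 'rV[R]_(1 * 2 + 1 * 2) * U0 R) : U0 R := aut_par k p.1 p.2.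
suff hc' : continuous h by exact: (continuous_curry_fun hc').
apply: (@continuous_comp_initial _ _ _ (@U0_coord R) h).
pose H (W : 'rV[R]_((1 * 2 + 1 * 2) + (2 * 2 + 2 * 2))) :=
  U0_pt (cj k (centry (rsubmx W) 0 0))
   (centry (lsubmx W) 0 0 * cj k (centry (rsubmx W) 0 1) +
    centry (lsubmx W) 0 1 * (Im (centry (rsubmx W) 0 0))%:C).
have sH : smooth_on setT H.
  have sl i j : csmooth setT (fun W : 'rV[R]_((1 * 2 + 1 * 2) + (2 * 2 + 2 * 2)) =>
      centry (lsubmx W) i j) by apply: csmooth_centry_comp; exact: smooth_lsubmx.
  have sr i j : csmooth setT (fun W : 'rV[R]_((1 * 2 + 1 * 2) + (2 * 2 + 2 * 2)) =>
      centry (rsubmx W) i j) by apply: csmooth_centry_comp; exact: smooth_rsubmx.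
  apply: smooth_U0_pt; first exact: csmooth_cj.
  by apply: csmoothD; apply: csmoothM => //; [exact: csmooth_cj|exact: csmooth_Im].
rewrite (_ : _ \o h = H \o (fun p => row_mx p.1 (U0_coord p.2))); last first.
  apply/funext => -[v A] /=; rewrite /H row_mxKl row_mxKr.
  by rewrite U0_coordE centry_rot centry_trans /h /aut_par /= rot_aut trans_aut.
move=> p; apply: continuous_comp; last exact: smooth_on_continuous sH I.
apply: continuous_row_mx => x; first exact: cvg_fst.
apply: (@continuous_comp _ _ _ snd (@U0_coord R)); first exact: cvg_snd.
exact: initial_continuous.
Qed.

Lemma closed_forall_eq0 (V : normedModType R) (J : Type) (h : J -> V -> C) :
  (forall i, csmooth setT (h i)) -> closed [set x | forall i, h i x = 0].
Proof.
move=> sh; pose A i := [set x | 0 < Re (h i x) ^+ 2 + Im (h i x) ^+ 2].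
have -> : [set x | forall i, h i x = 0] = ~` \bigcup_i A i.
  apply/seteqP; split=> x /=.
    by move=> h0 [i _]; rewrite /A /= h0 /= expr0n addr0 ltxx.
  move=> nA i; apply/eqP; rewrite -[_ == _]negbK; apply/negP => /sqr_complex_gt0 p.
  by apply: nA; exists i.
apply: open_closedC; apply: bigcup_open => i _; apply: open_gt0.
by have [sr si] := sh i; apply: smooth_onD; apply: smooth_onM.
Qed.

(** [sq_dist] is the denominator, [lin_num] and [tr_num] are the numerators, of the least-squares
    fit of a similarity to the differences from [i0]. Summing over all points avoids choosing an
    index [j], which could not be done uniformly over a compact set. *)
Definition sq_dist X : C :=
  \sum_i (wt X i - wt X i0) * (wt X i - wt X i0)^*%C.

Definition lin_num k Y X : C := (sg k)%:C *
  \sum_i (wt Y i - wt Y i0) * (cj k (wt X i - wt X i0))^*%C.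

Definition tr_num k Y X : C :=
  ((sg k)%:C * wt Y i0 * sq_dist X - lin_num k Y X * cj k (wt X i0)) / sina%:C.

Lemma sgCM k : (sg k)%:C * (sg k)%:C = 1 :> C.
Proof. by rewrite -rmorphM sgM. Qed.

Lemma cj_normsq k (z : C) : cj k z * (cj k z)^*%C = z * z^*%C.
Proof. by case: k => //=; rewrite conjcK mulrC. Qed.

Lemma lin_num_act k l m X Y : act_rel k l m X Y -> (forall i, kap X i ^+ 2 = 1) ->
  lin_num k Y X = l * sq_dist X.
Proof.
move=> a kX; rewrite /lin_num /sq_dist !mulr_sumr; apply: eq_bigr => i _.
rewrite (wt_actB hc a kX) -(cj_normsq k).
transitivity ((sg k)%:C * (sg k)%:C * (l * (cj k (wt X i - wt X i0) *
  (cj k (wt X i - wt X i0))^*%C))); first by ring.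
by rewrite sgCM mul1r.
Qed.

Lemma tr_num_act k l m X Y : act_rel k l m X Y -> (forall i, kap X i ^+ 2 = 1) ->
  tr_num k Y X = m * sq_dist X.
Proof.
move=> a kX; rewrite /tr_num (lin_num_act a kX) (wt_act hc (kX i0) a).
apply: (mulIf (sinaC_neq0 hc)); rewrite (divfK (sinaC_neq0 hc)).
transitivity (((sg k)%:C * (sg k)%:C) * (l * cj k (wt X i0) + m * sina%:C) * sq_dist X
  - l * sq_dist X * cj k (wt X i0)); first by ring.
by rewrite sgCM; ring.
Qed.

Lemma sq_dist_neq0 X j : wt X j != wt X i0 -> sq_dist X != 0.
Proof.
move=> wj; apply/eqP => /psumr_eq0P d0; move: wj; rewrite -subr_eq0; apply/negP/negPn.
have /eqP := d0 (fun i _ => mulcJ_ge0 _) j isT.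
by rewrite mulf_eq0 conjc_eq0 orbb.
Qed.

(** The equations of [act_rel] with the fitted parameters inserted and denominators cleared, so that
    they make sense on the whole ambient space and cut out a closed set. *)
Definition rel_defect k (x : 'I_n * bool) (W : 'rV[R]_(N + N)) : C :=
  let Y := lsubmx W in let X := rsubmx W in
  if x.2 then rot_at Y x.1 - cj k (rot_at X x.1)
  else trans_at Y x.1 * sq_dist X - (lin_num k Y X * cj k (trans_at X x.1) +
    tr_num k Y X * (Im (rot_at X x.1))%:C).

Lemma rel_defect_act k l m X Y x : act_rel k l m X Y -> (forall i, kap X i ^+ 2 = 1) ->
  rel_defect k x (row_mx Y X) = 0.
Proof.
move=> a kX; rewrite /rel_defect row_mxKl row_mxKr; have [rE tE] := a x.1.
case: x.2; first by rewrite rE subrr.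
by rewrite tE (lin_num_act a kX) (tr_num_act a kX); ring.
Qed.

Lemma act_rel_defect k X Y : sq_dist X != 0 ->
  (forall x, rel_defect k x (row_mx Y X) = 0) ->
  act_rel k (lin_num k Y X / sq_dist X) (tr_num k Y X / sq_dist X) X Y.
Proof.
move=> D0 h i; have := h (i, true); have := h (i, false).
rewrite /rel_defect row_mxKl row_mxKr /= => /eqP + /eqP.
rewrite !subr_eq0 => /eqP tE /eqP ->; split=> //.
have DK z w : z / sq_dist X * w * sq_dist X = z * w by rewrite mulrAC divfK.
by apply: (mulIf D0); rewrite tE [RHS]mulrDl !DK.
Qed.

Section Smoothness.
Variables (V : normedModType R) (U : set V) (f g : V -> 'rV[R]_N).
Hypotheses (sf : smooth_on U f) (sg' : smooth_on U g).

Lemma csmooth_wt_comp (h : V -> 'rV[R]_N) i : smooth_on U h ->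
  csmooth U (fun x => wt (h x) i).
Proof.
move=> sh; apply: csmoothM; last exact: csmooth_rep_entry_comp.
apply: csmooth_real; apply: smooth_onM; last exact: (smooth_on_cst _ sh.1).
exact: (csmooth_rep_entry_comp i 0 0 sh).2.
Qed.

Lemma csmooth_sq_dist : csmooth U (fun x => sq_dist (g x)).
Proof.
apply: csmooth_sum => [|i _]; first exact: sg'.1.
by apply: csmoothM; last apply: csmoothJ; apply: csmoothB; exact: csmooth_wt_comp.
Qed.

Lemma csmooth_lin_num k : csmooth U (fun x => lin_num k (f x) (g x)).
Proof.
apply: csmoothM; first exact: (csmooth_cst _ sf.1).
apply: csmooth_sum => [|i _]; first exact: sg'.1.
apply: csmoothM; first by apply: csmoothB; exact: csmooth_wt_comp.
by apply: csmoothJ; apply: csmooth_cj; apply: csmoothB; exact: csmooth_wt_comp.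
Qed.

Lemma csmooth_tr_num k : csmooth U (fun x => tr_num k (f x) (g x)).
Proof.
have sc z : csmooth U (fun=> z) := csmooth_cst z sf.1.
apply: csmoothM => //; apply: csmoothB.
  apply: csmoothM; last exact: csmooth_sq_dist.
  by apply: csmoothM => //; exact: csmooth_wt_comp.
apply: csmoothM; first exact: csmooth_lin_num.
by apply: csmooth_cj; exact: csmooth_wt_comp.
Qed.

End Smoothness.

Lemma csmooth_rel_defect k x : csmooth setT (rel_defect k x).
Proof.
have sl := @smooth_lsubmx N N; have sr := @smooth_rsubmx N N.
rewrite /rel_defect; case: x => i [] /=.
  apply: csmoothB; first exact: csmooth_rep_entry_comp.
  by apply: csmooth_cj; exact: csmooth_rep_entry_comp.
apply: csmoothB.
  by apply: csmoothM; [exact: csmooth_rep_entry_comp|exact: csmooth_sq_dist].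
apply: csmoothD; apply: csmoothM.
- exact: csmooth_lin_num.
- by apply: csmooth_cj; exact: csmooth_rep_entry_comp.
- exact: csmooth_tr_num.
- apply: (csmooth_Im (f := fun W : 'rV[R]_(N + N) => rot_at (rsubmx W) i)).
  exact: csmooth_rep_entry_comp.
Qed.

Definition par_of k (W : 'rV[R]_(N + N)) : 'rV[R]_(1 * 2 + 1 * 2) :=
  let Y := lsubmx W in let X := rsubmx W in
  re_im (\matrix_(i < 1, j < 2) if j == 0 then lin_num k Y X / sq_dist X
                                else tr_num k Y X / sq_dist X).

Lemma continuous_par_of k W : sq_dist (rsubmx W) != 0 -> {for W, continuous (par_of k)}.
Proof.
move=> D0; have sl := @smooth_lsubmx N N; have sr := @smooth_rsubmx N N.
have sD : csmooth setT (fun W : 'rV[R]_(N + N) => sq_dist (rsubmx W)) := csmooth_sq_dist sr.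
pose U := [set W : 'rV[R]_(N + N) |
    0 < Re (sq_dist (rsubmx W)) ^+ 2 + Im (sq_dist (rsubmx W)) ^+ 2].
have oU : open U.
  by apply: open_gt0; have [s1 s2] := sD; apply: smooth_onD; apply: smooth_onM.
have UW : U W by exact: sqr_complex_gt0.
have U0 V : U V -> sq_dist (rsubmx V) != 0.
  by move=> UV; apply/eqP => E; move: UV; rewrite /U /= E /= expr0n addr0 ltxx.
apply: (@smooth_on_continuous _ _ _ U) UW.
have sub f : csmooth setT f -> csmooth U f by apply: csmooth_sub.
have sV : csmooth U (fun W => (sq_dist (rsubmx W))^-1) by apply: csmoothV => //; exact: sub.
apply: smooth_re_im => // i j; have [->|j0] := eqVneq j 0.
  apply: (csmooth_eq (f := fun W => lin_num k (lsubmx W) (rsubmx W) / sq_dist (rsubmx W))).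
    by move=> V _; rewrite mxE.
  by apply: csmoothM => //; apply: sub; exact: csmooth_lin_num.
apply: (csmooth_eq (f := fun W => tr_num k (lsubmx W) (rsubmx W) / sq_dist (rsubmx W))).
  by move=> V _; rewrite mxE (negbTE j0).
by apply: csmoothM => //; apply: sub; exact: csmooth_tr_num.
Qed.

(** The automorphism relating two representations is a continuous function of the pair, once [k] is
    fixed. So the set in question is the union, over the two values of [k], of continuous images of
    closed parts of the compact set [K]. *)
Lemma AutU0_proper_RcU0 : AutU0_proper c s.
Proof.
move=> K cK KM.
pose jn (p : 'rV[R]_N * 'rV[R]_N) := row_mx p.1 p.2.
have jc : continuous jn.
  by apply: continuous_row_mx => x; [exact: cvg_fst|exact: cvg_snd].
have cK' : compact (jn @` K).
  by apply: continuous_compact => //; exact: continuous_subspaceT.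
pose A k := jn @` K `&` [set W | forall x, rel_defect k x W = 0].
have cA k : compact (A k).
  apply: compact_closedI => //; apply: closed_forall_eq0 => x.
  exact: csmooth_rel_defect.
pose f k (W : 'rV[R]_(N + N)) : {compact-open, U0 R -> U0 R} * 'rV[R]_N :=
  (aut_par k (par_of k W), rsubmx W).
have repM Y X : K (Y, X) -> exists rho rho', [/\ M rho, M rho', Y = rep rho' & X = rep rho].
  by move=> /KM[[r' Mr' YE] [r Mr XE]]; exists r, r'; split.
have D0 rho : M rho -> sq_dist (rep rho) != 0.
  by move=> /(RcU0P hc hF i0)[_ [j]]; exact: sq_dist_neq0.
have fc k : {within A k, continuous (f k)}.
  apply: continuous_in_subspaceT => W; rewrite inE => -[[[Y X] /= YX <-] _].
  have [r [r' [Mr Mr' _ XE]]] := repM _ _ YX.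
  have D1 : sq_dist (rsubmx (jn (Y, X))) != 0 by rewrite row_mxKr XE D0.
  have c1 : (fun W => aut_par k (par_of k W) : {compact-open, U0 R -> U0 R}) @
      (jn (Y, X)) --> (aut_par k (par_of k (jn (Y, X))) : {compact-open, U0 R -> U0 R}).
    apply: (@continuous_comp _ _ {compact-open, U0 R -> U0 R} (par_of k) (aut_par k)).
      exact: continuous_par_of.
    exact: continuous_aut_par.
  have c2 : (rsubmx : 'rV[R]_(N + N) -> 'rV[R]_N) @ (jn (Y, X)) --> rsubmx (jn (Y, X)).
    exact: (smooth_on_continuous (@smooth_rsubmx N N) I).
  exact: (cvg_pair c1 c2).
have -> : [set p : {compact-open, U0 R -> U0 R} * 'rV[R]_N | exists g rho,
    [/\ AutU0 g, M rho, p = (g, rep rho) & K (rep (g \o rho), rep rho)]] =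
    (f true @` A true) `|` (f false @` A false).
  apply/seteqP; split=> [p [g [rho [ag Mr -> Kp]]]|].
    have [k [l [m [l0 gE]]]] := AutU0P ag.
    have a : act_rel k l m (rep rho) (rep (g \o rho)) by rewrite gE; exact: act_rel_aut.
    have kr i := RcU0_kap hc i Mr.
    have : (f k @` A k) (g, rep rho).
      exists (jn (rep (g \o rho), rep rho)).
        split; first by exists (rep (g \o rho), rep rho).
        by move=> x; exact: rel_defect_act a kr.
      rewrite /f /par_of row_mxKl row_mxKr (lin_num_act a kr) (tr_num_act a kr).
      rewrite !(mulfK (D0 _ Mr)) gE; congr pair.
      by rewrite /aut_par !re_imK !mxE.
    by case: (k); [left|right].
  have H k p : (f k @` A k) p -> exists g rho,
      [/\ AutU0 g, M rho, p = (g, rep rho) & K (rep (g \o rho), rep rho)].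
    move=> [W [[[Y X] /= YX <-] WE] <-]; have [r [r' [Mr Mr' YE XE]]] := repM _ _ YX.
    have D1 := D0 _ Mr; rewrite -XE in D1.
    have a := act_rel_defect D1 WE.
    have kr i := RcU0_kap hc i Mr; have kX i : kap X i ^+ 2 = 1 by rewrite XE.
    set l := lin_num k Y X / sq_dist X in a; set m := tr_num k Y X / sq_dist X in a.
    (* With l = 0 all points of the target would coincide, but the target is not fully reducible. *)
    have l0 : l != 0.
      apply/eqP => l0; have [_ [j]] := (RcU0P hc hF i0 r').1 Mr'.
      by rewrite -YE -subr_eq0 (wt_actB hc a kX) l0 mulr0 mul0r eqxx.
    have aE : aut_par k (par_of k (jn (Y, X))) = autU0 k l m.
      by rewrite /aut_par /par_of row_mxKl row_mxKr !re_imK !mxE.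
    exists (autU0 k l m), r; split.
    - exact: autU0_AutU0.
    - exact: Mr.
    - by rewrite /f aE row_mxKr XE.
    - have -> : rep (autU0 k l m \o r) = rep r'.
        rewrite [RHS]rep_coordE; apply: rep_coord_pt => i; have [rE tE] := a i.
          by rewrite /= rot_aut -!(rot_at_coord s) -YE -XE rE.
        by rewrite /= trans_aut -!(trans_at_coord s) -!(rot_at_coord s) -YE -XE tE.
      by rewrite -YE -XE.
  by move=> p [] /H.
by apply: compactU; (apply: continuous_compact; [exact: fc|exact: cA]).
Qed.

End ProperAction.

(** * The slice t = 0 *)

Section Degenerate.
Context {R : realType} {n : nat}.
Variable (c : R).
Hypotheses (hc : -2 < c < 2).
Local Notation C := R[i].
Local Notation Re := (@complex.Re R).
Local Notation Im := (@complex.Im R).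
Local Notation N := (n * (2 * 2 + 2 * 2))%N.
Local Notation sina := (sina c).
Implicit Types (X Y Z : 'rV[R]_N) (V : 'M[R]_(3, n)) (p : R * 'M[R]_(3, n)).

Definition sim X Y := exists k l m, l != 0 /\ act_rel k l m X Y.

Lemma sim_refl X : sim X X.
Proof.
exists false, 1, 0; split; first exact: oner_neq0.
by move=> i /=; rewrite mul1r mul0r addr0.
Qed.

Lemma sim_sym X Y : sim X Y -> sim Y X.
Proof.
move=> [k [l [m [l0 a]]]].
have l1 : (cj k l)^-1 != 0 by rewrite invr_eq0 cj_eq0.
exists k, (cj k l)^-1, (- ((cj k l)^-1 * cj k m * (sg k)%:C)); split=> // i.
have [rE tE] := a i; split; first by rewrite rE cjK.
have kl : cj k l != 0 by rewrite cj_eq0.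
have sgC : (sg k)%:C * (sg k)%:C = 1 :> C by rewrite -rmorphM sgM.
rewrite tE rE Im_cj [(sg k * _)%:C]rmorphM cjD !cjM cjK cjr.
apply: (mulfI kl); rewrite mulrDr mulrA divff// mul1r.
rewrite [cj k l * (_ * _)](_ : _ = - ((cj k l / cj k l) * ((sg k)%:C * (sg k)%:C) *
  cj k m * (Im (rot_at X i))%:C)); last by ring.
by rewrite divff// sgC !mul1r addrK.
Qed.

Lemma sim_trans X Y Z : sim X Y -> sim Y Z -> sim X Z.
Proof.
move=> [k [l [m [l0 a]]]] [k' [l' [m' [l0' a']]]].
exists (k (+) k'), (l' * cj k' l), (l' * cj k' m + m' * (sg k)%:C); split.
  by rewrite mulf_neq0// cj_eq0.
have cc z : cj (k (+) k') z = cj k' (cj k z).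
  by case: (k) (k') => [] [] //=; rewrite conjcK.
move=> i; have [rE tE] := a i; have [rE' tE'] := a' i; split; first by rewrite rE' rE cc.
rewrite tE' tE rE cc Im_cj [(sg k * _)%:C]rmorphM cjD !cjM cjr; ring.
Qed.

Definition plane V i : C := Complex (V 0 i) (V 1 i).

Lemma ord3P (k : 'I_3) : [\/ k = 0, k = 1 | k = 2].
Proof.
case: k => [[|[|[|//]]] h]; [apply: Or31|apply: Or32|apply: Or33]; exact/val_inj.
Qed.

Lemma mulmx3E (g : 'M[R]_3) V k i :
  (g *m V) k i = g k 0 * V 0 i + g k 1 * V 1 i + g k 2 * V 2 i.
Proof.
rewrite mxE !big_ord_recl big_ord0 addr0 addrA.
by congr (g k _ * V _ i + g k _ * V _ i + g k _ * V _ i); apply/val_inj.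
Qed.

Lemma block3E (A : 'M[R]_2) (b : 'cV[R]_2) (d : R) :
  let g : 'M[R]_3 := (block_mx A b 0 (d%:M : 'M[R]_1) : 'M[R]_(2 + 1)) in
  [/\ [/\ g 0 0 = A 0 0, g 0 1 = A 0 1 & g 0 2 = b 0 0],
      [/\ g 1 0 = A 1 0, g 1 1 = A 1 1 & g 1 2 = b 1 0] &
      [/\ g 2 0 = 0, g 2 1 = 0 & g 2 2 = d]].
Proof.
move=> g.
have e0 : (0 : 'I_3) = lshift 1 (0 : 'I_2) by exact/val_inj.
have e1 : (1 : 'I_3) = lshift 1 (1 : 'I_2) by exact/val_inj.
have e2 : (2 : 'I_3) = rshift 2 (0 : 'I_1) by exact/val_inj.
rewrite /g e2 e0 e1; split; split; try exact: block_mxEul; try exact: block_mxEur.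
- by apply: etrans (block_mxEdl _ _ _ _ _ _) _; rewrite mxE.
- by apply: etrans (block_mxEdl _ _ _ _ _ _) _; rewrite mxE.
- by apply: etrans (block_mxEdr _ _ _ _ _ _) _; rewrite mxE eqxx.
Qed.

Lemma det2E (K : comPzRingType) (A : 'M[K]_2) : \det A = A 0 0 * A 1 1 - A 0 1 * A 1 0.
Proof.
rewrite (expand_det_row _ 0) !big_ord_recl big_ord0 addr0 /cofactor !det_mx11 !mxE /=.
rewrite expr0 mul1r expr1 mulN1r mulrN.
by congr (A _ _ * A _ _ - A _ _ * A _ _); apply/val_inj.
Qed.

Definition plane_action (g : 'M[R]_3) k (u b : C) := forall V i,
  (g *m V) 2 i = sg k * V 2 i /\
  plane (g *m V) i = u * cj k (plane V i) + b * (V 2 i)%:C.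

(** Orthogonality expresses the second row of [A] by the first and the determinant, so [A] is
    multiplication by a unit number, preceded by conjugation when the determinant is -1. *)
Lemma G0_action (g : 'M[R]_3) : G0 g ->
  exists k u b, u * u^*%C = 1 /\ plane_action g k u b.
Proof.
move=> [A [b [AA gE]]]; subst g.
have [[g00 g01 g02] [g10 g11 g12] [g20 g21 g22]] := block3E A b (\det A).
set g := block_mx _ _ _ _ in g00 g01 g02 g10 g11 g12 g20 g21 g22 *.
have AAE i j := congr1 (fun M : 'M[R]_2 => M i j) AA.
have r0 : A 0 0 ^+ 2 + A 0 1 ^+ 2 = 1.
  by have := AAE 0 0; rewrite mulmx2E !mxE /= !expr2.
have r1 : A 1 0 ^+ 2 + A 1 1 ^+ 2 = 1.
  by have := AAE 1 1; rewrite mulmx2E !mxE /= !expr2.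
have r01 : A 0 0 * A 1 0 + A 0 1 * A 1 1 = 0.
  by have := AAE 0 1; rewrite mulmx2E !mxE /=.
set dt := \det A in g22.
have dE : dt = A 0 0 * A 1 1 - A 0 1 * A 1 0 by exact: det2E.
have d2 : dt ^+ 2 = 1.
  transitivity ((A 0 0 ^+ 2 + A 0 1 ^+ 2) * (A 1 0 ^+ 2 + A 1 1 ^+ 2) -
    (A 0 0 * A 1 0 + A 0 1 * A 1 1) ^+ 2); first by rewrite dE; ring.
  by rewrite r0 r1 r01 expr0n subr0 mulr1.
have A11 : A 1 1 = dt * A 0 0.
  transitivity ((A 0 0 ^+ 2 + A 0 1 ^+ 2) * A 1 1 - A 0 1 * (A 0 0 * A 1 0 + A 0 1 * A 1 1)).
    by rewrite r0 r01; ring.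
  by rewrite dE; ring.
have A10 : A 1 0 = - dt * A 0 1.
  transitivity ((A 0 0 ^+ 2 + A 0 1 ^+ 2) * A 1 0 - A 0 0 * (A 0 0 * A 1 0 + A 0 1 * A 1 1)).
    by rewrite r0 r01; ring.
  by rewrite dE; ring.
have [k kE] : exists k, dt = sg k.
  by move/eqP: d2; rewrite sqrf_eq1 => /orP[] /eqP->; [exists false|exists true].
exists k, (Complex (A 0 0) (- dt * A 0 1)), (Complex (b 0 0) (b 1 0)); split.
  apply: complex_ext => /=; last by ring.
  by rewrite -r0 -[A 0 1 ^+ 2]mul1r -d2; ring.
move=> V i; rewrite !mulmx3E g20 g21 g22 !mul0r !add0r kE; split=> //.
apply: complex_ext; rewrite /plane /= !mulmx3E ?g00 ?g01 ?g02 ?g10 ?g11 ?g12 ?A10 ?A11 ?kE;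
  by case: (k); rewrite /sg /=; ring.
Qed.

Lemma G0_of k (u b : C) : u * u^*%C = 1 -> exists g : 'M[R]_3, G0 g /\ plane_action g k u b.
Proof.
move=> u1; have r0 : Re u ^+ 2 + Im u ^+ 2 = 1.
  by move/(congr1 Re): u1; case: (u) => x y /= <-; ring.
pose A : 'M[R]_2 := mx2 (Re u) (- sg k * Im u) (Im u) (sg k * Re u).
pose B : 'cV[R]_2 := \col_i if i == 0 then Re b else Im b.
have dA : \det A = sg k.
  rewrite det2E !mxE /= -[RHS]mulr1 -r0; ring.
have GA : G0 (block_mx A B 0 (\det A)%:M).
  exists A, B; split=> //.
  have s2 := sgM (R := R) k.
  apply: mx2P; rewrite mulmx2E !mxE /=.
  - transitivity (Re u ^+ 2 + sg k * sg k * Im u ^+ 2); first by ring.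
    by rewrite s2 mul1r.
  - transitivity ((1 - sg k * sg k) * (Re u * Im u)); first by ring.
    by rewrite s2 subrr mul0r.
  - transitivity ((1 - sg k * sg k) * (Re u * Im u)); first by ring.
    by rewrite s2 subrr mul0r.
  - transitivity (sg k * sg k * Re u ^+ 2 + Im u ^+ 2); first by ring.
    by rewrite s2 mul1r.
move: (block3E A B (\det A)) GA; cbv zeta.
move: (block_mx A B 0 (\det A)%:M : 'M[R]_(2 + 1)) => g.
move=> [[g00 g01 g02] [g10 g11 g12] [g20 g21 g22]] Gg.
exists g; split=> //.
move=> V i; rewrite !mulmx3E g20 g21 g22 !mul0r !add0r dA; split=> //.
have [A00 A01 A10 A11] :
    [/\ A 0 0 = Re u, A 0 1 = - sg k * Im u, A 1 0 = Im u & A 1 1 = sg k * Re u].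
  by split; rewrite mxE.
have [B0 B1] : B 0 0 = Re b /\ B 1 0 = Im b by split; rewrite mxE.
apply: complex_ext; rewrite /plane !mulmx3E ?g00 ?g01 ?g02 ?g10 ?g11 ?g12
    ?A00 ?A01 ?A10 ?A11 ?B0 ?B1;
  by case: (u) => ux uy; case: (b) => bx b_y; case: (k); rewrite /sg /=; ring.
Qed.

(* The factor by which [gen_mx c 0] multiplies [x + i y] in the upper right entry. *)
Definition frame_scale : C := - ('i%C * sina%:C).

Lemma frame_scale_neq0 : frame_scale != 0.
Proof.
rewrite oppr_eq0 mulf_neq0 ?(sinaC_neq0 hc)//.
by rewrite eq_complex /= eqxx oner_eq0.
Qed.

(** The upper rows of the matrices [gen_mx c 0 (col i V)], in the coordinates of representations;
    the map is affine in [V]. *)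
Definition alpha_of V : 'rV[R]_N :=
  rep_pt (fun i => rot_c c (V 2 i)) (fun i => frame_scale * plane V i).

Lemma cj_rot_c k z : cj k (rot_c c z) = rot_c c (sg k * z).
Proof. by apply: complex_ext; rewrite ?Re_cj ?Im_cj//= mulrA. Qed.

Lemma rot_c_inj z z' : rot_c c z = rot_c c z' -> z = z'.
Proof. by case=> /(mulIf (sina_neq0 hc)). Qed.

Lemma cj_frame_scale k : cj k frame_scale = (sg k)%:C * frame_scale.
Proof.
rewrite /frame_scale; case: k; apply: complex_ext => /=; rewrite /sg; ring.
Qed.

(* In the frame coordinates [Im (rot_c c z) = z * sina], so the translation part
   [b] of an element of [G0] becomes the parameter [frame_scale * b / sina]. *)
Lemma alpha_step V V' k (u b : C) : u != 0 ->
  (forall i, V' 2 i = sg k * V 2 i /\ plane V' i = u * cj k (plane V i) + b * (V 2 i)%:C) ->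
  sim (alpha_of V) (alpha_of V').
Proof.
move=> u0 H; exists k, ((sg k)%:C * u), (frame_scale * b / sina%:C); split.
  by rewrite mulf_neq0// sgC_neq0.
move=> i; have [zE wE] := H i; rewrite !rot_at_pt !trans_at_pt zE wE cj_rot_c; split=> //.
rewrite cjM cj_frame_scale /=.
have sgC : (sg k)%:C * (sg k)%:C = 1 :> C by rewrite -rmorphM sgM.
rewrite [(V 2 i * sina)%:C]rmorphM.
transitivity (((sg k)%:C * (sg k)%:C) * (frame_scale * u * cj k (plane V i)) +
   frame_scale * b * (V 2 i)%:C * (sina%:C / sina%:C)); last by ring.
by rewrite sgC mul1r divff ?(sinaC_neq0 hc)// mulr1; ring.
Qed.

Lemma scale_snd a p k i : (scale a p).2 k i = (if k == 2 then 1 else a) * p.2 k i.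
Proof.
by rewrite /scale mul_diag_mx !mxE; have [->|->|->] := ord3P k.
Qed.

(** The two claims are proved together: the symmetric and transitive cases need the slice t = 0 to
    be preserved before similarities can be inverted or composed. *)
Lemma Rbar_equiv_sim p p' : Rbar_equiv p p' -> (p.1 = 0 <-> p'.1 = 0) /\
  (p.1 = 0 -> sim (alpha_of p.2) (alpha_of p'.2)).
Proof.
elim=> {p p'} [p p'|p|p p' _ [IH1 IH2]|p1 p2 p3 _ [IH1 IH2] _ [IH1' IH2']].
- case=> [[a a0 ->]|[g Gg ->]].
    split=> [|t0].
      split=> [/= ->|/= /eqP]; first by rewrite mul0r.
      by rewrite mulf_eq0 invr_eq0 expf_eq0 /= (gt_eqF a0) orbF => /eqP.
    apply: (@alpha_step _ _ false a%:C 0).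
      by rewrite (fmorph_eq0 (real_complex R)) gt_eqF.
    move=> i; rewrite !scale_snd /= mul0r addr0 mul1r; split; first by rewrite /sg ?mul1r.
    by rewrite /plane !scale_snd /=; apply: complex_ext => /=; ring.
  split=> // t0; move: Gg; rewrite /Gt t0 eqxx => /G0_action[k [u [b [u1 H]]]].
  apply: (@alpha_step _ _ k u b); last exact: H.
  by apply: contra_eq_neq u1 => ->; rewrite mul0r eq_sym oner_neq0.
- by split=> // _; exact: sim_refl.
- by split=> [|t0]; [exact: iff_sym|apply: sim_sym; apply: IH2; apply/IH1].
- split=> [|t0]; first exact: iff_trans IH1 IH1'.
  by apply: sim_trans (IH2 t0) (IH2' _); apply/IH1.
Qed.

(** A similarity is the dilation by the modulus of [l], which is the scaling action, followed by an
    isometry, which comes from [G0]. *)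
Lemma sim_Rbar_equiv V V' : sim (alpha_of V) (alpha_of V') ->
  Rbar_equiv (0, V) (0, V').
Proof.
move=> [k [l [m [l0 a]]]].
pose r := Normc.normc l.
have r0 : 0 < r.
  rewrite lt_def; apply/andP; split; last by rewrite /r; case: (l) => x y; rewrite sqrtr_ge0.
  by apply: contra l0 => /eqP/Normc.eq0_normc ->.
have rC0 : r%:C != 0 :> C by rewrite (fmorph_eq0 (real_complex R)) gt_eqF.
have lJ : l * l^*%C = r%:C * r%:C.
  rewrite -sqr_normc -expr2; congr (_ ^+ 2).
(* The sign compensates the one that conjugation produces in [frame_scale]; dividing by [r] leaves
   modulus 1. *)
pose u := (sg k)%:C * l / r%:C.
have sgC : (sg k)%:C * (sg k)%:C = 1 :> C by rewrite -rmorphM sgM.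
have u1 : u * u^*%C = 1.
  have -> : u^*%C = (sg k)%:C * l^*%C / r%:C.
    by rewrite -[LHS]/(cj true u) /u -fmorphV !cjM !cjr.
  rewrite /u [LHS](_ : _ = ((sg k)%:C * (sg k)%:C) * (l * l^*%C) / (r%:C * r%:C)); last by field.
  by rewrite sgC mul1r lJ divff// mulf_neq0.
have [g [Gg gE]] := G0_of k (m * sina%:C / frame_scale) u1.
apply: (@rst_trans _ _ _ (scale r (0, V))).
  by apply: rst_step; left; exists r.
apply: rst_step; right; exists g.
  by rewrite /Gt /scale /= mul0r eqxx.
rewrite /scale /= mul0r; congr pair; apply/matrixP => x i.
set W := diag_mx _ *m V.
have WE y : W y i = (if y == 2 then 1 else r) * V y i := @scale_snd r (0, V) y i.
have [z1 w1] := gE W i; have [rE tE] := a i.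
have z2 : V' 2 i = (g *m W) 2 i.
  rewrite z1 WE /= mul1r; apply: rot_c_inj.
  by move: rE; rewrite !rot_at_pt cj_rot_c.
have w2 : plane V' i = plane (g *m W) i.
  apply: (mulfI frame_scale_neq0); move: tE; rewrite !trans_at_pt !rot_at_pt => ->.
  rewrite w1 WE /= mul1r cjM cj_frame_scale [(V 2 i * sina)%:C]rmorphM.
  have -> : plane W i = r%:C * plane V i.
    by apply: complex_ext; rewrite /plane !WE /=; ring.
  rewrite cjM cjr /u.
  rewrite [RHS](_ : _ = (sg k)%:C * l * frame_scale * cj k (plane V i) * (r%:C / r%:C) +
     m * sina%:C * (V 2 i)%:C * (frame_scale / frame_scale)); last by ring.
  by rewrite !divff ?frame_scale_neq0// !mulr1; ring.
case: w2 => w20 w21.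
by have [->|->|->] := ord3P x.
Qed.

End Degenerate.

(** * Diffeomorphisms of quotients induced by smooth ambient maps *)

Section QuotientDiffeomorphism.
Context {R : realType} {T T' : Type} {m m' k d d' : nat}.
Variables (M : set T) (e : T -> 'rV[R]_m) (E : T -> T -> Prop).
Variables (M' : set T') (e' : T' -> 'rV[R]_m') (E' : T' -> T' -> Prop).
Variable A : set (chart R (set T) d).
Hypothesis hA : quotient_structure M (embedded_atlas (k := k) e M) E A.
Local Notation q := (eclass M E).
Local Notation q' := (eclass M' E').
Local Notation good' := (good_chart (d := d') M' e' E').
Variables (Z : set (set T)) (Phi : set T -> set T').
Variables (al : 'rV[R]_m -> 'rV[R]_m') (be : 'rV[R]_m' -> 'rV[R]_m).
Hypotheses (sal : smooth_on setT al) (sbe : smooth_on setT be).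
Hypothesis ZM : Z `<=` quotient M E.
Hypothesis Phi_al : forall p, M p -> Z (q p) ->
  exists rho, [/\ M' rho, e' rho = al (e p) & Phi (q p) = q' rho].
Hypothesis Phi_be : forall rho, M' rho ->
  exists p, [/\ M p, Z (q p), e p = be (e' rho) & Phi (q p) = q' rho].
Hypothesis Phi_inj : forall y y', Z y -> Z y' -> Phi y = Phi y' -> y = y'.
Hypothesis cov' : forall rho, M' rho -> exists2 b, good' b & cdom b (q' rho).

(** The transition is the section belonging to [a], then [al], then the ambient expression of
    [b]. *)
Lemma local_transition a b y : A a -> good' b -> Z y -> cdom a y -> cdom b (Phi y) ->
  exists O F, [/\ O (a y), smooth_on O F & forall y', Z y' -> cdom a y' -> O (a y') ->
    cdom b (Phi y') /\ b (Phi y') = F (a y')].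
Proof.
move=> Aa gb Zy ay byP; have ga := structure_good hA Aa.
have [p Mp py] := quotient_repr (ZM Zy); subst y.
have [rho [Mr rE PE]] := Phi_al Mp Zy.
have [_ _ [W [G [Oa sG GE GP]]]] := ga.2 _ Mp ay.
rewrite PE in byP.
have [_ [N [H [Nr sH HP]]] _] := gb.2 _ Mr byP.
have s1 := smooth_on_comp sG sal.
exists ((W `&` G @^-1` setT) `&` (al \o G) @^-1` N), (H \o (al \o G)); split.
- by split; [split|rewrite /= GE -rE].
- exact: smooth_on_comp s1 sH.
- move=> y' Zy' ay' [[Oy' _] Ny'].
  have [p' [Mp' eE aP aE]] := GP _ Oy'.
  have y'E : y' = q p' by apply: (chart_inj ga.1 ay' aP).
  subst y'; have [rho' [Mr' rE' ->]] := Phi_al Mp' Zy'.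
  have Nr' : N (e' rho') by rewrite rE' eE.
  by have [? ->] := HP _ Mr' Nr'; rewrite /= rE' eE.
Qed.

Lemma local_transition_inv a b y : A a -> good' b -> Z y -> cdom a y -> cdom b (Phi y) ->
  exists O F, [/\ O (b (Phi y)), smooth_on O F & forall y', Z y' -> cdom b (Phi y') ->
    O (b (Phi y')) -> cdom a y' /\ a y' = F (b (Phi y'))].
Proof.
move=> Aa gb Zy ay byP; have ga := structure_good hA Aa.
have [rho Mr rE] : exists2 rho, M' rho & Phi y = q' rho.
  have [p Mp py] := quotient_repr (ZM Zy); subst y.
  by have [rho [Mr _ ->]] := Phi_al Mp Zy; exists rho.
have [p [Mp Zp pE PE]] := Phi_be Mr.
have yE : y = q p by apply: Phi_inj => //; rewrite rE PE.
subst y; rewrite PE in byP *.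
have [_ _ [W [G [Ob sG GE GP]]]] := gb.2 _ Mr byP.
have [_ [N [H [Np sH HP]]] _] := ga.2 _ Mp ay.
have s1 := smooth_on_comp sG sbe.
exists ((W `&` G @^-1` setT) `&` (be \o G) @^-1` N), (H \o (be \o G)); split.
- by split; [split|rewrite /= GE -pE].
- exact: smooth_on_comp s1 sH.
- move=> y' Zy' by' [[Oy' _] Ny'].
  have [rho' [Mr' eE bP bE]] := GP _ Oy'.
  have PE' : Phi y' = q' rho' by apply: (chart_inj gb.1 by' bP).
  have [p' [Mp' Zp' pE' PpE]] := Phi_be Mr'.
  have y'E : y' = q p' by apply: Phi_inj => //; rewrite PE' PpE.
  subst y'; have Np' : N (e p') by rewrite pE' eE.
  by have [? ->] := HP _ Mp' Np'; rewrite /= pE' eE.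
Qed.

Definition pull_chart (b : chart R (set T') d') : chart R (set T) d' :=
  Chart (Z `&` Phi @^-1` cdom b) (b \o Phi).

Lemma Phi_surj y' : quotient M' E' y' -> exists2 y, Z y & Phi y = y'.
Proof.
move=> /quotient_repr[rho Mr <-]; have [p [_ Zp _ PE]] := Phi_be Mr.
by exists (q p).
Qed.

Lemma pull_chart_image b : good' b ->
  pull_chart b @` cdom (pull_chart b) = b @` cdom b.
Proof.
move=> gb; rewrite eqEsubset; split=> [_ [y [Zy yb] <-]|_ [y' y'b <-]].
  by exists (Phi y).
have [bM _ _] := gb.1; have [y Zy yE] := Phi_surj (bM _ y'b); subst y'.
by exists y.
Qed.

(** The submanifold structure of [Z] is produced here: pulled-back target charts are related to the
    charts of [A] by the two transition lemmas. *)
Lemma pull_chart_submfd b : good' b -> submfd_atlas A Z (pull_chart b).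
Proof.
move=> gb; split.
  split; first by move=> y [].
    move=> y y'; rewrite !inE => -[Zy yb] [Zy' yb'] bE; apply: Phi_inj => //.
    exact: (chart_inj gb.1 yb yb' bE).
  by rewrite pull_chart_image//; have [_ _] := gb.1.
move=> y [Zy yb]; have [[_ cov _ _ _] _] := hA.
have [a Aa ay] := cov _ (ZM Zy); exists a; split=> //; split=> //.
- have [W [F [Oa sF FP]]] := local_transition Aa gb Zy ay yb.
  exists W; split=> //; first exact: sF.1.
  by move=> y' Zy' ay' Oy'; split=> //; have [] := FP _ Zy' ay' Oy'.
- move=> y1 [[Zy1 yb1] ay1].
  have [W [F [Oa sF FP]]] := local_transition_inv Aa gb Zy1 ay1 yb1.
  exists W, F; split=> // y' [[Zy' yb'] ay'] Oy'.
  by have [_ ->] := FP _ Zy' yb' Oy'.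
- move=> y1 [[Zy1 yb1] ay1].
  have [W [F [Oa sF FP]]] := local_transition Aa gb Zy1 ay1 yb1.
  exists W, F; split=> // y' [[Zy' yb'] ay'] Oy'.
  by have [_ <-] := FP _ Zy' ay' Oy'.
Qed.

(** Read in [pull_chart b] and [b], the map [Phi] and its inverse are both the identity. *)
Lemma quotient_diffeomorphism :
  diffeomorphism Z (submfd_atlas (k := d') A Z) (quotient M' E') good' Phi.
Proof.
have PhiM y : Z y -> exists2 rho, M' rho & Phi y = q' rho.
  move=> Zy; have [p Mp py] := quotient_repr (ZM Zy); subst y.
  by have [rho [Mr _ ->]] := Phi_al Mp Zy; exists rho.
pose g y' := xget set0 [set y | Z y /\ Phi y = y'].
have gP y' : quotient M' E' y' -> Z (g y') /\ Phi (g y') = y'.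
  move=> /Phi_surj[y Zy yE].
  exact: (xgetPex set0 (ex_intro (fun y => Z y /\ Phi y = y') y (conj Zy yE))).
have sid b : good' b -> smooth_on (b @` cdom b) id.
  by move=> gb; apply: smooth_on_id; have [_ _] := gb.1.
split.
- split.
  + by move=> y /PhiM[rho Mr ->]; exists rho.
  + by move=> y y'; rewrite !inE; exact: Phi_inj.
  + by move=> y' /Phi_surj[y Zy <-]; exists y.
- move=> y Zy; have [rho Mr PE] := PhiM _ Zy; have [b gb br] := cov' Mr.
  exists (pull_chart b), b, id; split=> //.
  + exact: pull_chart_submfd.
  + by split=> //=; rewrite PE.
  + split=> //; first by move=> _ [y' [_ ?] <-].
    by rewrite pull_chart_image//; exact: sid.
- exists g; split.
    move=> y; rewrite inE => Zy; have [rho Mr PE] := PhiM _ Zy.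
    have QP : quotient M' E' (Phi y) by exists rho.
    by have [? ?] := gP _ QP; exact: Phi_inj.
  move=> _ /quotient_repr[rho Mr <-]; have [b gb br] := cov' Mr.
  exists b, (pull_chart b), id; split=> //.
    exact: pull_chart_submfd.
  have [bM _ _] := gb.1; split=> //.
  + by move=> _ [y' y'b <-]; have [? PE] := gP _ (bM _ y'b); split=> //=; rewrite PE.
  + exact: sid.
  + by move=> y' y'b /=; have [_ ->] := gP _ (bM _ y'b).
Qed.

End QuotientDiffeomorphism.

(** * Reducible characters *)

Section SL2Group.
Context {R : realType}.
Local Notation C := R[i].

(** [free_on] ranges over group types; making SL_2 one allows representations that agree on the
    generators to be identified. *)
Record SL2 := MkSL2 { SL2mx :> 'M[C]_2 ; _ : \det SL2mx == 1 }.

HB.instance Definition _ := [isSub for SL2mx].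
HB.instance Definition _ := [Choice of SL2 by <:].

Implicit Types A B : SL2.

Lemma det_SL2 A : \det A = 1. Proof. by case: A => A /= /eqP. Qed.

Lemma unit_SL2 A : SL2mx A \in unitmx. Proof. by rewrite unitmxE det_SL2 unitr1. Qed.

Lemma SL2_oneP : \det (1%:M : 'M[C]_2) == 1. Proof. by rewrite det1. Qed.

Lemma SL2_mulP A B : \det (SL2mx A *m SL2mx B) == 1.
Proof. by rewrite det_mulmx !det_SL2 mulr1. Qed.

Lemma SL2_invP A : \det (invmx (SL2mx A)) == 1.
Proof. by rewrite det_inv det_SL2 invr1. Qed.

Definition SL2_mul A B := MkSL2 (SL2_mulP A B).
Definition SL2_inv A := MkSL2 (SL2_invP A).

Lemma SL2_mulA : associative SL2_mul.
Proof. by move=> A B D; apply/val_inj; rewrite /= mulmxA. Qed.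

Lemma SL2_mul1 : left_id (MkSL2 SL2_oneP) SL2_mul.
Proof. by move=> A; apply/val_inj; rewrite /= mul1mx. Qed.

Lemma SL2_mulr1 : right_id (MkSL2 SL2_oneP) SL2_mul.
Proof. by move=> A; apply/val_inj; rewrite /= mulmx1. Qed.

Lemma SL2_mulV : left_inverse (MkSL2 SL2_oneP) SL2_inv SL2_mul.
Proof. by move=> A; apply/val_inj; rewrite /= mulVmx// unit_SL2. Qed.

Lemma SL2_mulVr : right_inverse (MkSL2 SL2_oneP) SL2_inv SL2_mul.
Proof. by move=> A; apply/val_inj; rewrite /= mulmxV// unit_SL2. Qed.

HB.instance Definition _ :=
  isGroup.Build SL2 SL2_mulA SL2_mul1 SL2_mulr1 SL2_mulV SL2_mulVr.

Lemma SL2_rep_eq (F : groupType) n (s : 'I_n -> F) (rho rho' : F -> 'M[C]_2) :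
  free_on s -> SL2_rep rho -> SL2_rep rho' -> (forall i, rho (s i) = rho' (s i)) ->
  rho = rho'.
Proof.
move=> hF [d1 _ m1] [d2 _ m2] E.
pose h x := MkSL2 (introT eqP (d1 x)); pose h' x := MkSL2 (introT eqP (d2 x)).
have [g [_ gu]] := hF SL2 (fun i => h (s i)).
have gh : g = h by apply: gu; split=> // x y; apply/val_inj; exact: m1.
have gh' : g = h'.
  apply: gu; split=> [x y|i]; first by apply/val_inj; exact: m2.
  by apply/val_inj; rewrite /= E.
by apply/funext => x; rewrite -[LHS]/(SL2mx (h x)) -gh gh'.
Qed.

End SL2Group.

Section ReducibleTraces.
Context {R : realType}.
Local Notation C := R[i].

Lemma trace2E (K : pzRingType) (A : 'M[K]_2) : \tr A = A 0 0 + A 1 1.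
Proof.
rewrite /mxtrace !big_ord_recl big_ord0 addr0.
by congr (A _ _ + A _ _); apply/val_inj.
Qed.

Lemma eigen2 (K : fieldType) (A : 'M[K]_2) (u : 'cV[K]_2) k : u != 0 -> A *m u = k *: u ->
  k ^+ 2 - \tr A * k + \det A = 0.
Proof.
move=> u0 Au; have : \det (A - k%:M) *: u = 0.
  by rewrite -mul_scalar_mx -mul_adj_mx -mulmxA mulmxBl Au mul_scalar_mx subrr mulmx0.
move/eqP; rewrite scaler_eq0 (negPf u0) orbF => /eqP <-.
by rewrite !det2E trace2E !mxE /= ?mulr1n ?mulr0n; ring.
Qed.

(** The eigenvalues [k], [l] on the common eigenvector are roots of the same polynomial T^2 - x T +
    1, so l = k or k l = 1. The product has the eigenvalue k^2 or 1, and its determinant 1 then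
    fixes its trace. *)
Lemma common_eigen2_trace (K : fieldType) (A B : 'M[K]_2) (u : 'cV[K]_2) (x k l : K) :
  u != 0 -> A *m u = k *: u -> B *m u = l *: u -> \det A = 1 -> \det B = 1 ->
  \tr A = x -> \tr B = x -> \tr (A *m B) = 2 \/ \tr (A *m B) = x ^+ 2 - 2.
Proof.
move=> u0 Au Bu dA dB tA tB.
have := eigen2 u0 Au; rewrite dA tA => kE.
have := eigen2 u0 Bu; rewrite dB tB => lE.
have ABu : (A *m B) *m u = (k * l) *: u by rewrite -mulmxA Bu -scalemxAr Au scalerA mulrC.
have := eigen2 u0 ABu; rewrite det_mulmx dA dB mulr1; set T := \tr _ => TE.
have : (k - l) * (k + l - x) = 0.
  by rewrite -[RHS](subrr (0 : K)) -{1}kE -lE; ring.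
move/eqP; rewrite mulf_eq0 !subr_eq0 => /orP[/eqP kl|/eqP kl]; [right|left].
  subst l; have k0 : k * k != 0.
    rewrite mulf_eq0 orbb; apply: contra_eq_neq kE => ->.
    by rewrite expr0n mulr0 subr0 add0r oner_neq0.
  apply: (mulIf k0); apply/eqP; rewrite -subr_eq0; apply/eqP.
  (* k^4 - (x^2 - 2) k^2 + 1 factors as (k^2 - x k + 1) (k^2 + x k + 1). *)
  transitivity (- ((k * k) ^+ 2 - T * (k * k) + 1) +
    (k ^+ 2 - x * k + 1) * (k ^+ 2 + x * k + 1)); first by ring.
  by rewrite TE kE mul0r oppr0 addr0.
have lE' : l = x - k by rewrite -kl addrC addKr.
have k1 : k * l = 1.
  apply/eqP; rewrite -subr_eq0; apply/eqP; rewrite lE'.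
  by rewrite -[RHS]oppr0 -kE; ring.
apply/eqP; rewrite -subr_eq0; apply/eqP; rewrite -[RHS]oppr0 -TE k1; ring.
Qed.

Lemma reducible_trace (F : groupType) (rho : F -> 'M[C]_2) x y t :
  SL2_rep rho -> reducible rho -> \tr (rho x) = t -> \tr (rho y) = t ->
  \tr (rho (x * y)%g) = 2 \/ \tr (rho (x * y)%g) = t ^+ 2 - 2.
Proof.
move=> [d _ m] [u u0 H] tx ty; rewrite m.
have [k Hk] := H x; have [l Hl] := H y.
exact: (common_eigen2_trace u0 Hk Hl).
Qed.

Definition Bpair (t : R) (v w : 'cV[R]_3) : R :=
  t * (v 0 0 * w 0 0 + v 1 0 * w 1 0) + v 2 0 * w 2 0.

(* The Gram determinant of [v, w] is [t (P^2 + Q^2 + t D^2)], with [P, Q, D] the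
   entries of the cross product. *)
Lemma Bpair_sqr1 (t : R) (v w : 'cV[R]_3) : t != 0 -> Bform t v = 1 -> Bform t w = 1 ->
  Bpair t v w ^+ 2 = 1 -> v = w \/ v = - w.
Proof.
move=> t0; rewrite /Bform /Bpair.
have cV3 (a b : 'cV[R]_3) : a 0 0 = b 0 0 -> a 1 0 = b 1 0 -> a 2 0 = b 2 0 -> a = b.
  move=> e0 e1 e2; apply/matrixP => i j; rewrite !ord1.
  by have [->|->|->] := ord3P i.
have vwE : v = w <-> [/\ v 0 0 = w 0 0, v 1 0 = w 1 0 & v 2 0 = w 2 0].
  by split=> [->|[]] //; exact: cV3.
have vwN : v = - w <-> [/\ v 0 0 = - w 0 0, v 1 0 = - w 1 0 & v 2 0 = - w 2 0].
  by split=> [->|[*]]; [rewrite !mxE|apply: cV3; rewrite mxE].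
rewrite vwE vwN.
move: (v 0 0) (v 1 0) (v 2 0) (w 0 0) (w 1 0) (w 2 0) => x y z x' y' z' vE wE bE.
pose P := x * z' - x' * z; pose Q := y * z' - y' * z; pose D := x * y' - x' * y.
have S0 : P ^+ 2 + Q ^+ 2 + t * D ^+ 2 = 0.
  apply: (mulfI t0); rewrite mulr0.
  transitivity ((t * (x ^+ 2 + y ^+ 2) + z ^+ 2) * (t * (x' ^+ 2 + y' ^+ 2) + z' ^+ 2) -
    (t * (x * x' + y * y') + z * z') ^+ 2); first by rewrite /P /Q /D; ring.
  by rewrite vE wE bE mulr1 subrr.
have zD : z * D = y * P - x * Q by rewrite /P /Q /D; ring.
(* For t > 0 this is immediate from [S0], but for t < 0 the form is indefinite. Whatever the sign,
   (x P + y Q)^2 = (x^2 + y^2) (P^2 + Q^2) - (z D)^2 = - D^2. *)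
have D0 : D = 0.
  have : (z ^+ 2 - 1) * D ^+ 2 = (x ^+ 2 + y ^+ 2) * (P ^+ 2 + Q ^+ 2).
    have -> : P ^+ 2 + Q ^+ 2 = - (t * D ^+ 2).
      by apply/eqP; rewrite -subr_eq0 opprK S0.
    rewrite -vE; ring.
  have : 0 <= (x * P + y * Q) ^+ 2 by exact: sqr_ge0.
  have -> : (x * P + y * Q) ^+ 2 = (x ^+ 2 + y ^+ 2) * (P ^+ 2 + Q ^+ 2) - (z * D) ^+ 2.
    by rewrite zD; ring.
  move=> + E; rewrite -E => H.
  have : D ^+ 2 <= 0 by move: H; rewrite exprMn; nra.
  by move=> D0; apply/eqP; rewrite -sqrf_eq0 eq_le D0 sqr_ge0.
have PQ : P ^+ 2 + Q ^+ 2 = 0 by rewrite -S0 D0 expr0n mulr0 addr0.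
have P0 : P = 0.
  have := sqr_ge0 Q; have := sqr_ge0 P => p q; apply/eqP; rewrite -sqrf_eq0 eq_le p andbT; lra.
have Q0 : Q = 0.
  by apply/eqP; rewrite -sqrf_eq0 -PQ P0 expr0n add0r.
set b := t * _ + _ in bE.
have xE : x' = b * x.
  transitivity ((t * (x ^+ 2 + y ^+ 2) + z ^+ 2) * x' + t * (y * D) + z * P).
    by rewrite vE D0 P0; ring.
  by rewrite /P /D /b; ring.
have yE : y' = b * y.
  transitivity ((t * (x ^+ 2 + y ^+ 2) + z ^+ 2) * y' - t * (x * D) + z * Q).
    by rewrite vE D0 Q0; ring.
  by rewrite /Q /D /b; ring.
have zE : z' = b * z.
  transitivity ((t * (x ^+ 2 + y ^+ 2) + z ^+ 2) * z' - t * (x * P + y * Q)).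
    by rewrite vE P0 Q0; ring.
  by rewrite /P /Q /b; ring.
move/eqP: bE; rewrite sqrf_eq1 => /orP[] /eqP bE; [left|right];
  by rewrite xE yE zE bE; split; ring.
Qed.

Lemma gen_mxE (c t : R) v : -2 < c < 2 -> gen_mx c t v = mx2 ((c / 2) +i* (sina c * v 2 0))
  ((sina c)%:C * ('i%C * - (v 0 0 +i* v 1 0)))
  ((sina c)%:C * ('i%C * - (t%:C * (v 0 0 -i* v 1 0))))
  ((c / 2) -i* (sina c * v 2 0)).
Proof.
move=> hc; rewrite /gen_mx acosK; last by rewrite in_itv /=; apply/andP; split; lra.
rewrite sin_acos; last by apply/andP; split; lra.
by apply: mx2P; rewrite !mxE /=; apply: complex_ext => /=; rewrite /sina; ring.
Qed.

Lemma trace_gen_mx (c t : R) v : -2 < c < 2 -> \tr (gen_mx c t v) = c%:C.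
Proof.
move=> hc; rewrite trace2E gen_mxE// !mxE /=; apply: complex_ext => /=; last by ring.
by field.
Qed.

Lemma trace_gen_mxM (c t : R) v w : -2 < c < 2 ->
  \tr (gen_mx c t v *m gen_mx c t w) =
    (c ^+ 2 / 2 - 2 * sina c ^+ 2 * Bpair t v w)%:C.
Proof.
move=> hc; rewrite trace2E !mulmx2E !gen_mxE// !mxE /= /Bpair.
by apply: complex_ext => /=; field.
Qed.

End ReducibleTraces.

Section ZeroSlice.
Context {R : realType} {F : groupType} {n : nat}.
Variables (c : R) (s : 'I_n -> F).
Hypotheses (hc : -2 < c < 2) (hF : free_on s).
Variable (i0 : 'I_n).
Local Notation C := R[i].
Local Notation Re := (@complex.Re R).
Local Notation Im := (@complex.Im R).
Local Notation kap := (kap c).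
Local Notation wt := (wt c).
Local Notation sina := (sina c).
Local Notation rep := (rep_coord s).
Local Notation M := (RcU0 c s).
Local Notation E := (@AutU0_equiv R F).
Local Notation frame_scale := (frame_scale c).
Local Notation alpha_of := (alpha_of c).
Implicit Types (rho : F -> U0 R) (X : 'rV[R]_(n * (2 * 2 + 2 * 2))).
Implicit Types (V : 'M[R]_(3, n)) (p : R * 'M[R]_(3, n)).

Lemma kap_alpha V i : kap (alpha_of V) i = V 2 i.
Proof. by rewrite /kap rot_at_pt /= mulfK// sina_neq0. Qed.

Lemma wt_alpha V i : wt (alpha_of V) i = frame_scale * ((V 2 i)%:C * plane V i).
Proof. by rewrite /wt kap_alpha trans_at_pt mulrCA. Qed.

(** The product is the plane part of whichever of v_i, - v_i has third coordinate 1. So the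
    nondegeneracy in [Rbar] matches the points [wt] not all coinciding. *)
Lemma col_eq_pm V i j : V 2 i ^+ 2 = 1 -> V 2 j ^+ 2 = 1 ->
  (col i V = col j V \/ col i V = - col j V) <->
  (V 2 i)%:C * plane V i = (V 2 j)%:C * plane V j.
Proof.
move=> i1 j1.
have cE : col i V = col j V <-> forall k, V k i = V k j.
  split=> [H k|H].
    by have := congr1 (fun v : 'cV[R]_3 => v k 0) H; rewrite !mxE.
  by apply/matrixP => k l; rewrite !mxE.
have cN : col i V = - col j V <-> forall k, V k i = - V k j.
  split=> [H k|H].
    by have := congr1 (fun v : 'cV[R]_3 => v k 0) H; rewrite !mxE.
  by apply/matrixP => k l; rewrite !mxE.
rewrite cE cN; split=> [[] H|].
- by rewrite /plane !H.
- by rewrite /plane !H; apply: complex_ext => /=; ring.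
- move=> [] /=; rewrite !mul0r !subr0 !addr0 => e0 e1.
  by move: e0 e1; move/eqP: i1; rewrite sqrf_eq1 => /orP[]/eqP zi;
    move/eqP: j1; rewrite sqrf_eq1 => /orP[]/eqP zj; rewrite zi zj => e0 e1;
    [left|right|right|left] => k; have [->|->|->] := ord3P k; lra.
Qed.

Lemma Rbar0P V : Rbar (0, V) <-> (forall i, V 2 i ^+ 2 = 1) /\
  exists k, wt (alpha_of V) k != wt (alpha_of V) i0.
Proof.
have B0 i : Bform 0 (col i V) = V 2 i ^+ 2 by rewrite /Bform !mxE mul0r add0r.
have wE i j : V 2 i ^+ 2 = 1 -> V 2 j ^+ 2 = 1 ->
    wt (alpha_of V) i = wt (alpha_of V) j <-> (col i V = col j V \/ col i V = - col j V).
  move=> i1 j1; rewrite col_eq_pm// !wt_alpha.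
  by split=> [/(mulfI (frame_scale_neq0 hc))|->].
split=> [[H [i [j [n1 n2]]]]|[H [k wk]]].
  have H1 l : V 2 l ^+ 2 = 1 by rewrite -B0; exact: H.
  split=> //; apply: contrapT => nk.
  have wc l : wt (alpha_of V) l = wt (alpha_of V) i0.
    by apply/eqP; rewrite -[_ == _]negbK; apply/negP => wl; apply: nk; exists l.
  by have [] : col i V = col j V \/ col i V = - col j V by apply/wE => //; rewrite !wc.
split=> [i|]; first by rewrite B0.
exists k, i0; split=> H'; move/eqP: wk; apply; apply/wE => //; [left|right]; exact: H'.
Qed.

Lemma alpha_realize V : Rbar (0, V) -> exists rho, M rho /\ rep rho = alpha_of V.
Proof.
move=> /Rbar0P[V1 [k wk]].
have [rho [rM rE]] := rep_pt_realize hF (a := fun i => rot_c c (V 2 i))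
  (fun i => frame_scale * plane V i) (fun i => rot_cJ hc (V1 i)).
exists rho; split; last exact: rE.
apply/(RcU0P hc hF i0); split; last by exists k; rewrite rE.
split=> // i; apply/trace_eq_c.
by rewrite -(rot_at_coord s) rE rot_at_pt.
Qed.

Lemma alpha_gen V rho i : V 2 i ^+ 2 = 1 -> rep rho = alpha_of V ->
  U0mx (rho (s i)) = gen_mx c 0 (col i V).
Proof.
move=> V1 rE; rewrite U0mxE -(rot_at_coord s) -(trans_at_coord s) rE rot_at_pt trans_at_pt.
by rewrite gen_mxE// !mxE; apply: mx2P; rewrite !mxE /=; apply: complex_ext => /=; ring.
Qed.

Definition beta_of X : 'M[R]_(3, n) := \matrix_(k, i)
  if k == 2 then kap X i
  else if k == 0 then Re (trans_at X i / frame_scale) else Im (trans_at X i / frame_scale).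

Lemma plane_beta X i : plane (beta_of X) i = trans_at X i / frame_scale.
Proof. by rewrite /plane !mxE; exact: complex_ext. Qed.

Lemma alpha_beta rho : M rho -> alpha_of (beta_of (rep rho)) = rep rho.
Proof.
move=> Mr; have rc := RcU0_c_rep Mr; apply: esym; apply: rep_coord_pt => i.
  rewrite -(rot_at_coord s) (rot_at_kap hc); last exact: c_rep_Re.
  by rewrite mxE.
by rewrite -(trans_at_coord s) plane_beta mulrC divfK// frame_scale_neq0.
Qed.

Lemma Rbar_beta rho : M rho -> Rbar (0, beta_of (rep rho)).
Proof.
move=> Mr; apply/Rbar0P; split=> [i|]; first by rewrite mxE /= (RcU0_kap hc).
by rewrite alpha_beta//; have [_] := (RcU0P hc hF i0 rho).1 Mr.
Qed.

Definition alpha_coord (Y : 'rV[R]_(1 + 3 * n)) := alpha_of (vec_mx (rsubmx Y)).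
Definition beta_coord X : 'rV[R]_(1 + 3 * n) := Rbar_coord (0, beta_of X).

Lemma alpha_coordE p : alpha_coord (Rbar_coord p) = alpha_of p.2.
Proof. by rewrite /alpha_coord /Rbar_coord row_mxKr mxvecK. Qed.

Lemma smooth_alpha_coord : smooth_on setT alpha_coord.
Proof.
have oT := @openT 'rV[R]_(1 + 3 * n).
have sV k i : smooth_on setT (fun Y : 'rV[R]_(1 + 3 * n) =>
    (vec_mx (rsubmx Y) : 'M[R]_(3, n)) k i).
  apply: smooth_on_eq (smooth_on_coord 0 (rshift 1 (mxvec_index k i)) oT) => Y _.
  by rewrite !mxE.
apply: smooth_rep_pt => // i.
  split; first exact: smooth_on_cst.
  by apply: smooth_onM; [exact: sV|exact: smooth_on_cst].
by apply: csmoothM; [exact: csmooth_cst|split; exact: sV].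
Qed.

Lemma smooth_beta_coord : smooth_on setT beta_coord.
Proof.
have oT := @openT 'rV[R]_(n * (2 * 2 + 2 * 2)).
apply: smooth_on_mx => // i l; rewrite ord1; case: (split_ordP l) => {}l ->.
  apply: smooth_on_eq (smooth_on_cst 0 oT) => X _.
  by rewrite row_mxEl !mxE /= mul0rn.
move: l; apply: mxvec_ind => k j.
have [sr si] : csmooth setT (fun X : 'rV[R]_(n * (2 * 2 + 2 * 2)) =>
    trans_at X j / frame_scale).
  by apply: csmoothM; [exact: csmooth_rep_entry|exact: csmooth_cst].
have [->|->|->] := ord3P k.
- by apply: smooth_on_eq sr => X _; rewrite row_mxEr mxvecE mxE.
- by apply: smooth_on_eq si => X _; rewrite row_mxEr mxvecE mxE.
- apply: smooth_on_eq (csmooth_kap c j oT) => X _.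
  by rewrite row_mxEr mxvecE mxE.
Qed.

Lemma RcU0_equivP rho rho' : M rho -> M rho' -> E rho rho' <-> sim (rep rho) (rep rho').
Proof. by move=> Mr Mr'; exact (AutU0_equivP hF (RcU0_morph Mr) (RcU0_morph Mr')). Qed.

Lemma U0_SL2_rep rho : {morph rho : x y / (x * y)%g} -> SL2_rep (fun x => U0mx (rho x)).
Proof.
move=> rM; have r1 : rho 1%g = 1%g.
  by apply: (mulIg (rho 1%g)); rewrite -rM !mul1g.
split=> [x| |x y]; last by rewrite rM.
  by rewrite U0mxE det2E !mxE /= mulr0 subr0 rotJ.
by rewrite r1.
Qed.

Lemma U0_reducible rho : reducible (fun x => U0mx (rho x)).
Proof.
exists (delta_mx 0 0); first by apply/eqP => /matrixP/(_ 0 0)/eqP; rewrite !mxE oner_eq0.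
move=> x; exists (rot (rho x)); apply/matrixP => i j; rewrite !ord1 U0mxE.
rewrite !mxE !big_ord_recl big_ord0 !mxE /= mulr1 !mulr0 !addr0.
by have [->|->] : i = 0 \/ i = 1;
  [case: (i) => [[|[|//]] h]; [left|right]; exact/val_inj|rewrite /= ?mulr1|rewrite /= ?mulr0].
Qed.

Lemma sim_character rho rho' : M rho -> M rho' -> sim (rep rho) (rep rho') ->
  U0_character rho' = U0_character rho.
Proof.
move=> Mr Mr' /(RcU0_equivP Mr Mr')[g /AutU0P[k [l [m [l0 ->]]]] ->].
by apply/funext => x; rewrite /U0_character /character !trace_U0 /= rot_aut Re_cj.
Qed.

(** [rho'] shares only its character with [rho]; the traces at [s i], [s j] and their product
    already suffice. *)
Lemma nonzero_slice_irreducible p (rho rho' : F -> 'M[C]_2) : Rbar p -> p.1 != 0 ->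
  SL2_rep rho -> (forall i, rho (s i) = gen_mx c p.1 (col i p.2)) ->
  SL2_rep rho' -> reducible rho' -> character rho <> character rho'.
Proof.
move=> [pB [i [j [n1 n2]]]] p0 rS rG rS' rR chE.
have tE x : \tr (rho x) = \tr (rho' x) by exact: (congr1 (fun f => f x) chE).
have ts k : \tr (rho' (s k)) = c%:C by rewrite -tE rG trace_gen_mx.
have [_ _ rM] := rS.
suff B1 : Bpair p.1 (col i p.2) (col j p.2) ^+ 2 = 1.
  by have [] := Bpair_sqr1 p0 (pB i) (pB j) B1.
have s2 := sina2 hc; have s0 : sina ^+ 2 != 0 by rewrite sqrf_eq0 sina_neq0.
have := reducible_trace rS' rR (ts i) (ts j).
rewrite -tE rM !rG trace_gen_mxM//.
have -> : 2 = (2 : R)%:C :> C by rewrite (rmorph_nat (real_complex R)).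
have -> : c%:C ^+ 2 - (2 : R)%:C = (c ^+ 2 - 2)%:C by rewrite rmorphB rmorphXn.
set B := Bpair _ _ _ => -[] /complexI H.
  suff -> : B = -1 by rewrite sqrrN expr1n.
  by apply: (mulfI s0); move: H; rewrite s2 expr_div_n; lra.
suff -> : B = 1 by rewrite expr1n.
by apply: (mulfI s0); move: H; rewrite s2 expr_div_n; lra.
Qed.

End ZeroSlice.

(** * The diffeomorphism *)

Section ReducibleLocus.
Context {R : realType} {F : groupType} {n : nat}.
Variables (c : R) (s : 'I_n -> F).
Hypotheses (hc : -2 < c < 2) (hF : free_on s).
Variable (i0 : 'I_n).
Local Notation C := R[i].
Local Notation rep := (rep_coord s).
Local Notation M := (RcU0 c s).
Local Notation E := (@AutU0_equiv R F).
Local Notation q := (eclass M E).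
Local Notation qr := (eclass (@Rbar R n) (@Rbar_equiv R n)).
Local Notation alpha_of := (alpha_of c).
Implicit Types (rho : F -> U0 R) (p : R * 'M[R]_(3, n)).

Lemma Rbar_pt p : p.1 = 0 -> p = (0, p.2).
Proof. by case: p => t V /= ->. Qed.

Lemma qrE p p' : Rbar p -> Rbar p' -> qr p = qr p' <-> Rbar_equiv p p'.
Proof.
move=> Rp Rp'; split=> [qE|pp'].
  by have : qr p' p' by [split=> //; exact: rst_refl]; rewrite -qE => -[].
rewrite eqEsubset; split=> x [Rx xE]; split=> //.
  by apply: rst_trans xE; exact: rst_sym.
exact: rst_trans pp' xE.
Qed.

Lemma qr_zero p p' : Rbar p -> qr p p' -> p'.1 = 0 <-> p.1 = 0.
Proof. by move=> Rp [Rp' /(Rbar_equiv_sim hc)[H _]]; exact: iff_sym. Qed.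

(** [pi_c] chooses among all representatives of the class, so the chosen [p'] may differ from [p].
    The chosen representation agrees on the generators with the U_0 representation built from [p'],
    hence equals it. *)
Lemma pi_c_zero p : Rbar p -> p.1 = 0 -> exists p' rho,
  [/\ qr p p', M rho, rep rho = alpha_of p'.2 & pi_c c s (qr p) = U0_character rho].
Proof.
move=> Rp p0.
have gen p' rho : qr p p' -> M rho -> rep rho = alpha_of p'.2 ->
    forall i, U0mx (rho (s i)) = gen_mx c p'.1 (col i p'.2).
  move=> pp' Mr rE i; have p0' : p'.1 = 0 by apply/(qr_zero Rp pp').
  have [Rp' _] := pp'; move: Rp'; rewrite (Rbar_pt p0') => Rp'.
  rewrite /=; exact: (alpha_gen hc (((Rbar0P hc i0 _).1 Rp').1 i) rE).
have real p' : qr p p' -> exists rho, M rho /\ rep rho = alpha_of p'.2.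
  move=> pp'; have p0' : p'.1 = 0 by apply/(qr_zero Rp pp').
  by have [Rp' _] := pp'; apply: (alpha_realize hc hF i0); rewrite -Rbar_pt.
set S := [set chi : F -> C | exists p' (rho : F -> 'M[C]_2), [/\ qr p p', SL2_rep rho,
  forall i, rho (s i) = gen_mx c p'.1 (col i p'.2) & chi = character rho]].
have : S (pi_c c s (qr p)).
  have qp : qr p p by split=> //; exact: rst_refl.
  have [rho [Mr rE]] := real _ qp.
  apply: (@xgetPex _ (fun=> 0) S); exists (U0_character rho), p, (fun x => U0mx (rho x)).
  by split=> //; [exact: (U0_SL2_rep (RcU0_morph Mr))|exact: gen].
move=> [p' [rho' [pp' rS rG ->]]]; have [rho [Mr rE]] := real _ pp'.
exists p', rho; split=> //; congr character; apply: (SL2_rep_eq hF rS).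
  exact: (U0_SL2_rep (RcU0_morph Mr)).
by move=> i; rewrite rG (gen _ _ pp' Mr rE).
Qed.

Lemma calX_redP p : Rbar p -> calX_red c s (qr p) <-> p.1 = 0.
Proof.
move=> Rp; split=> [[_ [XC [rho' [rS' rR chE]]]]|p0].
  apply: contrapT => /eqP p0.
  set S := [set chi : F -> C | exists p' (rho : F -> 'M[C]_2), [/\ qr p p', SL2_rep rho,
    forall i, rho (s i) = gen_mx c p'.1 (col i p'.2) & chi = character rho]].
  (* If there is no candidate, [pi_c] takes its default value, the zero function; this is no
     character, since a character is 2 at the identity. *)
  have [[chi Schi]|nS] := pselect (exists chi, S chi).
    have := @xgetPex _ (fun=> 0) S (ex_intro _ _ Schi).
    rewrite -[xget _ _]/(pi_c c s (qr p)) => -[p' [rho [pp' rS rG piE]]].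
    have [Rp' _] := pp'.
    apply: (nonzero_slice_irreducible hc Rp' _ rS rG rS' rR); last by rewrite -piE.
    by apply: contraNneq p0 => p0'; apply/eqP/(qr_zero Rp pp').
  have pi0 : pi_c c s (qr p) = fun=> 0.
    by rewrite /pi_c xgetPN// => chi Schi; apply: nS; exists chi.
  have [_ r1 _] := rS'.
  have := congr1 (fun f => f 1%g) chE; rewrite pi0 /character r1 mxtrace1 => /eqP.
  by rewrite eq_sym pnatr_eq0.
have [p' [rho [_ Mr _ piE]]] := pi_c_zero Rp p0.
have rS := U0_SL2_rep (RcU0_morph Mr).
split; first by exists p.
rewrite piE; split; last first.
  by exists (fun x => U0mx (rho x)); split=> //; exact: U0_reducible.
exists (fun x => U0mx (rho x)); split=> //; first by move=> i; have [] := Mr.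
by move=> x; rewrite /U0_character /character trace_U0.
Qed.

(** All zero-slice representatives of [D] are used, so no choice has to be shown harmless;
    [U0_classesE] shows that the result is a single class. *)
Definition U0_classes (D : set (R * 'M[R]_(3, n))) : set (F -> U0 R) :=
  [set rho | M rho /\ exists p, [/\ D p, p.1 = 0 & sim (alpha_of p.2) (rep rho)]].

Lemma U0_classesE p rho : Rbar p -> p.1 = 0 -> M rho -> rep rho = alpha_of p.2 ->
  U0_classes (qr p) = q rho.
Proof.
move=> Rp p0 Mr rE; rewrite eqEsubset; split=> rho' [Mr'].
  move=> [p' [[_ /(Rbar_equiv_sim hc)[_ /(_ p0) pp']] _ sp]]; split=> //.
  by apply/(RcU0_equivP hF Mr Mr'); rewrite rE; exact: sim_trans pp' sp.
move/(RcU0_equivP hF Mr Mr'); rewrite rE => sp; split=> //.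
exists p; split; [split; [exact: Rp|exact: rst_refl]|exact: p0|exact: sp].
Qed.

Lemma U0_classes_inj C C' : calX_red c s C -> calX_red c s C' ->
  U0_classes C = U0_classes C' -> C = C'.
Proof.
move=> CX CX'; have [[p Rp pC] _] := CX; have [[p' Rp' pC'] _] := CX'; subst C C'.
have p0 := (calX_redP Rp).1 CX; have p0' := (calX_redP Rp').1 CX'.
have [rho [Mr rE]] : exists rho, M rho /\ rep rho = alpha_of p.2.
  by apply: (alpha_realize hc hF i0); rewrite -Rbar_pt.
have [rho' [Mr' rE']] : exists rho, M rho /\ rep rho = alpha_of p'.2.
  by apply: (alpha_realize hc hF i0); rewrite -Rbar_pt.
rewrite (U0_classesE Rp p0 Mr rE) (U0_classesE Rp' p0' Mr' rE').
move/(eclassE Mr Mr')/(RcU0_equivP hF Mr Mr'); rewrite rE rE' => sE.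
apply/qrE => //; rewrite (Rbar_pt p0) (Rbar_pt p0').
exact: (sim_Rbar_equiv hc).
Qed.

Lemma U0_classes_character C rho : calX_red c s C -> U0_classes C rho ->
  U0_character rho = pi_c c s C.
Proof.
move=> CX; have [[p Rp pC] _] := CX; subst C; have p0 := (calX_redP Rp).1 CX.
have [p' [rho' [[Rp' pp'] Mr' rE' ->]]] := pi_c_zero Rp p0.
move=> [Mr [p1 [[Rp1 pp1] _ sp1]]]; apply: (sim_character hF Mr' Mr).
rewrite rE'; apply: sim_trans sp1.
have p0' : p'.1 = 0 by apply/(qr_zero Rp).
have /(Rbar_equiv_sim hc)[_ H] : Rbar_equiv p' p1 by apply: rst_trans pp1; exact: rst_sym.
exact: H.
Qed.

Variable A : set (chart R (set (R * 'M[R]_(3, n))) (2 * n - 3)).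
Hypothesis hA : quotient_structure (@Rbar R n) (@Rbar_atlas R n) (@Rbar_equiv R n) A.

Lemma U0_classes_diffeomorphism :
  diffeomorphism (calX_red c s) (submfd_atlas (k := (2 * n - 4)%N) A (calX_red c s))
    (XcU0 c s) (good_chart (d := (2 * n - 4)%N) M rep E) U0_classes.
Proof.
apply: (quotient_diffeomorphism hA (smooth_alpha_coord c) (smooth_beta_coord c)).
- by move=> D [].
- move=> p Rp /(calX_redP Rp) p0.
  have [rho [Mr rE]] : exists rho, M rho /\ rep rho = alpha_of p.2.
    by apply: (alpha_realize hc hF i0); rewrite -Rbar_pt.
  by exists rho; rewrite alpha_coordE; split=> //; exact: U0_classesE.
- move=> rho Mr; have Rp := Rbar_beta hc hF i0 Mr.
  exists (0, beta_of c (rep rho)); split.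
  + exact: Rp.
  + by apply/(calX_redP Rp).
  + by [].
  + exact: (U0_classesE Rp _ Mr (esym (alpha_beta hc Mr))).
- exact: U0_classes_inj.
- move=> rho Mr; have [[_ cov _ _ _] _] := XcU0_structure hc hF i0.
  by have [|b gb br] := cov (q rho); [exists rho|exists b].
Qed.

End ReducibleLocus.

Theorem theorem8p4 (R : realType) (n : nat) (c : R) (F : groupType)
    (s : 'I_n -> F) (n2 : (2 <= n)%N) (hc : -2 < c < 2) (hF : free_on s)
    (A : set (chart R (set (R * 'M[R]_(3, n))) (2 * n - 3)))
    (hA : quotient_structure (@Rbar R n) (@Rbar_atlas R n) (@Rbar_equiv R n) A) :
  [/\ AutU0_acts c s, AutU0_free c s, AutU0_proper c s
    & exists B : set (chart R (set (F -> U0 R)) (2 * n - 4)),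
        unique (quotient_structure (RcU0 c s) (RcU0_atlas c s)
                  (@AutU0_equiv R F)) B /\
        exists Phi : set (R * 'M[R]_(3, n)) -> set (F -> U0 R),
          diffeomorphism (calX_red c s)
            (submfd_atlas (k := (2 * n - 4)%N) A (calX_red c s))
            (XcU0 c s) B Phi /\
          forall C rho, calX_red c s C -> Phi C rho ->
            U0_character rho = pi_c c s C].
Proof.
pose i0 : 'I_n := Ordinal (ltnW n2).
split.
- exact: (AutU0_acts_RcU0 hc hF i0).
- exact: (AutU0_free_RcU0 hc hF i0).
- exact: (AutU0_proper_RcU0 hc hF i0).
exists (good_chart (RcU0 c s) (rep_coord s) (@AutU0_equiv R F)); split.
  split; first exact: (XcU0_structure hc hF i0).
  by move=> Q hQ; rewrite (quotient_structure_unique hQ).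
exists (U0_classes c s); split.
  exact: (U0_classes_diffeomorphism hc hF i0 hA).
exact: (U0_classes_character hc hF i0).
Qed.
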